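(* Let $\Gamma$ be a loopless $3$-edge connected metric graph of genus at least $2$, with canonical model $(G_0,l_0)$. The following are equivalent. (A) $|V(G_0)|\in\{2,3\}$, or $\Gamma$ is strictly trigonal, i.e. there is a non-degenerate harmonic morphism of degree $3$ from $\Gamma$ itself to a metric tree. (B) $\Gamma$ is divisorially trigonal, i.e. there is a divisor on $\Gamma$ of degree $3$ and rank at least $1$.
   Context: Graphs are finite and connected; multiple edges and loops are allowed. The valence of a vertex is the number of incident edges, loops counted twice. $E_v(G)$ denotes the set of edges incident to $v$. The genus of a graph is $b_1(G)=|E(G)|-|V(G)|+1$. A metric graph $\Gamma$ is a metric space obtained from a graph $G$ and a length function $l:E(G)\to\mathbb R_{>0}$ by gluing intervals $[0,l(e)]$ according to $G$; $(G,l)$ is called a model of $\Gamma$ and we write $\Gamma=(G,l)$. For genus $\ge 2$, the canonical model $(G_0,l_0)$ of $\Gamma$ is obtained by iteratively removing all vertices of valence $1$ with their adjacent edge, and all vertices of valence $2$ (replacing their two adjacent edges by one edge whose length is the sum). $\Gamma$ is loopless if no model of it has a loop edge. $\Gamma$ is $k$-edge connected if its canonical model is, i.e. if $G_0$ stays connected after removing any $k-1$ edges. A metric tree is a metric graph whose models are trees. A morphism of graphs $\varphi:G\to G'$ is a map $V(G)\cup E(G)\to V(G')\cup E(G')$ with $\varphi(V(G))\subseteq V(G')$ such that for $e=xy\in E(G)$: if $\varphi(e)\in V(G')$ then $\varphi(e)=\varphi(x)=\varphi(y)$; if $\varphi(e)\in E(G')$ then $\varphi(e)=\varphi(x)\varphi(y)$.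 It is indexed if each $e\in E(G)$ carries an integer $\mu_\varphi(e)\ge 0$ with $\mu_\varphi(e)=0$ iff $\varphi(e)\in V(G')$. It is harmonic if for every $x\in V(G)$ the number $m_\varphi(x)=\sum_{e\in E_x(G),\,\varphi(e)=e'}\mu_\varphi(e)$ is the same for all $e'\in E_{\varphi(x)}(G')$ (with $m_\varphi(x)=0$ if the sum is over the empty set). It is non-degenerate if it contracts no loops and $m_\varphi(x)\ge 1$ for all $x\in V(G)$. Its degree is $\sum_{e\in E(G),\,\varphi(e)=e'}\mu_\varphi(e)$, independent of $e'\in E(G')$. A morphism of metric graphs from $\Gamma$ to $\Gamma'$ is induced by an indexed morphism $\varphi:G\to G'$ between models $(G,l)$, $(G',l')$ (any models may be chosen) with $\mu_\varphi(e)=l'(\varphi(e))/l(e)\in\mathbb Z$ whenever $\varphi(e)\in E(G')$ (and $\mu_\varphi(e)=0$ otherwise); it is continuous and linear along edges. It is harmonic, non-degenerate, of degree $d$ if $\varphi$ is. A divisor on $\Gamma$ is a finite formal sum $D=\sum_{x\in\Gamma}D(x)x$, $D(x)\in\mathbb Z$, with degree $\sum D(x)$; it is effective if all $D(x)\ge0$. A rational function is a continuous piecewise linear $f:\Gamma\to\mathbb R$ with integer slopes; $\operatorname{div}(f)(x)$ is the sum of the outgoing slopes of $f$ at $x$. $D\sim D'$ if $D-D'=\operatorname{div}(f)$ for some $f$. The rank is $\operatorname{rk}(D)=-1$ if $D$ is not equivalent to an effective divisor, and otherwise the largest $k\ge0$ such that for every effective $E$ of degree $k$, $D-E$ is equivalent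 to an effective divisor.
   Formalization: The canonical model (G_0,l_0) is required to be a model of Γ itself, so Γ has no dangling trees; with dangling trees the equivalence fails, e.g. for K4 with distinct lengths at one vertex and ten leaf edges attached there. *)

(* Defs.v *)
From HB Require Import structures.
From Stdlib Require Import Relation_Operators.
From mathcomp Require Import all_boot all_order all_algebra.
From mathcomp Require Import all_classical all_reals all_analysis.

Set Implicit Arguments.
Unset Strict Implicit.
Unset Printing Implicit Defensive.

Import Order.TTheory GRing.Theory Num.Theory.
Import numFieldNormedType.Exports.

Local Open Scope classical_set_scope.
Local Open Scope ring_scope.

Definition same_ends (V : Type) (p q : V * V) : Prop :=
  p = q \/ p = (q.2, q.1).

(* [adj src tgt S] is adjacency in the graph with the edges of [S] removed. *)
Definition adj (V E : finType) (src tgt : E -> V) (S : {set E}) : rel V :=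
  fun x y => [exists e, (e \notin S) &&
    (((src e == x) && (tgt e == y)) || ((src e == y) && (tgt e == x)))].

(* The orientation [src] -> [tgt] of an edge is auxiliary: it only fixes how
   the interval [0, l(e)] is glued. *)
Record graph := Graph {
  vert : finType;
  edge : finType;
  src : edge -> vert;
  tgt : edge -> vert;
  vert_gt0 : (0 < #|vert|)%N;
  graph_conn : forall x y : vert, connect (adj src tgt finset.set0) x y
}.

Section GraphNotions.
Variable G : graph.

Definition ends (e : edge G) : vert G * vert G := (src e, tgt e).

Definition incident (e : edge G) (v : vert G) : bool :=
  (src e == v) || (tgt e == v).

Definition is_loop (e : edge G) : bool := src e == tgt e.

Definition valence (v : vert G) : nat :=
  (#|[pred e : edge G | src e == v]| + #|[pred e : edge G | tgt e == v]|)%N.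

(* Truncation is harmless: |V| <= |E| + 1 in a connected graph. *)
Definition genus : nat := (#|edge G|.+1 - #|vert G|)%N.

Definition is_tree : Prop := genus = 0%N.

Definition edge_connected (k : nat) : Prop :=
  forall S : {set edge G}, #|S| = k.-1 ->
    forall x y : vert G, connect (adj (@src G) (@tgt G) S) x y.

End GraphNotions.

Record indexed_morphism (G G' : graph) := IndexedMorphism {
  mapV : vert G -> vert G';
  mapE : edge G -> vert G' + edge G';
  edge_index : edge G -> nat;
  mapE_vert : forall e w, mapE e = inl w ->
    mapV (src e) = w /\ mapV (tgt e) = w;
  mapE_edge : forall e e', mapE e = inr e' ->
    same_ends (ends e') (mapV (src e), mapV (tgt e));
  edge_index_eq0 : forall e, edge_index e = 0%N <-> exists w, mapE e = inl w
}.

Section Harmonic.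
Variables (G G' : graph) (phi : indexed_morphism G G').

(* A loop at [x] is a single element of E_x(G), so it is counted once here,
   unlike in [valence]. *)
Definition local_sum (x : vert G) (e' : edge G') : nat :=
  (\sum_(e | incident e x && (mapE phi e == inr e')) edge_index phi e)%N.

Definition is_harmonic : Prop :=
  forall (x : vert G) (e' e'' : edge G'),
    incident e' (mapV phi x) -> incident e'' (mapV phi x) ->
    local_sum x e' = local_sum x e''.

Definition local_degree (x : vert G) : nat :=
  if [pick e' | incident e' (mapV phi x)] is Some e' then local_sum x e'
  else 0%N.

Definition is_nondegenerate : Prop :=
  (forall (e : edge G) (w : vert G'), is_loop e -> mapE phi e <> inl w) /\
  (forall x : vert G, (1 <= local_degree x)%N).

Definition degree : nat :=
  if [pick e' : edge G'] is Some e' then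
    (\sum_(e | mapE phi e == inr e') edge_index phi e)%N
  else 0%N.

End Harmonic.

(* A metric graph is handled through a presentation (G,l); the metric space
   itself is [mg_point] with the distance [dist], and two presentations are
   models of the same metric graph when these spaces are isometric. *)

Record model (R : realType) := Model {
  mgraph :> graph;
  len : edge mgraph -> R;
  len_gt0 : forall e, 0 < len e
}.

Section MetricGraph.
Context {R : realType}.

Inductive mg_point (M : model R) : Type :=
| Vtx (v : vert M)
| Inn (e : edge M) (t : R) (h : 0 < t < len e).

HB.instance Definition _ (M : model R) := gen_eqMixin (mg_point M).
HB.instance Definition _ (M : model R) := gen_choiceMixin (mg_point M).

(* The image in the metric graph of the parameter [t] of the interval
   [0, l(e)]; parameters outside the interval are clamped to its ends. *)
Definition edge_point (M : model R) (e : edge M) (t : R) : mg_point M :=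
  match @idP (0 < t < len e) with
  | ReflectT h => Inn h
  | ReflectF _ => if t <= 0 then Vtx (src e) else Vtx (tgt e)
  end.

(* [(e, a, b)] is the piece of a path that runs along [e] from [a] to [b]. *)
Fixpoint chain (M : model R) (x : mg_point M) (s : seq (edge M * R * R))
    (y : mg_point M) : Prop :=
  if s is (e, a, b) :: s' then
    [/\ 0 <= a <= len e, 0 <= b <= len e, edge_point e a = x
      & chain (edge_point e b) s' y]
  else x = y.

Definition chain_length (M : model R) (s : seq (edge M * R * R)) : R :=
  \sum_(p <- s) `|p.1.2 - p.2|.

Definition dist (M : model R) (x y : mg_point M) : R :=
  inf [set r | exists2 s, chain x s y & r = chain_length s].

Definition is_model (Gam H : model R) : Prop :=
  exists psi : mg_point H -> mg_point Gam,
    bijective psi /\ forall x y, dist (psi x) (psi y) = dist x y.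

Definition loopless (Gam : model R) : Prop :=
  forall H, is_model Gam H -> forall e : edge H, ~~ is_loop e.

Definition metric_tree (Gam : model R) : Prop :=
  forall H, is_model Gam H -> is_tree H.

(* The reduction steps are relations because their result only matters up to
   relabelling of its vertices and edges and reversal of its edges. *)
Definition prune_step (M M' : model R) : Prop :=
  exists (v : vert M) (iV : vert M' -> vert M) (iE : edge M' -> edge M),
    [/\ valence v = 1%N, injective iV, injective iE,
        forall x, (x \in codom iV) = (x != v) &
        forall e, (e \in codom iE) = ~~ incident e v] /\
    forall e, same_ends (ends (iE e)) (iV (src e), iV (tgt e)) /\
      len (iE e) = len e.

(* The edges [e1] and [e2] at [v] are replaced by [e0]; [iE] sends [e0] to [e1]
   and misses [e2].  As [e1] and [e2] are distinct and [v] has valence 2,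
   neither of them is a loop. *)
Definition merge_step (M M' : model R) : Prop :=
  exists (v a b : vert M) (e1 e2 : edge M) (e0 : edge M')
      (iV : vert M' -> vert M) (iE : edge M' -> edge M),
    [/\ valence v = 2%N, e1 != e2,
        same_ends (ends e1) (a, v) & same_ends (ends e2) (v, b)] /\
    [/\ injective iV, injective iE,
        forall x, (x \in codom iV) = (x != v) &
        forall e, (e \in codom iE) = (e != e2)] /\
    [/\ iE e0 = e1, same_ends (a, b) (iV (src e0), iV (tgt e0)) &
        len e0 = len e1 + len e2] /\
    forall e, e != e0 ->
      same_ends (ends (iE e)) (iV (src e), iV (tgt e)) /\ len (iE e) = len e.

Definition reduces : model R -> model R -> Prop :=
  clos_refl_trans (model R) (fun M M' => prune_step M M' \/ merge_step M M').

(* The result of the reduction is required to be a model of [Gam] itself.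
   Pruning a vertex of valence 1 changes the metric space, so this says that
   [Gam] has no dangling trees. *)
Definition canonical_model (Gam M0 : model R) : Prop :=
  [/\ is_model Gam M0,
      exists2 M, is_model Gam M & reduces M M0 &
      forall v : vert M0, valence v != 1%N /\ valence v != 2%N].

Definition metric_morphism (H H' : model R) (phi : indexed_morphism H H') :
    Prop :=
  forall (e : edge H) (e' : edge H'), mapE phi e = inr e' ->
    (edge_index phi e)%:R = len e' / len e.

Definition strictly_trigonal (Gam : model R) : Prop :=
  exists T : model R, metric_tree T /\
  exists (H H' : model R) (phi : indexed_morphism H H'),
    [/\ is_model Gam H, is_model T H' & metric_morphism phi] /\
    [/\ is_harmonic phi, is_nondegenerate phi & degree phi = 3%N].

Section Divisors.
Variable Gam : model R.
Implicit Types (D E : mg_point Gam -> int) (f : mg_point Gam -> R).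

Definition is_divisor D : Prop := finite_set [set x | D x != 0].

Definition div_degree D : int := \sum_(x \in [set: mg_point Gam]) D x.

Definition effective D : Prop := is_divisor D /\ forall x, 0 <= D x.

(* Each restriction of [f] to an interval [0, l(e)] is affine with integer
   slope between consecutive terms of a subdivision 0 < s_1 < ... < s_n = l(e);
   continuity holds because the pieces are closed intervals. *)
Definition rational_function f : Prop :=
  forall e : edge Gam, exists s : seq R,
    [/\ path <%R 0 s, last 0 s = len e &
        forall i, (i < size s)%N -> exists k : int, forall t : R,
          nth 0 (0 :: s) i <= t <= nth 0 s i ->
          f (edge_point e t) = f (edge_point e (nth 0 (0 :: s) i))
                         + k%:~R * (t - nth 0 (0 :: s) i)].

(* The slope of [f] on leaving the parameter [t] of [e] in the direction
   [sg] = 1 or -1; unique for a rational function, if the direction stays in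
   the interval. *)
Definition out_slope f (e : edge Gam) (t sg : R) : int :=
  xget 0 [set k : int | \forall h \near (0 : R)^'+,
            f (edge_point e (t + sg * h)) = f (edge_point e t) + k%:~R * h].

(* A loop at [v] contributes two outgoing slopes, one in each sum. *)
Definition div_of f (x : mg_point Gam) : int :=
  match x with
  | Vtx v => \sum_(e : edge Gam | src e == v) out_slope f e 0 1
             + \sum_(e : edge Gam | tgt e == v) out_slope f e (len e) (-1)
  | Inn e t _ => out_slope f e t 1 + out_slope f e t (-1)
  end.

Definition lin_equiv D E : Prop :=
  exists2 f, rational_function f & forall x, D x - E x = div_of f x.

Definition equiv_effective D : Prop := exists2 E, effective E & lin_equiv D E.

Definition rank_ge D (k : nat) : Prop :=
  forall E, effective E -> div_degree E = k%:Z -> equiv_effective (D \- E).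

Definition is_rank D (r : int) : Prop :=
  (~ equiv_effective D /\ r = -1) \/
  (equiv_effective D /\ exists k : nat,
     [/\ r = k%:Z, rank_ge D k & forall j, rank_ge D j -> (j <= k)%N]).

Definition divisorially_trigonal : Prop :=
  exists D, [/\ is_divisor D, div_degree D = 3 &
                exists2 r, is_rank D r & 1 <= r].

End Divisors.
End MetricGraph.

(* Main.v *)
(** Only the isometry between Gam and M0, looplessness and 3-edge-connectivity
    matter, since the divisor of a rational function can be read off the spheres
    of small radius and is therefore invariant under isometries.

    If |V| is 2 or 3, the sum of all vertices (plus one more chip) has rank at
    least 1, because two chips at the ends of an edge can be moved to any pair of
    points symmetric about its midpoint.  If phi is a morphism of degree 3 to a
    tree, the fibres of phi are linearly equivalent and cover everything except
    contracted edges, which are reached from their distinct ends.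

    Conversely let |V| >= 4.  For each vertex v choose D_v = v + a + b in the
    given class, where a and b are not interior to the same edge, and subdivide
    so that all these divisors are supported on vertices.  Let f be a function
    with D_v - D_w = div f nonzero.  A level set of f is a cut, through which at
    most 3 units flow; by 3-edge-connectivity it consists of exactly three edges
    of slope 1, so D_v sits at the minimum of f and D_w at the maximum.  Hence
    distinct D_v have disjoint supports.  If an edge joins the supports of D_v
    and D_w, then f takes only two values, so that exactly three edges, of equal
    length, join these supports.  Contracting the edges within each support and
    identifying such triples of edges gives a harmonic morphism of degree 3 to a
    graph in which every edge is a bridge. *)

From HB Require Import structures.
From mathcomp Require Import all_boot all_order all_algebra.
From mathcomp Require Import all_classical all_reals all_analysis.
From mathcomp Require Import ring lra zify.
Require Import Defs.

Set Implicit Arguments.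
Unset Strict Implicit.
Unset Printing Implicit Defensive.

Import Order.TTheory GRing.Theory Num.Theory.
Import numFieldNormedType.Exports.

Local Open Scope classical_set_scope.
Local Open Scope ring_scope.

(** * Paths and distances *)

Section Points.
Context {R : realType}.
Implicit Types (M : model R).

(** Edge-connectivity is given on M0 and the other hypotheses on Gam. Distances are infima over
    chains, so lower bounds come from explicit 1-Lipschitz tents; with these, small spheres recover
    the directions at a point. In the converse the obstacle is that 3-edge-connectivity is lost
    under subdivision: a set of new vertices inside m open edges may have only 2m boundary edges.
    This is why a and b must not be interior to the same edge. Such a set then holds at most one
    chip if m = 1 and at most two otherwise, fewer than the 2m needed for a slope of at least 1 on
    every boundary edge. That f has only two values when an edge joins two supports is tested
    against a third divisor D_z with z in its support: along that edge the slope 1 of f splits into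
    two slopes in {-1, 0, 1}, one of which must vanish. A support has at most three points, so |V|
    >= 4 yields two distinct divisors. The target is shown to be a tree by orienting its edges
    towards a root and counting them. *)

Lemma edge_point0 M (e : edge M) : edge_point e 0 = Vtx (src e).
Proof. by rewrite /edge_point; destruct idP as [h|]; [exfalso; move: h; rewrite ltxx | rewrite lexx]. Qed.

Lemma edge_point_len M (e : edge M) : edge_point e (len e) = Vtx (tgt e).
Proof.
rewrite /edge_point; destruct idP as [h|]; last by rewrite leNgt len_gt0.
by exfalso; move: h; rewrite ltxx andbF.
Qed.

Lemma edge_pointE M (e : edge M) t (h : 0 < t < len e) :
  edge_point e t = Inn h.
Proof.
rewrite /edge_point; destruct idP as [h'|]; last by [].
by rewrite (bool_irrelevance h' h).
Qed.

Lemma Inn_inj M (e e' : edge M) t t' (h : 0 < t < len e) (h' : 0 < t' < len e') :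
  Inn h = Inn h' -> e = e' /\ t = t'.
Proof. by case. Qed.

Lemma edge_point_interior M (e e' : edge M) t t' :
  0 < t < len e -> 0 <= t' <= len e' -> edge_point e t = edge_point e' t' ->
  e' = e /\ t' = t.
Proof.
move=> h; rewrite !le_eqVlt => /andP[/predU1P[<-|t0]].
  by rewrite edge_point0 edge_pointE.
move=> /predU1P[->|t1]; first by rewrite edge_point_len edge_pointE.
have h' : 0 < t' < len e' by rewrite t0.
by rewrite !edge_pointE => /Inn_inj[-> ->].
Qed.

Lemma edge_point_Vtx M (e : edge M) t v : 0 <= t <= len e ->
  edge_point e t = Vtx v -> (t = 0 /\ src e = v) \/ (t = len e /\ tgt e = v).
Proof.
rewrite !le_eqVlt => /andP[/predU1P[<-|t0]].
  by rewrite edge_point0 => _ [<-]; left.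
move=> /predU1P[->|t1]; first by rewrite edge_point_len => -[<-]; right.
by rewrite edge_pointE ?t0.
Qed.

Lemma edge_ind M (e : edge M) (P : R -> Prop) :
  P 0 -> P (len e) -> (forall t, 0 < t < len e -> P t) ->
  forall t, 0 <= t <= len e -> P t.
Proof.
move=> P0 P1 PI t; rewrite !le_eqVlt => /andP[/predU1P[<-//|t0]].
by move=> /predU1P[->//|t1]; apply: PI; rewrite t0.
Qed.

Lemma chain_cat M (x y z : mg_point M) s1 s2 :
  chain x s1 y -> chain y s2 z -> chain x (s1 ++ s2) z.
Proof.
elim: s1 x => [|[[e a] b] s1 IH] x /=; first by move=> ->.
by move=> [? ? ? c1] c2; split=> //; apply: IH c2.
Qed.

Lemma chain1 M (e : edge M) a b : 0 <= a <= len e -> 0 <= b <= len e ->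
  chain (edge_point e a) [:: (e, a, b)] (edge_point e b).
Proof. by []. Qed.

Lemma chain_sym M (x y : mg_point M) s : chain x s y -> exists s', chain y s' x.
Proof.
elim: s x => [|[[e a] b] s IH] x /=; first by move=> ->; exists [::].
move=> [ha hb <- /IH[s' c']]; exists (s' ++ [:: (e, b, a)]).
by apply: chain_cat c' _; apply: chain1.
Qed.

Lemma len_ge0 M (e : edge M) : 0 <= len e. Proof. exact/ltW/len_gt0. Qed.

Lemma chain_to_vtx M (x : mg_point M) : exists v s, chain x s (Vtx v).
Proof.
case: x => [v|e t h]; first by exists v, [::].
exists (src e), [:: (e, t, 0)].
by rewrite /= (edge_pointE h) edge_point0 lexx len_ge0; split=> //; case/andP: h => /ltW-> /ltW->.
Qed.

Lemma chain_edge M (e : edge M) : exists s, chain (Vtx (src e)) s (Vtx (tgt e)).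
Proof.
exists [:: (e, 0, len e)]; rewrite -edge_point0 -edge_point_len.
by apply: chain1; rewrite lexx len_ge0.
Qed.

Lemma chain_vtx M (v w : vert M) : exists s, chain (Vtx v) s (Vtx w).
Proof.
have /connectP[p pth ->] := graph_conn v w.
elim: p v pth => [|u p IH] v /=; first by exists [::].
move=> /andP[/existsP[e /andP[_ h]] /IH[s c]].
have [s' c'] : exists s', chain (Vtx v) s' (Vtx u).
  case/orP: h => /andP[/eqP<- /eqP<-]; first exact: chain_edge.
  have [s' c'] := chain_edge e; exact: chain_sym c'.
by exists (s' ++ s); apply: chain_cat c.
Qed.

Lemma chain_exists M (x y : mg_point M) : exists s, chain x s y.
Proof.
have [v [s1 c1]] := chain_to_vtx x; have [w [s2 c2]] := chain_to_vtx y.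
have [s3 c3] := chain_vtx v w; have [s4 c4] := chain_sym c2.
by exists (s1 ++ (s3 ++ s4)); apply: chain_cat c1 (chain_cat c3 c4).
Qed.

Lemma chain_length_ge0 M (s : seq (edge M * R * R)) : 0 <= chain_length s.
Proof. by apply: sumr_ge0. Qed.

Lemma dist_le M (x y : mg_point M) s : chain x s y -> dist x y <= chain_length s.
Proof.
move=> c; apply: ge_inf; last by exists s.
by exists 0 => _ [s' _ ->]; apply: chain_length_ge0.
Qed.

Lemma le_dist M (x y : mg_point M) r :
  (forall s, chain x s y -> r <= chain_length s) -> r <= dist x y.
Proof.
move=> h; apply: lb_le_inf; last by move=> _ [s c ->]; apply: h.
by have [s c] := chain_exists x y; exists (chain_length s), s.
Qed.

Lemma dist_ge0 M (x y : mg_point M) : 0 <= dist x y.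
Proof. by apply: le_dist => s _; apply: chain_length_ge0. Qed.

Definition edge_lipschitz M (F : mg_point M -> R) := forall (e : edge M) a b,
  0 <= a <= len e -> 0 <= b <= len e ->
  `|F (edge_point e a) - F (edge_point e b)| <= `|a - b|.

(** The variation of [F] telescopes along any chain; this is the source of all lower bounds on
    [dist]. *)
Lemma lipschitz_dist M (F : mg_point M -> R) : edge_lipschitz F ->
  forall x y, F x - F y <= dist x y.
Proof.
move=> lF x y; apply: le_dist => s; elim: s x => [|[[e a] b] s IH] x /=.
  by move=> ->; rewrite subrr /chain_length big_nil.
move=> [ha hb <- /IH]; rewrite /chain_length big_cons /=.
have := lF e a b ha hb; move: (ler_norm (F (edge_point e a) - F (edge_point e b))).
lra.
Qed.

Lemma dist_edge_le M (e : edge M) a b : 0 <= a <= len e -> 0 <= b <= len e ->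
  dist (edge_point e a) (edge_point e b) <= `|a - b|.
Proof.
move=> ha hb; have := dist_le (chain1 ha hb).
by rewrite /chain_length big_seq1.
Qed.

Lemma dist_refl M (x : mg_point M) : dist x x = 0.
Proof.
apply/eqP; rewrite eq_le dist_ge0 andbT.
by have := @dist_le _ x x [::] erefl; rewrite /chain_length big_nil.
Qed.

End Points.

(** * Germs of directions at a point *)

Section Germs.
Context {R : realType}.
Implicit Types (M : model R).

(** Explicit form of the right filter at 0 used in [out_slope]: a concrete [eps] lets conditions be
    combined by minima and linear arithmetic. *)
Definition eventually0 (P : R -> Prop) :=
  exists2 eps, 0 < eps & forall h, 0 < h < eps -> P h.

Lemma eventually0P P : (\forall h \near (0 : R)^'+, P h) <-> eventually0 P.
Proof.
have e (u : R) : 0 < u -> `|0 - u| = u by move=> u0; rewrite sub0r normrN gtr0_norm.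
split=> [[eps /= eps0 h]|[eps eps0 h]].
  exists eps => // t /andP[t0 te]; apply: h => //=.
  by change (`|0 - (t : R)| < eps); rewrite e.
exists eps => //= t; change (`|0 - (t : R)| < eps -> 0 < (t : R) -> P t) => te t0.
by apply: h; rewrite t0 -[X in X < _]e.
Qed.

Lemma eventually0_and P Q :
  eventually0 P -> eventually0 Q -> eventually0 (fun h => P h /\ Q h).
Proof.
move=> [a a0 ha] [b b0 hb]; exists (Num.min a b); first by rewrite lt_min a0.
move=> h; rewrite lt_min => /and3P[h0 h1 h2].
by split; [apply: ha | apply: hb]; rewrite h0.
Qed.

Lemma eventually0_imp (P Q : R -> Prop) :
  (forall h, 0 < h -> P h -> Q h) -> eventually0 P -> eventually0 Q.
Proof.
by move=> PQ [a a0 ha]; exists a => // h hh; apply: PQ (ha _ hh); case/andP: hh.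
Qed.

Lemma eventually0_all (T : eqType) (s : seq T) (P : T -> R -> Prop) :
  (forall x, x \in s -> eventually0 (P x)) ->
  eventually0 (fun h => forall x, x \in s -> P x h).
Proof.
elim: s => [|x s IH] hs; first by exists 1.
have h1 := hs x (mem_head _ _).
have h2 := IH (fun y hy => hs y (mem_behead (s := x :: s) hy)).
apply: eventually0_imp (eventually0_and h1 h2) => h _ [p1 p2] y.
by rewrite inE => /predU1P[->|/p2].
Qed.

Lemma eventually0_ex P : eventually0 P -> exists2 h, 0 < h & P h.
Proof. by move=> [a a0 ha]; exists (a / 2); [lra | apply: ha; lra]. Qed.

Lemma eventually0_lt a : 0 < a -> eventually0 (fun h => h < a).
Proof. by move=> a0; exists a => // h /andP[]. Qed.

(* A germ [(e, t, sg)] is the direction [sg] = 1 or -1 at the parameter [t]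
   of [e]. *)
Definition germ M := (edge M * R * R)%type.

Definition is_germ M (g : germ M) : Prop :=
  [/\ 0 <= g.1.2 <= len g.1.1, g.2 = 1 \/ g.2 = -1,
      g.2 = 1 -> g.1.2 < len g.1.1 & g.2 = -1 -> 0 < g.1.2].

Definition germ_point M (g : germ M) (h : R) : mg_point M :=
  edge_point g.1.1 (g.1.2 + g.2 * h).

Definition germs M (x : mg_point M) : seq (germ M) :=
  match x with
  | Vtx v => [seq (e, 0, 1) | e <- enum [pred e : edge M | src e == v]] ++
             [seq (e, len e, -1) | e <- enum [pred e : edge M | tgt e == v]]
  | Inn e t _ => [:: (e, t, 1); (e, t, -1)]
  end.

Lemma neq1N1 : (1 == -1 :> R) = false.
Proof. by apply/negbTE; rewrite gt_eqF //; lra. Qed.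

Lemma germsP M (x : mg_point M) g :
  g \in germs x <-> is_germ g /\ edge_point g.1.1 g.1.2 = x.
Proof.
case: x => [v|e t h] /=; last first.
  rewrite !inE; split.
    case/orP => /eqP-> /=; rewrite edge_pointE; split=> //; case/andP: h => h1 h2;
      split=> //=; rewrite ?(ltW h1) ?(ltW h2) //; by [left | right].
  case: g => [[e' t'] sg] /= [[/= ht hs _ _] /esym].
  rewrite -(edge_pointE h) => /(edge_point_interior h ht)[-> ->].
  by case: hs => ->; rewrite eqxx ?orbT.
rewrite mem_cat; split.
  case/orP => /mapP[e]; rewrite mem_enum inE => /eqP ev -> /=.
    rewrite edge_point0 ev; split=> //; split=> //=; rewrite ?lexx ?len_ge0 ?len_gt0 //.
    - by left.
    - by move=> /eqP; rewrite neq1N1.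
  rewrite edge_point_len ev; split=> //; split=> //=; rewrite ?lexx ?len_ge0 ?len_gt0 //.
  - by right.
  - by move=> /esym/eqP; rewrite neq1N1.
case: g => [[e t] sg] /= [[/= ht hs h1 h2]] /(edge_point_Vtx ht)[[t0 ev]|[t0 ev]].
  apply/orP; left; apply/mapP; exists e; first by rewrite mem_enum inE ev.
  by case: hs => hs; [rewrite hs t0 | move: (h2 hs); rewrite t0 ltxx].
apply/orP; right; apply/mapP; exists e; first by rewrite mem_enum inE ev.
by case: hs => hs; [move: (h1 hs); rewrite t0 ltxx | rewrite hs t0].
Qed.

Lemma germs_uniq M (x : mg_point M) : uniq (germs x).
Proof.
case: x => [v|e t h] /=; last by rewrite inE !xpair_eqE neq1N1 !andbF.
rewrite cat_uniq !map_inj_uniq ?enum_uniq //=; try by move=> ? ? [].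
rewrite andbT; apply/hasPn => g /mapP[e _ ->]; apply/mapP => -[e' _ [_ _ /esym/eqP]].
by rewrite neq1N1.
Qed.

Lemma size_germs M (v : vert M) : size (germs (Vtx v)) = valence v.
Proof. by rewrite size_cat !size_map -!cardE. Qed.

Lemma div_of_germs M (f : mg_point M -> R) x :
  div_of f x = \sum_(g <- germs x) out_slope f g.1.1 g.1.2 g.2.
Proof.
case: x => [v|e t h] /=; last by rewrite big_cons big_seq1.
rewrite big_cat !big_map; congr (_ + _); rewrite big_enum /=; exact: eq_bigl.
Qed.

Lemma germ_point_interior M (g : germ M) : is_germ g ->
  eventually0 (fun h => 0 < g.1.2 + g.2 * h < len g.1.1).
Proof.
case: g => [[e t] sg] [/= /andP[t0 t1] [->|->] h1 h2].
  exists (len e - t); first by have := h1 erefl; lra.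
  move=> h /=; lra.
exists t; first by have := h2 erefl; lra.
move=> h; lra.
Qed.

(** The tent of height [eps / 2] over [0, eps]. It is the identity on the first half and vanishes
    outside the interval, so it extends by 0 to the whole graph. *)
Definition hat (eps u : R) : R := Num.max 0 (Num.min u (eps - u)).

Lemma hatP eps u : [\/ hat eps u = 0 /\ (u <= 0 \/ eps <= u),
  hat eps u = u /\ 0 <= u /\ u + u <= eps |
  hat eps u = eps - u /\ u <= eps /\ eps <= u + u].
Proof.
rewrite /hat; case: (leP u (eps - u)) => h1.
  by case: (leP 0 u) => h2; [apply: Or32 | apply: Or31]; split=> //; lra.
by case: (leP 0 (eps - u)) => h2; [apply: Or33 | apply: Or31]; split=> //; lra.
Qed.

Lemma hat_lip eps u v : `|hat eps u - hat eps v| <= `|u - v|.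
Proof.
have [[-> ?]|[-> [? ?]]|[-> [? ?]]] := hatP eps u;
have [[-> ?]|[-> [? ?]]|[-> [? ?]]] := hatP eps v;
rewrite ler_norml; have [uv|uv] := lerP v u; apply/andP; lra.
Qed.

Lemma hat0 eps u : u <= 0 \/ eps <= u -> hat eps u = 0.
Proof. by have [[-> ?]|[-> [? ?]]|[-> [? ?]]] := hatP eps u; lra. Qed.

Lemma hatE eps u : 0 <= u -> u + u <= eps -> hat eps u = u.
Proof. by have [[-> ?]|[-> [? ?]]|[-> [? ?]]] := hatP eps u; lra. Qed.

End Germs.

(** * Small spheres *)

Section Spheres.
Context {R : realType}.
Implicit Types (M : model R).

(* A 1-Lipschitz bump along one germ; such functions bound [dist] from below. *)
Definition germ_hat M (g : germ M) (eps : R) (y : mg_point M) : R :=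
  match y with
  | Vtx _ => 0
  | Inn e s _ => if e == g.1.1 then hat eps (g.2 * (s - g.1.2)) else 0
  end.

Definition germ_room M (g : germ M) (eps : R) := 0 < g.1.2 + g.2 * eps < len g.1.1.

Lemma germ_hatE M (g : germ M) eps : is_germ g -> 0 < eps -> germ_room g eps ->
  forall e s, 0 <= s <= len e -> germ_hat g eps (edge_point e s) =
    if e == g.1.1 then hat eps (g.2 * (s - g.1.2)) else 0.
Proof.
move=> [/andP[gt0 gt1] gs g1 g2] eps0 /andP[gr1 gr2] e; apply: edge_ind.
- rewrite edge_point0 /=; case: eqP => // _; rewrite hat0 //.
  by case: gs gr1 gr2 => ->; lra.
- rewrite edge_point_len /=; case: eqP => // ->; rewrite hat0 //.
  by case: gs gr1 gr2 => ->; lra.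
by move=> t ht; rewrite edge_pointE.
Qed.

Lemma germ_hat_lip M (g : germ M) eps : is_germ g -> 0 < eps ->
  germ_room g eps -> edge_lipschitz (germ_hat g eps).
Proof.
move=> hg eps0 hr e a b ha hb; rewrite !germ_hatE //.
case: eqP => _; last by rewrite subrr normr0.
apply: le_trans (hat_lip _ _ _) _; rewrite -mulrBr normrM.
case: hg => _ [->|->] _ _; rewrite ?normrN normr1 mul1r le_eqVlt; apply/orP; left;
by apply/eqP; congr (`|_|); ring.
Qed.

Lemma lipschitzN M (F : mg_point M -> R) : edge_lipschitz F ->
  edge_lipschitz (fun x => - F x).
Proof. by move=> h e a b ha hb; rewrite opprK addrC distrC h. Qed.

Lemma germ_room_le M (g : germ M) a h : is_germ g -> 0 < h <= a ->
  germ_room g a -> germ_room g h.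
Proof.
by rewrite /germ_room => -[+ gs g1 g2]; case: gs (g1) (g2) => -> h1 h2;
  [have := h1 erefl|have := h2 erefl]; lra.
Qed.

Lemma germ_hat_self M (g : germ M) eps h : is_germ g -> germ_room g eps ->
  0 <= h -> h + h <= eps -> 0 < eps -> germ_hat g eps (germ_point g h) = h.
Proof.
move=> hg hr h0 heps eps0; rewrite germ_hatE ?eqxx //.
  rewrite -[RHS](hatE (eps := eps)) //; congr hat.
  by case: hg => _ [->|->] _ _; ring.
move: h0; rewrite le_eqVlt => /predU1P[<-|h0].
  by rewrite mulr0 addr0; case: hg.
have /andP[h1 h2] : germ_room g h by apply: germ_room_le hr => //; lra.
by rewrite !ltW.
Qed.

(** Two germs at [x] share an edge only as the opposite directions at an inner point or as the two
    ends of a loop. In the second case room for [eps + eps] keeps the two tents apart. *)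
Lemma germ_hat_other M (x : mg_point M) (g g' : germ M) eps h :
  g \in germs x -> g' \in germs x -> g != g' -> 0 < eps -> germ_room g eps ->
  germ_room g' eps -> germ_room g (eps + eps) -> germ_room g' (eps + eps) ->
  0 <= h <= eps -> germ_hat g eps (germ_point g' h) = 0.
Proof.
move=> /germsP[hg gx] /germsP[hg' g'x] gg' eps0 hr hr' r2 r2' /andP[h0 heps].
have ht : 0 <= g'.1.2 + g'.2 * h <= len g'.1.1.
  move: h0; rewrite le_eqVlt => /predU1P[<-|h0].
    by rewrite mulr0 addr0; case: hg'.
  have /andP[h1 h2] : germ_room g' h by apply: germ_room_le hr' => //; rewrite h0.
  by rewrite !ltW.
rewrite germ_hatE //; case: eqP => // ee; rewrite hat0 //.
case: g g' ee gg' hg hg' gx g'x hr hr' r2 r2' ht => [[e t] sg] [[e' t'] sg'] /= <-.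
rewrite /germ_room /is_germ /= => gg' [/= ht hs h1 h2] [/= ht' hs' h1' h2'] ex ex'.
have [/eqP tt|] := boolP (t == t').
  case: hs hs' gg' => -> [->|->]; rewrite tt ?eqxx // => _; lra.
(* Distinct parameters of one edge give the same point only at its ends, so the edge is a loop at
   [x]. *)
move=> /eqP tt; have ends u u' : 0 <= u <= len e' -> 0 <= u' <= len e' ->
    u <> u' -> edge_point e' u = edge_point e' u' -> u = 0 \/ u = len e'.
  move=> + hu' uu' eu; have h3 (hu : 0 < u < len e') := (edge_point_interior hu hu' eu).2.
  rewrite !le_eqVlt => /andP[/predU1P[->|u0]]; first by left.
  move=> /predU1P[->|u1]; first by right.
  by case: uu'; rewrite h3 ?u0.
have [t0|t0] := ends _ _ ht ht' tt (etrans ex (esym ex'));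
have [t0'|t0'] := ends _ _ ht' ht (fun h => tt (esym h)) (etrans ex' (esym ex)).
- by rewrite t0 t0' in tt.
- case: hs h2 => -> h2; last by have := h2 erefl; rewrite t0 ltxx.
  case: hs' h1' => -> h1'; first by have := h1' erefl; rewrite t0' ltxx.
  by lra.
- case: hs h1 => -> h1; first by have := h1 erefl; rewrite t0 ltxx.
  case: hs' h2' => -> h2'; last by have := h2' erefl; rewrite t0' ltxx.
  by lra.
by rewrite t0 t0' in tt.
Qed.

Definition near_star M (x : mg_point M) (r : R) (y : mg_point M) :=
  y = x \/ exists2 g, g \in germs x & exists2 h, 0 < h <= r & y = germ_point g h.

(** Below radius [eps] each ray stays in the open edge of its germ, so a path can change rays only
    by passing through [x]. *)
Lemma near_star_step M (x : mg_point M) eps r (e : edge M) a b :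
  (forall g, g \in germs x -> germ_room g eps) -> 0 <= r < eps ->
  0 <= a <= len e -> 0 <= b <= len e ->
  near_star x r (edge_point e a) -> near_star x (r + `|a - b|) (edge_point e b).
Proof.
move=> hroom /andP[r0 reps] ha hb [ax|[g hg [h /andP[h0 hr]]]].
  have [ab|ab|->] := ltgtP b a; last by left.
    right; exists (e, a, -1).
      by apply/germsP; split=> //; split=> //=; [right|lra|lra].
    exists (a - b); first by rewrite gtr0_norm; lra.
    by rewrite /germ_point /=; congr edge_point; ring.
  right; exists (e, a, 1).
    by apply/germsP; split=> //; split=> //=; [left|lra|lra].
  exists (b - a); first by rewrite ltr0_norm; lra.
  by rewrite /germ_point /=; congr edge_point; ring.
have [gg gx] := (germsP x g).1 hg.
have hrm : germ_room g h.
  by apply: germ_room_le (hroom _ hg) => //; rewrite h0 /= ltW //; apply: le_lt_trans reps.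
move=> /esym/(edge_point_interior hrm ha)[ee aa].
move: hrm gg gx hg (hroom _ hg); case: g ee aa => [[e' t] sg] /= ee; subst e'.
move=> aa hrm [/= ht hs h1 h2] gx hg room.
have [bt|bt] := eqVneq (sg * (b - t)) 0.
  left; rewrite -gx; congr edge_point; case: hs bt => ->; lra.
have [bt'|bt'] := ltP 0 (sg * (b - t)).
  right; exists (e, t, sg) => //; exists (sg * (b - t)); last first.
    by rewrite /germ_point /=; congr edge_point; case: hs => ->; ring.
  rewrite bt' /=; rewrite aa; apply: le_trans (_ : h + `|t + sg * h - b| <= _); last by lra.
  by case: hs => ->; [have [] := lerP (t + 1 * h) b | have [] := lerP (t + -1 * h) b]; lra.
(* The piece runs through [x] and continues on the opposite germ of the same edge. *)
right; exists (e, t, - sg).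
  apply/germsP; split=> //; split=> //=; first by case: hs => ->; [right|left; ring].
    case: hs bt bt' => -> bt bt'; first lra.
    by move=> _; move: bt; rewrite -subr_eq0 => bt; have : b != t by [apply: contra_neq bt => ->; ring]; lra.
  case: hs bt bt' => -> bt bt'; last lra.
  by move=> _; have : b != t by [apply: contra_neq bt => ->; ring]; lra.
exists (- (sg * (b - t))).
  rewrite oppr_gt0 lt_neqAle bt bt' /= aa; apply: le_trans (_ : h + `|t + sg * h - b| <= _); last by lra.
  by case: hs bt' => -> bt'; [have [] := lerP (t + 1 * h) b | have [] := lerP (t + -1 * h) b]; lra.
by rewrite /germ_point /=; congr edge_point; case: hs => ->; ring.
Qed.

Lemma chain_length_cons M (e : edge M) a b s :
  chain_length ((e, a, b) :: s) = `|a - b| + chain_length s.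
Proof. by rewrite /chain_length big_cons. Qed.

Lemma near_star_chain M (x : mg_point M) eps r y s z :
  (forall g, g \in germs x -> germ_room g eps) -> 0 <= r ->
  near_star x r y -> chain y s z -> r + chain_length s < eps ->
  near_star x (r + chain_length s) z.
Proof.
move=> hroom; elim: s r y => [|[[e a] b] s IH] r y r0 /=.
  by move=> hy <- _; rewrite /chain_length big_nil addr0.
move=> hy [ha hb ey c]; rewrite chain_length_cons addrA => hlt.
have l0 := chain_length_ge0 s.
apply: (IH _ _ _ _ c hlt); first by rewrite addr_ge0.
apply: (near_star_step hroom) => //; last by rewrite ey.
by rewrite r0 /=; have := normr_ge0 (a - b); lra.
Qed.

Lemma near_star_dist M (x : mg_point M) eps y :
  (forall g, g \in germs x -> germ_room g eps) -> dist x y < eps ->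
  y = x \/ exists2 g, g \in germs x & exists2 h, 0 < h < eps & y = germ_point g h.
Proof.
move=> hroom /inf_lt[|_ [s c ->] hlt].
  by have [s0 c0] := chain_exists x y; exists (chain_length s0), s0.
have := near_star_chain hroom (lexx _) (or_introl erefl) c.
rewrite add0r => /(_ hlt)[->|[g hg [h /andP[h0 hh] ->]]]; first by left.
by right; exists g => //; exists h => //; rewrite h0 (le_lt_trans hh).
Qed.

End Spheres.

(** * Invariance of valences and divisors under isometries *)

Section Isometry.
Context {R : realType}.
Implicit Types (M : model R).

(** Small rays are at distance [h + h'], but the fourth clause only records a strict excess over
    [|h - h'|], the distance within one ray: this is enough to tell rays apart. *)
Definition star_radius M (x : mg_point M) (eps : R) := [/\ 0 < eps,
  forall g h, g \in germs x -> 0 < h < eps -> germ_room g h,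
  forall g h h', g \in germs x -> 0 <= h < eps -> 0 <= h' < eps ->
    dist (germ_point g h) (germ_point g h') = `|h - h'|,
  forall g g' h h', g \in germs x -> g' \in germs x -> g != g' ->
    0 < h < eps -> 0 < h' < eps ->
    `|h - h'| < dist (germ_point g h) (germ_point g' h') &
  forall y, dist x y < eps -> y = x \/
    exists2 g, g \in germs x & exists2 h, 0 < h < eps & y = germ_point g h].

Lemma germ_point0 M (x : mg_point M) g : g \in germs x -> germ_point g 0 = x.
Proof. by move=> /germsP[_ <-]; rewrite /germ_point mulr0 addr0. Qed.

Lemma star_radius_ex M (x : mg_point M) : exists eps, star_radius x eps.
Proof.
have [a a0 ha] : exists2 a, 0 < a & forall g, g \in germs x -> germ_room g a.
  apply: eventually0_ex; apply: eventually0_all => g /germsP[hg _].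
  exact: germ_point_interior.
have room b : 0 < b <= a -> forall g, g \in germs x -> germ_room g b.
  by move=> hb g hg; have [gg _] := (germsP _ _).1 hg; apply: germ_room_le (ha _ hg).
(* Tents of width [a / 2] are the identity up to [a / 4], whence the radius below; [germ_hat_other]
   asks for room up to twice their width, that is [a]. *)
have w0 : 0 < a / 2 by lra.
have room1 := room (a / 2) ltac:(lra); have room2 := room (a / 2 + a / 2) ltac:(lra).
have hin g h : g \in germs x -> 0 <= h < a / 4 ->
    0 <= g.1.2 + g.2 * h <= len g.1.1.
  move=> hg /andP[h0 h1]; move: h0; rewrite le_eqVlt => /predU1P[<-|h0].
    by rewrite mulr0 addr0; case: ((germsP _ _).1 hg) => -[].
  by have /andP[? ?] := room h ltac:(lra) _ hg; rewrite !ltW.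
exists (a / 4); split; first by lra.
- by move=> g h hg hh; apply: room => //; lra.
- move=> g h h' hg hh hh'; have [gg _] := (germsP _ _).1 hg.
  have lip := germ_hat_lip gg w0 (room1 _ hg).
  have s1 : germ_hat g (a / 2) (germ_point g h) = h.
    by apply: germ_hat_self => //; [exact: room1 | lra | lra].
  have s2 : germ_hat g (a / 2) (germ_point g h') = h'.
    by apply: germ_hat_self => //; [exact: room1 | lra | lra].
  have := lipschitz_dist lip (germ_point g h) (germ_point g h').
  have := lipschitz_dist (lipschitzN lip) (germ_point g h) (germ_point g h').
  have := dist_edge_le (hin _ _ hg hh) (hin _ _ hg hh').
  rewrite -/(germ_point g h) -/(germ_point g h') s1 s2.
  have -> : `|g.1.2 + g.2 * h - (g.1.2 + g.2 * h')| = `|h - h'|.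
    rewrite opprD addrACA subrr add0r -mulrBr normrM.
    by case: gg => _ [->|->] _ _; rewrite ?normrN normr1 mul1r.
  move=> u1 u2 u3; apply/eqP; rewrite eq_le u1 /=.
  by have [_|_] := lerP h h'; lra.
- move=> g g' h h' hg hg' ne hh hh'.
  have [gg _] := (germsP _ _).1 hg; have [gg' _] := (germsP _ _).1 hg'.
  have lip := germ_hat_lip gg w0 (room1 _ hg).
  have lip' := germ_hat_lip gg' w0 (room1 _ hg').
  have s1 : germ_hat g (a / 2) (germ_point g h) = h.
    by apply: germ_hat_self => //; [exact: room1 | lra | lra].
  have s2 : germ_hat g' (a / 2) (germ_point g' h') = h'.
    by apply: germ_hat_self => //; [exact: room1 | lra | lra].
  have s3 : germ_hat g (a / 2) (germ_point g' h') = 0.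
    by apply: (@germ_hat_other _ M x g g') => //; rewrite ?room1 ?room2 //; lra.
  have s4 : germ_hat g' (a / 2) (germ_point g h) = 0.
    by apply: (@germ_hat_other _ M x g' g) => //; rewrite ?room1 ?room2 1?eq_sym //; lra.
  have := lipschitz_dist lip (germ_point g h) (germ_point g' h').
  have := lipschitz_dist (lipschitzN lip') (germ_point g h) (germ_point g' h').
  rewrite s1 s2 s3 s4 => u1 u2.
  by have [_|_] := lerP h h'; lra.
move=> y hy; apply: near_star_dist hy => g; apply: room; lra.
Qed.

(** The form of [rational_function] that isometries visibly preserve: it refers to germs instead of
    subdivisions of edges. The equivalence is [rational_locally_linear]. *)
Definition locally_linear M (f : mg_point M -> R) := forall x g, g \in germs x ->
  exists k : int, eventually0 (fun h => f (germ_point g h) = f x + k%:~R * h).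

Definition isometry M M' (psi : mg_point M -> mg_point M') :=
  bijective psi /\ forall x y, dist (psi x) (psi y) = dist x y.

Lemma isometry_id M : isometry (@id (mg_point M)).
Proof. by split=> //; exists id. Qed.

Lemma isometry_comp M1 M2 M3 (p : mg_point M1 -> mg_point M2)
  (q : mg_point M2 -> mg_point M3) : isometry p -> isometry q -> isometry (q \o p).
Proof.
by move=> [bp dp] [bq dq]; split; [exact: bij_comp|move=> x y /=; rewrite dq].
Qed.

Lemma isometry_inv M M' (psi : mg_point M -> mg_point M') : isometry psi ->
  exists phi, [/\ isometry phi, cancel psi phi & cancel phi psi].
Proof.
move=> [[phi h1 h2] d]; exists phi; split=> //; split; first by exists psi.
by move=> x y; rewrite -d !h2.
Qed.

(** A point at height [h] goes to distance [h] from [psi x], hence to height [h] on some ray. That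
    ray does not depend on [h], since points on different rays are farther apart than [|h - h'|];
    radius [m / 2] serves as reference. *)
Lemma isometry_star M M' (psi : mg_point M -> mg_point M') x : isometry psi ->
  exists2 eps, 0 < eps & forall g, g \in germs x -> exists2 g',
    g' \in germs (psi x) &
    forall h, 0 < h < eps -> psi (germ_point g h) = germ_point g' h.
Proof.
move=> [bpsi dpsi]; have [a [a0 _ ha _ _]] := star_radius_ex x.
have [b [b0 _ hb hbd hball]] := star_radius_ex (psi x).
have near g h : g \in germs x -> 0 < h < Num.min a b ->
    exists2 g', g' \in germs (psi x) & psi (germ_point g h) = germ_point g' h.
  rewrite lt_min => hg /and3P[h0 h1 h2].
  have dd : dist (psi x) (psi (germ_point g h)) = h.
    rewrite dpsi -{1}(germ_point0 hg) ha ?lexx ?a0 ?ltW //.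
    by rewrite sub0r normrN gtr0_norm.
  have [|e|[g' hg' [h' /andP[h'0 h'b] e]]] := hball (psi (germ_point g h)).
  - by rewrite dd.
  - by move: dd; rewrite e dist_refl => hh; rewrite -hh ltxx in h0.
  exists g' => //; rewrite e; congr germ_point.
  rewrite -dd e -{1}(germ_point0 hg') hb ?lexx ?h'b ?ltW //.
  by rewrite sub0r normrN gtr0_norm.
set m := Num.min a b in near; have m0 : 0 < m by rewrite lt_min a0.
exists m => // g hg; have [g' hg' e'] := near g (m / 2) hg ltac:(lra).
exists g' => // h hh; have [g2 hg2 e2] := near g h hg hh.
have mab : m <= a /\ m <= b by rewrite /m !ge_min !lexx orbT.
rewrite e2; have [->//|ne] := eqVneq g2 g'; exfalso.
have := hbd _ _ h (m / 2) hg2 hg' ne ltac:(lra) ltac:(lra).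
by rewrite -e2 -e' dpsi ha ?ltxx //; lra.
Qed.

Lemma locally_linear_isometry M M' (psi : mg_point M -> mg_point M') f :
  isometry psi -> locally_linear f -> locally_linear (f \o psi).
Proof.
move=> ipsi lf x g hg; have [eps eps0 heps] := isometry_star x ipsi.
have [g' hg' e] := heps g hg; have [k [a a0 ha]] := lf _ _ hg'.
exists k, (Num.min eps a) => [|h]; first by rewrite lt_min eps0.
by rewrite lt_min => /and3P[h0 h1 h2]; rewrite /= e ?ha // h0.
Qed.

Lemma germs_sphere M (x : mg_point M) : exists2 eps, 0 < eps &
  forall h, 0 < h < eps -> uniq [seq germ_point g h | g <- germs x] /\
    forall y, y \in [seq germ_point g h | g <- germs x] <-> dist x y = h.
Proof.
have [a [a0 _ ha hn hball]] := star_radius_ex x.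
exists a => // h /andP[h0 h1]; split.
  rewrite map_inj_in_uniq ?germs_uniq // => g g' hg hg' e.
  apply/eqP; apply: contraT => ne.
  have := hn g g' h h hg hg' ne; rewrite h0 h1 => /(_ isT isT).
  by rewrite e dist_refl subrr normr0 ltxx.
have dd g h' : g \in germs x -> 0 < h' < a -> dist x (germ_point g h') = h'.
  move=> hg hh; rewrite -{1}(germ_point0 hg) ha ?lexx ?a0 //; last by lra.
  by rewrite sub0r normrN gtr0_norm //; lra.
move=> y; split=> [/mapP[g hg ->]|e]; first by rewrite dd // h0.
have [|yx|[g hg [h' hh' e']]] := hball y; first by rewrite e.
  by move: e; rewrite yx dist_refl => hh; rewrite -hh ltxx in h0.
by apply/mapP; exists g => //; rewrite -e e' dd.
Qed.

Lemma isometry_germs M M' (psi : mg_point M -> mg_point M') x : isometry psi ->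
  eventually0 (fun h => perm_eq [seq psi (germ_point g h) | g <- germs x]
                             [seq germ_point g h | g <- germs (psi x)]).
Proof.
move=> [[phi psiK phiK] dpsi]; have [a a0 ha] := germs_sphere x.
have [b b0 hb] := germs_sphere (psi x).
exists (Num.min a b) => [|h]; rewrite lt_min ?a0 // => /and3P[h0 h1 h2].
have [ua ma] := ha h ltac:(lra); have [ub mb] := hb h ltac:(lra).
rewrite (map_comp psi (fun g => germ_point g h)); apply: uniq_perm => //.
  by rewrite map_inj_uniq //; apply: can_inj psiK.
move=> y; apply/idP/idP => [/mapP[z /ma hz ->]|/mb hy]; first by apply/mb; rewrite dpsi.
by rewrite -[y]phiK; apply: map_f; apply/ma; rewrite -dpsi phiK.
Qed.

Lemma isometry_valence M M' (psi : mg_point M -> mg_point M') x : isometry psi ->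
  size (germs (psi x)) = size (germs x).
Proof.
by move=> /(isometry_germs x)/eventually0_ex[h _ /perm_size]; rewrite !size_map.
Qed.

Lemma out_slopeE M (f : mg_point M -> R) x g (k : int) : g \in germs x ->
  eventually0 (fun h => f (germ_point g h) = f x + k%:~R * h) ->
  out_slope f g.1.1 g.1.2 g.2 = k.
Proof.
move=> /germsP[_ gx] hk; apply: xget_unique.
  by apply/eventually0P; rewrite gx.
move=> k' /eventually0P; rewrite gx => hk'.
have [h h0 [e1 e2]] := eventually0_ex (eventually0_and hk hk').
have /(mulIf (lt0r_neq0 h0))/intr_inj// : k'%:~R * h = k%:~R * h.
by apply: (addrI (f x)); rewrite -e1 -e2.
Qed.

Lemma out_slopeP M (f : mg_point M -> R) x g : locally_linear f -> g \in germs x ->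
  eventually0 (fun h => f (germ_point g h)
                      = f x + (out_slope f g.1.1 g.1.2 g.2)%:~R * h).
Proof. by move=> lf hg; have [k hk] := lf x g hg; rewrite (out_slopeE hg hk). Qed.

(* The right-hand side only involves the sphere of radius [h] around [x], so
   [div_of] is invariant under isometries. *)
Lemma div_of_sphere M (f : mg_point M -> R) x : locally_linear f ->
  eventually0 (fun h => (div_of f x)%:~R * h =
    \sum_(y <- [seq germ_point g h | g <- germs x]) (f y - f x)).
Proof.
move=> lf; have := eventually0_all (fun g hg => out_slopeP lf hg) (s := germs x).
apply: eventually0_imp => h _ hs; rewrite big_map div_of_germs big_seq.
rewrite raddf_sum mulr_suml [RHS]big_seq; apply: eq_bigr => g hg.
by rewrite hs // addrC addKr.
Qed.

Lemma div_of_isometry M M' (psi : mg_point M -> mg_point M') f x :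
  isometry psi -> locally_linear f -> div_of (f \o psi) x = div_of f (psi x).
Proof.
move=> ipsi lf; have lfp := locally_linear_isometry ipsi lf.
have [h h0 [[e1 e2] p]] := eventually0_ex (eventually0_and (eventually0_and
  (div_of_sphere x lfp) (div_of_sphere (psi x) lf)) (isometry_germs x ipsi)).
apply: (@intr_inj R); apply: (mulIf (lt0r_neq0 h0)); rewrite [LHS]e1 [RHS]e2.
have pb : \sum_(y <- [seq psi (germ_point g h) | g <- germs x]) (f y - f (psi x))
    = \sum_(y <- [seq germ_point g h | g <- germs (psi x)]) (f y - f (psi x)).
  exact: perm_big p.
by rewrite -[RHS]pb !big_map.
Qed.

End Isometry.

(** * Rational functions *)

Section PiecewiseLinear.
Context {R : realType}.
Implicit Types (M : model R) (g : R -> R).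

Definition affine_between g (a b : R) :=
  exists k : int, forall t, a <= t <= b -> g t = g a + k%:~R * (t - a).

Fixpoint pieces g (a : R) (s : seq R) : Prop :=
  if s is b :: s' then [/\ a < b, affine_between g a b & pieces g b s'] else True.

Lemma piecesP g a s : pieces g a s <-> path <%R a s /\
  forall i, (i < size s)%N -> affine_between g (nth 0 (a :: s) i) (nth 0 s i).
Proof.
elim: s a => [|b s IH] a //=; split.
  by move=> [-> hab /IH[-> h]]; split=> // -[|i] //=; exact: h.
move=> [/andP[-> hp] h]; split=> //; first exact: (h 0%N).
by apply/IH; split=> // i hi; exact: (h i.+1).
Qed.

Lemma rational_pieces M (f : mg_point M -> R) : rational_function f <->
  forall e, exists2 s, pieces (fun t => f (edge_point e t)) 0 s & last 0 s = len e.
Proof.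
split=> h e; have [s] := h e.
  by move=> [h1 h2 h3]; exists s => //; apply/piecesP; split.
by move=> /piecesP[h1 h2] h3; exists s; split.
Qed.

Lemma pieces_le g a s : pieces g a s -> a <= last a s.
Proof. by elim: s a => [|b s IH] a //= [/ltW ab _ /IH]; apply: le_trans. Qed.

Lemma pieces_right g a s t : pieces g a s -> a <= t < last a s ->
  exists k : int, eventually0 (fun h => g (t + h) = g t + k%:~R * h).
Proof.
elim: s a => [|b s IH] a /=; first by move=> _ /andP[/le_lt_trans h /h]; rewrite ltxx.
move=> [ab [k hk] hs] /andP[ta tl]; have [tb|bt] := ltP t b; last by apply: IH hs _; rewrite bt.
exists k, (b - t) => [|h /andP[h0 h1]]; first by lra.
rewrite (hk (t + h)) ?(hk t); [ring | lra | lra].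
Qed.

Lemma pieces_left g a s t : pieces g a s -> a < t <= last a s ->
  exists k : int, eventually0 (fun h => g (t - h) = g t + k%:~R * h).
Proof.
elim: s a => [|b s IH] a /=; first by move=> _ /andP[/lt_le_trans h /h]; rewrite ltxx.
move=> [ab [k hk] hs] /andP[ta tl]; have [bt|tb] := ltP b t; first by apply: IH hs _; rewrite bt.
exists (- k), (t - a) => [|h /andP[h0 h1]]; first by lra.
rewrite (hk (t - h)) ?(hk t) ?rmorphN /=; [ring | lra | lra].
Qed.

Lemma pieces_rcons g a s b : pieces g a s -> last a s < b ->
  affine_between g (last a s) b -> pieces g a (rcons s b).
Proof. by elim: s a => [|c s IH] a //= [ac haff hs] hb hl; split=> //; apply: IH. Qed.

(** A compactness argument. [A] holds the parameters up to which a finite subdivision exists; the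
    germ to the left of [sup A] shows that the supremum is attained, and the germ to its right
    contradicts [sup A < L]. *)
Lemma locally_affine_pieces g (L : R) : 0 < L ->
  (forall t, 0 <= t < L ->
    exists k : int, eventually0 (fun h => g (t + h) = g t + k%:~R * h)) ->
  (forall t, 0 < t <= L ->
    exists k : int, eventually0 (fun h => g (t - h) = g t + k%:~R * h)) ->
  exists2 s, pieces g 0 s & last 0 s = L.
Proof.
move=> L0 hr hl; pose A := [set t | t <= L /\ exists2 s, pieces g 0 s & last 0 s = t].
have A0 : A 0 by split; [exact: ltW | exists [::]].
have supA : has_sup A by split; [exists 0 | exists L => t []].
have c0 : 0 <= sup A by apply: ub_le_sup => //; case: supA.
have cL : sup A <= L by apply: ge_sup; [exists 0 | move=> t []].
have Ac : A (sup A).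
  have [e|ne] := eqVneq (sup A) 0; first by rewrite e.
  have c0' : 0 < sup A by rewrite lt_neqAle eq_sym ne.
  have [k [eps eps0 hk]] := hl (sup A) ltac:(lra).
  have [t At ht] := sup_adherent (eps := Num.min eps (sup A)) ltac:(rewrite lt_min eps0 //) supA.
  have htc : t <= sup A by apply: ub_le_sup => //; case: supA.
  have [<-//|/eqP tc] := eqVneq t (sup A).
  have {}tc : t < sup A by rewrite lt_neqAle htc andbT; apply/eqP.
  have htt : sup A - t < eps.
    have : Num.min eps (sup A) <= eps by rewrite ge_min lexx.
    by move: ht; lra.
  case: At => tL [s hs hst]; split=> //; exists (rcons s (sup A)); rewrite ?last_rcons //.
  apply: pieces_rcons => //; rewrite hst // /affine_between.
  have gl u : t <= u <= sup A -> g u = g (sup A) - (- k)%:~R * (sup A - u).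
    move=> /andP[u1 u2]; have [->|uc] := eqVneq u (sup A); first by rewrite subrr mulr0 subr0.
    have {}uc : u < sup A by rewrite lt_neqAle uc.
    have := hk (sup A - u) ltac:(lra).
    by rewrite subKr => ->; rewrite rmorphN /= mulNr opprK.
  by exists (- k) => u hu; rewrite (gl u) ?(gl t); [ring | lra | lra].
have [e|ne] := eqVneq (sup A) L; first by case: Ac => _; rewrite e.
have {}ne : sup A < L by rewrite lt_neqAle ne.
have [k [eps eps0 hk]] := hr (sup A) ltac:(lra).
exfalso; pose b := Num.min (sup A + eps / 2) L.
have [b1 b2 b3] : [/\ sup A < b, b <= L & b < sup A + eps].
  by rewrite /b; case: (leP (sup A + eps / 2) L) => ?; split; lra.
suff : A b by move=> Ab; have := ub_le_sup supA.2 Ab; lra.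
split=> //; case: Ac => _ [s hs hst]; exists (rcons s b); rewrite ?last_rcons //.
apply: pieces_rcons => //; rewrite hst //; exists k => t /andP[t1 t2].
have [->|tc] := eqVneq t (sup A); first by rewrite subrr mulr0 addr0.
have {}tc : sup A < t by rewrite lt_neqAle eq_sym tc.
by rewrite -hk ?(addrC (sup A)) ?subrK //; lra.
Qed.

Lemma rational_locally_linear M (f : mg_point M -> R) :
  rational_function f <-> locally_linear f.
Proof.
rewrite rational_pieces; split=> [h x [[e t] sg]|h e].
  move=> /germsP[[/= /andP[t0 t1] hs h1 h2] <-] /=; have [s hs1 hs2] := h e.
  case: hs => hs; subst sg.
    have [|k hk] := pieces_right (t := t) hs1; first by rewrite t0 hs2 h1.
    exists k; apply: eventually0_imp hk => u _.
    by rewrite /germ_point /= mul1r.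
  have [|k hk] := pieces_left (t := t) hs1; first by rewrite hs2 t1 andbT h2.
  by exists k; apply: eventually0_imp hk => u _; rewrite /germ_point /= mulN1r.
apply: locally_affine_pieces; first exact: len_gt0.
  move=> t /andP[t0 t1]; have [|k hk] := h (edge_point e t) (e, t, 1).
    apply/germsP; split=> //; split=> //=; first by rewrite t0 ltW.
      by left.
    by move=> /eqP; rewrite neq1N1.
  by exists k; apply: eventually0_imp hk => u _; rewrite /germ_point /= mul1r.
move=> t /andP[t0 t1]; have [|k hk] := h (edge_point e t) (e, t, -1).
  apply/germsP; split=> //; split=> //=; first by rewrite t1 ltW.
    by right.
  by move=> /esym/eqP; rewrite neq1N1.
by exists k; apply: eventually0_imp hk => u _; rewrite /germ_point /= mulN1r.
Qed.

(** When the two outgoing slopes at a breakpoint cancel, the slopes on both sides agree and the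
    pieces merge. *)
Lemma pieces_affine g a s : pieces g a s -> a < last a s ->
  (forall t (k k' : int), a < t < last a s ->
    eventually0 (fun h => g (t + h) = g t + k%:~R * h) ->
    eventually0 (fun h => g (t - h) = g t + k'%:~R * h) -> k + k' = 0) ->
  affine_between g a (last a s).
Proof.
elim: s a => [|b s IH] a /=; first by rewrite ltxx.
move=> [ab [k hk] hs] _ hdiv; have bl := pieces_le hs.
move: bl; rewrite le_eqVlt => /predU1P[<-|bl]; first by exists k.
have [|k' hk'] := IH _ hs bl.
  by move=> t k1 k2 /andP[t1 t2]; apply: hdiv; rewrite t2 (lt_trans ab).
have : k' + - k = 0.
  apply: (hdiv b); first by rewrite ab.
    exists (last b s - b); first by lra.
    by move=> h hh; rewrite hk'; [ring | lra].
  exists (b - a); first by lra.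
  by move=> h hh; rewrite (hk (b - h)) ?(hk b) ?rmorphN /=; [ring | lra | lra].
move=> /subr0_eq e; subst k'; exists k => t /andP[t1 t2].
have [tb|bt] := lerP t b; first by rewrite hk // t1.
by rewrite hk' ?(ltW bt) // (hk b); [ring | lra].
Qed.

Lemma edge_affine M (f : mg_point M -> R) (e : edge M) : rational_function f ->
  (forall t (h : 0 < t < len e), div_of f (Inn h) = 0) ->
  exists k : int, forall t, 0 <= t <= len e ->
    f (edge_point e t) = f (edge_point e 0) + k%:~R * t.
Proof.
move=> rf h0; have lf := (rational_locally_linear f).1 rf.
have [s hs hl] := (rational_pieces f).1 rf e.
have [||k hk] := pieces_affine hs; rewrite ?hl ?len_gt0 //.
  move=> t k k' ht h1 h2; rewrite -(h0 t ht) /=.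
  have e1 : (e, t, 1) \in germs (Inn ht) by rewrite inE eqxx.
  have e2 : (e, t, -1) \in germs (Inn ht) by rewrite !inE eqxx orbT.
  rewrite -(edge_pointE ht) in e1 e2.
  rewrite (out_slopeE (k := k) e1) ?(out_slopeE (k := k') e2) //.
    by apply: eventually0_imp h2 => h _; rewrite /germ_point /= mulN1r.
  by apply: eventually0_imp h1 => h _; rewrite /germ_point /= mul1r.
by rewrite hl in hk; exists k => t ht; rewrite hk // subr0.
Qed.

Lemma locally_linearD M (f g : mg_point M -> R) :
  locally_linear f -> locally_linear g -> locally_linear (f \+ g).
Proof.
move=> lf lg x b hb; have [k hk] := lf x b hb; have [l hl] := lg x b hb.
exists (k + l); apply: eventually0_imp (eventually0_and hk hl) => h _ [/= -> ->].
by rewrite rmorphD /=; ring.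
Qed.

Lemma locally_linearN M (f : mg_point M -> R) :
  locally_linear f -> locally_linear (\- f).
Proof.
move=> lf x b hb; have [k hk] := lf x b hb.
by exists (- k); apply: eventually0_imp hk => h _ /= ->; rewrite rmorphN /=; ring.
Qed.

Lemma div_ofD M (f g : mg_point M -> R) x : locally_linear f -> locally_linear g ->
  div_of (f \+ g) x = div_of f x + div_of g x.
Proof.
move=> lf lg; rewrite !div_of_germs -big_split big_seq [RHS]big_seq.
apply: eq_bigr => b hb; apply: (out_slopeE hb).
apply: eventually0_imp (eventually0_and (out_slopeP lf hb) (out_slopeP lg hb)).
by move=> h _ [/= -> ->]; rewrite rmorphD /=; ring.
Qed.

Lemma div_ofN M (f : mg_point M -> R) x : locally_linear f ->
  div_of (\- f) x = - div_of f x.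
Proof.
move=> lf; rewrite !div_of_germs -sumrN big_seq [RHS]big_seq.
apply: eq_bigr => b hb; apply: (out_slopeE hb).
apply: eventually0_imp (out_slopeP lf hb).
by move=> h _ /= ->; rewrite rmorphN /=; ring.
Qed.

Lemma lin_equiv_refl M (D : mg_point M -> int) : lin_equiv D D.
Proof.
have l0 : locally_linear (fun _ : mg_point M => 0 : R).
  by move=> x g _; exists 0, 1 => // h _; rewrite mul0r addr0.
exists (fun => 0); first exact/rational_locally_linear.
move=> x; rewrite subrr div_of_germs big_seq big1 // => g hg.
by apply: (out_slopeE hg); exists 1 => // h _; rewrite mul0r addr0.
Qed.

Lemma lin_equiv_sym M (D E : mg_point M -> int) : lin_equiv D E -> lin_equiv E D.
Proof.
move=> [f /rational_locally_linear lf h].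
exists (\- f); first exact/rational_locally_linear/locally_linearN.
by move=> x; rewrite div_ofN // -h opprB.
Qed.

Lemma lin_equiv_trans M (D E F : mg_point M -> int) :
  lin_equiv D E -> lin_equiv E F -> lin_equiv D F.
Proof.
move=> [f /rational_locally_linear lf h] [g /rational_locally_linear lg h'].
exists (f \+ g); first exact/rational_locally_linear/locally_linearD.
by move=> x; rewrite div_ofD // -h -h' addrA subrK.
Qed.

Lemma lin_equiv_shift M (D E F : mg_point M -> int) :
  lin_equiv D E -> lin_equiv (fun x => D x + F x) (fun x => E x + F x).
Proof. by move=> [f rf h]; exists f => // x; rewrite -h opprD addrACA subrr addr0. Qed.

Lemma lin_equiv_isometry M M' (psi : mg_point M -> mg_point M') D E :
  isometry psi -> lin_equiv D E -> lin_equiv (D \o psi) (E \o psi).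
Proof.
move=> ipsi [f /rational_locally_linear lf h].
exists (f \o psi); first exact/rational_locally_linear/locally_linear_isometry.
by move=> x /=; rewrite div_of_isometry // -h.
Qed.

End PiecewiseLinear.

(** * Degrees and genus *)

Section Degree.
Context {R : realType}.
Implicit Types (M : model R).

Lemma div_degreeE M (D : mg_point M -> int) s : uniq s ->
  (forall x, x \notin s -> D x = 0) -> div_degree D = \sum_(x <- s) D x.
Proof.
move=> us h; rewrite /div_degree (fsbigE s) //; last by move=> i _; apply: h.
by apply: eq_bigl => x; rewrite in_setT.
Qed.

Lemma is_divisorP M (D : mg_point M -> int) : is_divisor D <->
  exists2 s, uniq s & forall x, x \notin s -> D x = 0.
Proof.
split=> [hf|[s us h]].
  have /finite_seqP[s e] := hf; exists (undup s) => [|x]; first exact: undup_uniq.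
  rewrite mem_undup => /negP h; apply/eqP/negPn/negP => hx; apply: h.
  by have : [set x | D x != 0] x by []; rewrite e.
apply: (@sub_finite_set _ _ [set` s]); last exact: finite_seq.
by move=> x /=; apply: contraNT => /h ->.
Qed.

Lemma is_divisor2 M (D E : mg_point M -> int) : is_divisor D -> is_divisor E ->
  exists2 s, uniq s & forall x, x \notin s -> D x = 0 /\ E x = 0.
Proof.
move=> /is_divisorP[s _ hs] /is_divisorP[t _ ht]; exists (undup (s ++ t)).
  exact: undup_uniq.
by move=> x; rewrite mem_undup mem_cat negb_or => /andP[/hs ? /ht].
Qed.

Lemma is_divisorD M (D E : mg_point M -> int) : is_divisor D -> is_divisor E ->
  is_divisor (fun x => D x + E x).
Proof.
move=> hD hE; have [s us h] := is_divisor2 hD hE; apply/is_divisorP.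
by exists s => // x /h[-> ->]; rewrite addr0.
Qed.

Lemma is_divisorN M (D : mg_point M -> int) : is_divisor D ->
  is_divisor (fun x => - D x).
Proof.
move=> /is_divisorP[s us h]; apply/is_divisorP.
by exists s => // x /h ->; rewrite oppr0.
Qed.

Lemma div_degreeD M (D E : mg_point M -> int) : is_divisor D -> is_divisor E ->
  div_degree (fun x => D x + E x) = div_degree D + div_degree E.
Proof.
move=> hD hE; have [s us h] := is_divisor2 hD hE.
rewrite !(div_degreeE us) ?big_split //; last by move=> x /h[-> ->].
  by move=> x /h[].
by move=> x /h[].
Qed.

Lemma div_degreeN M (D : mg_point M -> int) : is_divisor D ->
  div_degree (fun x => - D x) = - div_degree D.
Proof.
move=> /is_divisorP[s us h].
by rewrite !(div_degreeE us) ?sumrN // => x /h ->.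
Qed.

Lemma div_degree_isometry M M' (psi : mg_point M -> mg_point M') D :
  isometry psi -> div_degree (D \o psi) = div_degree D.
Proof. by move=> [bpsi _]; rewrite /div_degree [RHS](reindex_fsbigT psi). Qed.

Lemma is_divisor_isometry M M' (psi : mg_point M -> mg_point M') D :
  isometry psi -> is_divisor D -> is_divisor (D \o psi).
Proof.
move=> [[phi h1 h2] _] /is_divisorP[s us h]; apply/is_divisorP.
exists (map phi s); first by rewrite map_inj_uniq //; apply: can_inj h2.
move=> x hx; apply: h; apply: contra hx => hx.
by rewrite -[x]h1 map_f.
Qed.

Lemma vtx_support M (D : mg_point M -> int) :
  (forall e t (h : 0 < t < @len _ M e), D (Inn h) = 0) ->
  is_divisor D /\ div_degree D = \sum_(v : vert M) D (Vtx v).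
Proof.
move=> h; have us : uniq [seq @Vtx _ M v | v <- enum (vert M)].
  by rewrite map_inj_uniq ?enum_uniq // => ? ? [].
have hs x : x \notin [seq @Vtx _ M v | v <- enum (vert M)] -> D x = 0.
  by case: x => [v|e t ht]; [rewrite map_f ?mem_enum | rewrite h].
split; first by apply/is_divisorP; exists [seq @Vtx _ M v | v <- enum (vert M)].
by rewrite (div_degreeE us hs) big_map big_enum.
Qed.

Lemma sum_valence (G : graph) :
  (\sum_(v : vert G) valence v = #|edge G| + #|edge G|)%N.
Proof.
have h (F : edge G -> vert G) : (\sum_(v : vert G) #|[pred e | F e == v]| = #|edge G|)%N.
  rewrite -[RHS]sum1_card (partition_big F predT) //=; apply: eq_bigr => v _.
  by rewrite -sum1_card; apply: eq_bigl => e; rewrite inE.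
by rewrite big_split /= !h.
Qed.

(** [D N] is the canonical divisor, valence minus 2 at each point, of degree 2|E| - 2|V|. Valences
    count the points of small spheres, so an isometry preserves this degree. *)
Lemma euler_isometry M M' (psi : mg_point M -> mg_point M') : isometry psi ->
  (#|edge M| + #|vert M'| = #|edge M'| + #|vert M|)%N.
Proof.
move=> ipsi; pose D (N : model R) (x : mg_point N) : int := (size (germs x))%:Z - 2.
have hD (N : model R) : div_degree (D N) = (#|edge N| + #|edge N|)%:Z - (#|vert N| * 2)%:Z.
  rewrite (vtx_support _).2 // -sum_valence [X in X - _](big_morph Posz PoszD (erefl _)).
  rewrite (eq_bigr (fun v => (valence v)%:Z - 2)); last first.
    by move=> v _; rewrite /D size_germs.
  by rewrite sumrB -[X in _ - X%:Z]sum_nat_const (big_morph Posz PoszD (erefl _)).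
have : div_degree (D M) = div_degree (D M').
  rewrite -(div_degree_isometry _ ipsi); congr div_degree; apply/funext => x /=.
  by rewrite /D isometry_valence.
rewrite !hD; lia.
Qed.

Lemma genus_isometry M M' (psi : mg_point M -> mg_point M') : isometry psi ->
  genus M = genus M'.
Proof. by move=> /euler_isometry; rewrite /genus; lia. Qed.

End Degree.

(** * Subdivision of an edge *)

Section Subdivision.
Context {R : realType}.
Implicit Types (M : model R).

Lemma adj_sym (V E : finType) (s t : E -> V) S : symmetric (adj s t S).
Proof. by move=> x y; rewrite /adj; apply: eq_existsb => e; rewrite orbC. Qed.

Lemma connect_adj_sym (V E : finType) (s t : E -> V) S :
  connect_sym (adj s t S).
Proof. exact/sym_connect_sym/adj_sym. Qed.

Lemma adj_edge (V E : finType) (s t : E -> V) (S : {set E}) e : e \notin S ->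
  connect (adj s t S) (s e) (t e).
Proof. by move=> h; apply/connect1/existsP; exists e; rewrite h !eqxx. Qed.

Section OneStep.
Variables (M : model R) (e0 : edge M) (t0 : R) (h0 : 0 < t0 < len e0).

(** The edge [Some e0] becomes the part of [e0] over [0, t0] and the edge [None] the part over
    [t0, len e0]; the vertex [None] is the new point. *)
Definition sub_src (a : option (edge M)) : option (vert M) :=
  if a is Some e then Some (src e) else None.

Definition sub_tgt (a : option (edge M)) : option (vert M) :=
  if a is Some e then (if e == e0 then None else Some (tgt e)) else Some (tgt e0).

Lemma sub_vert_gt0 : (0 < #|{: option (vert M)}|)%N.
Proof. by rewrite card_option. Qed.

Lemma sub_conn x y : connect (adj sub_src sub_tgt finset.set0) x y.
Proof.
have mid a : connect (adj sub_src sub_tgt finset.set0) (sub_src a) (sub_tgt a).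
  by apply: adj_edge; rewrite finset.in_set0.
have edge_conn e : connect (adj sub_src sub_tgt finset.set0) (Some (src e)) (Some (tgt e)).
  have := mid (Some e) => /=; case: eqP => // -> h.
  exact: connect_trans h (mid None).
have some_conn v w : connect (adj sub_src sub_tgt finset.set0) (Some v) (Some w).
  have /connectP[p pth ->] := graph_conn v w.
  elim: p v pth => [|u p IH] v //= /andP[/existsP[e /andP[_ h]] /IH].
  apply: connect_trans.
  case/orP: h => /andP[/eqP<- /eqP<-] //; by rewrite connect_adj_sym.
have none_conn : connect (adj sub_src sub_tgt finset.set0) None (Some (tgt e0)) by exact: mid None.
case: x y => [x|] [y|] //; [|exact: connect_trans none_conn _].
by rewrite connect_adj_sym; exact: connect_trans none_conn _.
Qed.

Definition sub_graph : graph := Graph sub_vert_gt0 sub_conn.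

Definition sub_len (a : edge sub_graph) : R :=
  if a is Some e then (if e == e0 then t0 else len e) else len e0 - t0.

Lemma sub_len_gt0 a : 0 < sub_len a.
Proof.
have /andP[h1 h2] := h0.
by case: a => [e|] /=; [case: eqP => _ //; exact: len_gt0 | rewrite subr_gt0].
Qed.

Definition sub_model : model R := Model sub_len_gt0.

Definition sub_base (a : edge sub_model) : edge M := odflt e0 a.
Definition sub_off (a : edge sub_model) : R := if a is Some _ then 0 else t0.

Definition sub_map (x : mg_point sub_model) : mg_point M :=
  match x with
  | Vtx (Some v) => Vtx v
  | Vtx None => Inn h0
  | Inn a t _ => edge_point (sub_base a) (sub_off a + t)
  end.

Definition sub_inv (x : mg_point M) : mg_point sub_model :=
  match x with
  | Vtx v => @Vtx R sub_model (Some v)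
  | Inn e t _ => if (e == e0) && (t0 < t) then @edge_point R sub_model None (t - t0)
                 else @edge_point R sub_model (Some e) t
  end.

Lemma sub_range (a : edge sub_model) t : 0 <= t <= len a ->
  0 <= sub_off a + t <= len (sub_base a).
Proof. by have := h0; case: a => [e|] /=; [case: eqP => [->|_]; lra | lra]. Qed.

Lemma sub_map_edge (a : edge sub_model) t : 0 <= t <= len a ->
  sub_map (edge_point a t) = edge_point (sub_base a) (sub_off a + t).
Proof.
move: t; apply: edge_ind.
- rewrite edge_point0 addr0; case: a => [e|] /=; first by rewrite edge_point0.
  by rewrite (edge_pointE h0).
- rewrite edge_point_len; case: a => [e|] /=.
    rewrite add0r; case: eqP => [->|_]; first by rewrite (edge_pointE h0).
    by rewrite edge_point_len.
  by rewrite addrC subrK edge_point_len.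
by move=> t ht; rewrite (edge_pointE ht).
Qed.

Lemma sub_inv_edge (e : edge M) t : 0 <= t <= len e ->
  sub_inv (edge_point e t) = if (e == e0) && (t0 < t)
    then @edge_point R sub_model None (t - t0) else @edge_point R sub_model (Some e) t.
Proof.
have /andP[h1 h2] := h0; move: t; apply: edge_ind.
- by rewrite edge_point0 ltNge ltW // andbF edge_point0.
- rewrite edge_point_len /=; case: eqP => [->|ne] /=.
    by rewrite h2 (@edge_point_len R sub_model None).
  have := @edge_point_len R sub_model (Some e) => /=.
  by case: eqP ne => // _ _ ->.
by move=> t ht; rewrite (edge_pointE ht).
Qed.

Lemma sub_mapK : cancel sub_map sub_inv.
Proof.
have /andP[h1 h2] := h0.
have inn (a : edge sub_model) t : 0 < t < len a ->
    sub_inv (edge_point (sub_base a) (sub_off a + t)) = edge_point a t.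
  move=> /andP[t1 t2]; rewrite sub_inv_edge; last by apply: sub_range; rewrite !ltW.
  case: a t2 => [e|] /=; last by rewrite eqxx ltrDl t1 addrAC subrr add0r.
  rewrite add0r; case: eqP => //= _ t2.
  by rewrite ltNge ltW.
case=> [[v|]|a t ha] //=; last by rewrite inn // (edge_pointE ha).
rewrite ltxx andbF; have := @edge_point_len R sub_model (Some e0) => /=.
by rewrite eqxx.
Qed.

Lemma sub_invK : cancel sub_inv sub_map.
Proof.
have /andP[h1 h2] := h0.
case=> [v|e t ht] //=; have /andP[ht1 ht2] := ht.
case: ifP => [/andP[/eqP ee tt]|].
  subst e; rewrite sub_map_edge /=; last by lra.
  by rewrite addrC subrK (edge_pointE ht).
move=> hh; rewrite sub_map_edge /= ?add0r ?(edge_pointE ht) //.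
by case: eqP hh => //= _; lra.
Qed.

(** The image of a piece may be a whole chain, because the inverse of a subdivision breaks a piece
    that runs across the new vertex. *)
Lemma dist_edgewise M1 M2 (p : mg_point M1 -> mg_point M2) :
  (forall (e : edge M1) a b, 0 <= a <= len e -> 0 <= b <= len e ->
    exists2 s, chain (p (edge_point e a)) s (p (edge_point e b)) &
    chain_length s = `|a - b|) ->
  forall x y, dist (p x) (p y) <= dist x y.
Proof.
move=> h x y; apply: le_dist => s c.
suff [s' c' <-] : exists2 s', chain (p x) s' (p y) & chain_length s' = chain_length s.
  exact: dist_le.
elim: s x c => [|[[e a] b] s IH] x /=; first by move=> ->; exists [::] => //; rewrite /chain_length !big_nil.
move=> [ha hb <- /IH[s1 c1 l1]]; have [s2 c2 l2] := h e a b ha hb.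
exists (s2 ++ s1); first exact: chain_cat c2 c1.
by rewrite /chain_length big_cat big_cons /= -/(chain_length _) -/(chain_length _) l1 l2.
Qed.

Lemma sub_map_isometry : isometry sub_map.
Proof.
have /andP[h1 h2] := h0; split; first by exists sub_inv; [exact: sub_mapK | exact: sub_invK].
have le1 : forall x y, dist (sub_map x) (sub_map y) <= dist x y.
  apply: dist_edgewise => a u v hu hv; rewrite !sub_map_edge //.
  exists [:: (sub_base a, sub_off a + u, sub_off a + v)].
    by apply: chain1; exact: sub_range.
  by rewrite /chain_length big_seq1 /= opprD addrACA subrr add0r.
have le2 : forall x y, dist (sub_inv x) (sub_inv y) <= dist x y.
  apply: dist_edgewise => e u v hu hv; rewrite !sub_inv_edge //.
  case: (eqVneq e e0) => [ee|ne] /=; last first.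
    have le : @len R sub_model (Some e) = len e by rewrite /= (negbTE ne).
    exists [:: (Some e : edge sub_model, u, v)]; first by apply: chain1; rewrite le.
    by rewrite /chain_length big_seq1.
  have le : @len R sub_model (Some e) = t0 by rewrite /= ee eqxx.
  have le' : @len R sub_model None = len e - t0 by rewrite /= ee.
  have mid : @edge_point R sub_model (Some e) t0 = @edge_point R sub_model None 0.
    by rewrite -{1}le edge_point_len edge_point0 /= ee eqxx.
  have [tu|ut] := ltP t0 u; have [tv|vt] := ltP t0 v.
  - exists [:: (None : edge sub_model, u - t0, v - t0)].
      by apply: chain1; rewrite le'; lra.
    by rewrite /chain_length big_seq1 /=; congr (`|_|); ring.
  - exists [:: (None : edge sub_model, u - t0, 0); (Some e : edge sub_model, t0, v)].
      rewrite -[[:: _; _]]/([:: _] ++ [:: _]); apply: (@chain_cat _ _ _ (@edge_point R sub_model None 0)).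
        by apply: chain1; rewrite le'; lra.
      by rewrite -mid; apply: chain1; rewrite le; lra.
    rewrite /chain_length big_cons big_seq1 /= subr0 !ger0_norm; [ring | lra | lra | lra].
  - exists [:: (Some e : edge sub_model, u, t0); (None : edge sub_model, 0, v - t0)].
      rewrite -[[:: _; _]]/([:: _] ++ [:: _]); apply: (@chain_cat _ _ _ (@edge_point R sub_model (Some e) t0)).
        by apply: chain1; rewrite le; lra.
      by rewrite mid; apply: chain1; rewrite le'; lra.
    by rewrite /chain_length big_cons big_seq1 /= sub0r normrN (@ler0_norm _ (u - t0)) ?(@ger0_norm _ (v - t0)) ?(@ler0_norm _ (u - v)); [ring | lra | lra | lra].
  exists [:: (Some e : edge sub_model, u, v)]; first by apply: chain1; rewrite le; lra.
  by rewrite /chain_length big_seq1.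
move=> x y; apply/eqP; rewrite eq_le le1 /= -{1}(sub_mapK x) -{1}(sub_mapK y).
exact: le2.
Qed.

End OneStep.

End Subdivision.

(** * Principal divisors have degree zero *)

Section DegreeZero.
Context {R : realType}.
Implicit Types (M : model R).

Lemma subdivision_ind M (P : forall H : model R, (mg_point H -> mg_point M) -> Prop) :
  P M id ->
  (forall (H : model R) (psi : mg_point H -> mg_point M) (e : edge H) t
     (h : 0 < t < len e), isometry psi -> P H psi ->
     P (sub_model h) (psi \o @sub_map _ _ _ _ h)) ->
  forall s : seq (mg_point M), exists (H : model R) (psi : mg_point H -> mg_point M),
    [/\ isometry psi, P H psi, forall v, exists w, psi (Vtx w) = Vtx v,
        forall p, p \in s -> exists w, psi (Vtx w) = p &
        forall w, (exists v, psi (Vtx w) = Vtx v) \/ psi (Vtx w) \in s].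
Proof.
move=> P0 PS; elim=> [|p s [H [psi [ipsi PH hV hs hw]]]].
  exists M, id; split=> //; first exact: isometry_id.
    by move=> v; exists v.
  by move=> w; left; exists w.
have [psi' [_ psiK psi'K]] := isometry_inv ipsi.
case e : (psi' p) => [w|a t h].
  exists H, psi; split=> //.
    move=> q; rewrite inE => /predU1P[->|/hs//].
    by exists w; rewrite -e psi'K.
  by move=> v; rewrite inE; case: (hw v) => [|->]; [left|right; rewrite orbT].
exists (sub_model h), (psi \o @sub_map _ _ _ _ h); split.
- exact: isometry_comp (sub_map_isometry h) ipsi.
- exact: PS.
- by move=> v; have [w <-] := hV v; exists (Some w).
- move=> q; rewrite inE => /predU1P[->|/hs[w <-]]; last by exists (Some w).
  by exists None; rewrite /= -e psi'K.
case=> [w|] /=; first by rewrite inE; case: (hw w) => [|->]; [left|right; rewrite orbT].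
by right; rewrite -e psi'K inE eqxx.
Qed.

Lemma subdivision_ex M (s : seq (mg_point M)) :
  exists (H : model R) (psi : mg_point H -> mg_point M),
    [/\ isometry psi, forall v, exists w, psi (Vtx w) = Vtx v,
        forall p, p \in s -> exists w, psi (Vtx w) = p &
        forall w, (exists v, psi (Vtx w) = Vtx v) \/ psi (Vtx w) \in s].
Proof.
have [//|//|H [psi [? _ ? ? ?]]] := @subdivision_ind M (fun _ _ => True) _ _ s.
by exists H, psi; split.
Qed.

Lemma affine_div M (f : mg_point M -> R) (k : edge M -> int) v :
  (forall e t, 0 <= t <= len e ->
    f (edge_point e t) = f (edge_point e 0) + (k e)%:~R * t) ->
  div_of f (Vtx v) = \sum_(e : edge M | src e == v) k e
                   - \sum_(e : edge M | tgt e == v) k e.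
Proof.
move=> h; rewrite /= -sumrN; congr (_ + _); apply: eq_bigr => e /eqP ev.
  have hg : (e, 0, 1) \in germs (Vtx v).
    by rewrite mem_cat; apply/orP; left; apply/mapP; exists e; rewrite // mem_enum inE ev.
  apply: (out_slopeE hg); exists (len e) => [|u hu]; first exact: len_gt0.
  rewrite /germ_point /= add0r mul1r h ?ltW ?edge_point0 ?ev //; lra.
have hg : (e, len e, -1) \in germs (Vtx v).
  by rewrite mem_cat; apply/orP; right; apply/mapP; exists e; rewrite // mem_enum inE ev.
apply: (out_slopeE hg); exists (len e) => [|u hu]; first exact: len_gt0.
rewrite /germ_point /= mulN1r -ev -edge_point_len h; last lra.
rewrite (h e (len e)) ?lexx ?len_ge0 // rmorphN /=; ring.
Qed.

(** Discrete divergence theorem: the edges inside [X] cancel. *)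
Lemma sum_flow (G : graph) (k : edge G -> int) (X : {pred vert G}) :
  \sum_(v in X) (\sum_(e : edge G | src e == v) k e - \sum_(e : edge G | tgt e == v) k e)
  = \sum_(e | (src e \in X) && (tgt e \notin X)) k e
    - \sum_(e | (tgt e \in X) && (src e \notin X)) k e.
Proof.
have h (F : edge G -> vert G) : \sum_(v in X) \sum_(e | F e == v) k e
    = \sum_(e | F e \in X) k e.
  rewrite (partition_big F (mem X)) //=; apply: eq_bigr => v vX.
  by apply: eq_bigl => e; case: eqP => [->|]; rewrite ?vX ?andbF.
rewrite sumrB !h [Y in Y - _](bigID (fun e => tgt e \in X)) /=.
rewrite [Y in _ - Y](bigID (fun e => src e \in X)) /=.
rewrite [Y in _ - (Y + _)](eq_bigl _ _ (fun e => andbC (tgt e \in X) (src e \in X))).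
by rewrite opprD addrACA subrr add0r.
Qed.

(** After subdivision at the supports, [f] is affine on every edge, and each edge contributes
    opposite slopes at its two ends. *)
Lemma lin_equiv_degree M (D E : mg_point M -> int) : is_divisor D ->
  is_divisor E -> lin_equiv D E -> div_degree D = div_degree E.
Proof.
move=> hD hE [f rf hf]; have [s us hs] := is_divisor2 hD hE.
have hF := is_divisorD hD (is_divisorN hE).
apply/eqP; rewrite -subr_eq0 -(div_degreeN hE) -(div_degreeD hD (is_divisorN hE)).
have [H [psi [ipsi _ hp _]]] := subdivision_ex s.
have lf := (rational_locally_linear f).1 rf.
rewrite -(div_degree_isometry _ ipsi).
have h0 (e : edge H) t (h : 0 < t < len e) : D (psi (Inn h)) = 0 /\ E (psi (Inn h)) = 0.
  apply: hs; apply/negP => /hp[w].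
  by move=> /(bij_inj ipsi.1).
rewrite (vtx_support _).2; last by move=> e t h /=; have [-> ->] := h0 e t h.
have hk e : exists k : int, forall t, 0 <= t <= len e ->
    (f \o psi) (edge_point e t) = (f \o psi) (edge_point e 0) + k%:~R * t.
  apply: (@edge_affine _ _ (f \o psi) e) => [|t h].
    exact/rational_locally_linear/locally_linear_isometry.
  by rewrite div_of_isometry // -hf; have [-> ->] := h0 e t h.
have [k {}hk] := boolp.choice hk.
have := @sum_flow H k predT.
rewrite [Y in _ = Y - _]big_pred0 => [|e]; last by rewrite !inE.
rewrite [Y in _ = _ - Y]big_pred0 => [|e]; last by rewrite !inE.
rewrite subr0 => h; apply/eqP; rewrite -[RHS]h; apply: eq_big => [v|v _].
  by rewrite inE.
by rewrite -(affine_div v hk) div_of_isometry // -hf.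
Qed.

Definition pt M (p : mg_point M) : mg_point M -> int := fun x => ((x == p) : nat)%:Z.

Lemma pt_divisor M (p : mg_point M) : is_divisor (pt p).
Proof.
apply/is_divisorP; exists [:: p] => // x; rewrite inE /pt => /negbTE ->.
by [].
Qed.

Lemma pt_degree M (p : mg_point M) : div_degree (pt p) = 1.
Proof.
rewrite (@div_degreeE _ _ _ [:: p]) ?big_seq1 /pt ?eqxx // => x.
by rewrite inE => /negbTE ->.
Qed.

Lemma effective_pt M (D : mg_point M -> int) : effective D -> div_degree D = 1 ->
  exists p, D = pt p.
Proof.
move=> [hD D0] dD; have [p _ Dp] : exists2 p, [set: mg_point M] p & 0 < D p.
  have D1 : 0 < div_degree D by rewrite dD.
  exact: (fsumr_gt0 [::] D1).
exists p; have hE := is_divisorD hD (is_divisorN (pt_divisor p)).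
have : div_degree (fun x => D x + - pt p x) = 0.
  by rewrite (div_degreeD hD (is_divisorN (pt_divisor p))) (div_degreeN (pt_divisor p)) pt_degree dD.
have [s us hs] := (is_divisorP _).1 hE; rewrite (div_degreeE us hs).
have ge0 x : 0 <= D x + - pt p x.
  by rewrite /pt; case: eqP => [->|_]; [lia | rewrite oppr0 addr0].
move=> /eqP; rewrite psumr_eq0 // => /allP h; apply/funext => x.
apply/eqP; rewrite -subr_eq0; have [xs|/hs ->//] := boolP (x \in s).
exact: h.
Qed.

Lemma effective_degree_ge0 M (D : mg_point M -> int) : effective D -> 0 <= div_degree D.
Proof. by move=> [_ h]; apply: fsumr_ge0. Qed.

Lemma effectiveD M (D E : mg_point M -> int) : effective D -> effective E ->
  effective (fun x => D x + E x).
Proof. by move=> [h1 h2] [h3 h4]; split; [exact: is_divisorD|move=> x; exact: addr_ge0]. Qed.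

Lemma pt_effective M (p : mg_point M) : effective (pt p).
Proof. by split; [exact: pt_divisor|]. Qed.

Lemma multiple_pt M (p : mg_point M) k : effective (fun x => pt p x *+ k) /\
  div_degree (fun x => pt p x *+ k) = k%:Z.
Proof.
have hs x : x \notin [:: p] -> pt p x *+ k = 0.
  by rewrite inE /pt => /negbTE ->; rewrite mul0rn.
split; last by rewrite (@div_degreeE _ _ _ [:: p]) // big_seq1 /pt eqxx; exact: natz.
split; first by apply/is_divisorP; exists [:: p].
by move=> x; apply: mulrn_wge0.
Qed.

(** [is_rank] asks for the exact rank. It exists because the degree bounds it: if [D] minus [j]
    chips at a point is equivalent to an effective divisor, then 3 - j is nonnegative. *)
Lemma trigonal_of_points M (D : mg_point M -> int) : is_divisor D -> div_degree D = 3 ->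
  (forall p, equiv_effective (fun x => D x - pt p x)) -> divisorially_trigonal M.
Proof.
move=> hD dD hp; exists D; split=> //.
have [v0 _] := card_gt0P (vert_gt0 M); pose p0 : mg_point M := Vtx v0.
have r1 : rank_ge D 1.
  by move=> E effE /(effective_pt effE)[p ->]; exact: hp.
have bound j : rank_ge D j -> (j <= 3)%N.
  move=> /(_ _ (multiple_pt p0 j).1 (multiple_pt p0 j).2)[E effE eqE].
  have dv := is_divisorD hD (is_divisorN (multiple_pt p0 j).1.1).
  have := lin_equiv_degree dv effE.1 eqE.
  rewrite (div_degreeD hD (is_divisorN (multiple_pt p0 j).1.1)).
  rewrite (div_degreeN (multiple_pt p0 j).1.1) (multiple_pt p0 j).2 dD => e.
  by have := effective_degree_ge0 effE; rewrite -e; lia.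
have ex : exists k, `[< rank_ge D k >] by exists 1%N; apply/asboolP.
have ub k : `[< rank_ge D k >] -> (k <= 3)%N by move=> /asboolP/bound.
case: (ex_maxnP ex ub) => k /asboolP rk kmax.
exists k%:Z; last by have := kmax 1%N; rewrite lez_nat; apply; apply/asboolP.
right; split; last by exists k; split=> // j rj; apply: kmax; apply/asboolP.
have [E effE eqE] := hp p0; exists (fun x => E x + pt p0 x).
  exact: effectiveD effE (pt_effective p0).
have := lin_equiv_shift (pt p0) eqE.
suff -> : (fun x => D x - pt p0 x + pt p0 x) = D by [].
by apply/funext => x; rewrite subrK.
Qed.

(** The rank [k] may exceed 1, and [rank_ge D k] only speaks of degree [k]; so [k] chips at [p] are
    removed and put back afterwards. *)
Lemma trigonal_points M : divisorially_trigonal M -> exists D : mg_point M -> int,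
  [/\ is_divisor D, div_degree D = 3 &
  forall p, exists E, [/\ effective E, 1 <= E p, div_degree E = 3 & lin_equiv D E]].
Proof.
move=> [D [hD dD [r hr r1]]]; exists D; split=> // p.
case: hr => [[_ e]|[_ [k [e rk _]]]]; first by move: r1; rewrite e.
have [E0 effE eqE] := rk _ (multiple_pt p k).1 (multiple_pt p k).2.
have eff : effective (fun x => E0 x + pt p x *+ k).
  exact: effectiveD effE (multiple_pt p k).1.
have eqD : lin_equiv D (fun x => E0 x + pt p x *+ k).
  have := lin_equiv_shift (fun x => pt p x *+ k) eqE.
  suff -> : (fun x => (D \- (fun x => pt p x *+ k)) x + pt p x *+ k) = D by [].
  by apply/funext => x /=; rewrite subrK.
exists (fun x => E0 x + pt p x *+ k); split=> //.
  have := effE.2 p; rewrite /pt eqxx (natz k); move: r1; rewrite e; lia.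
by rewrite -dD; apply/esym/lin_equiv_degree => //; case: eff.
Qed.

Lemma trigonal_isometry M M' (psi : mg_point M -> mg_point M') : isometry psi ->
  divisorially_trigonal M' -> divisorially_trigonal M.
Proof.
move=> ipsi /trigonal_points[D [hD dD hp]]; apply: (@trigonal_of_points _ (D \o psi)).
- exact: is_divisor_isometry.
- by rewrite div_degree_isometry.
move=> p; have [E [effE Ep dE eqE]] := hp (psi p).
exists (fun x => E (psi x) - pt p x).
  split.
    exact: (is_divisorD (is_divisor_isometry ipsi effE.1) (is_divisorN (pt_divisor p))).
  move=> x; have := effE.2 (psi x); rewrite /pt; case: eqP => [->|_]; first by lia.
  by rewrite subr0.
exact: lin_equiv_shift (lin_equiv_isometry ipsi eqE).
Qed.

End DegreeZero.

(** * Piecewise linear functions with prescribed divisor *)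

Section Hinges.
Context {R : realType}.
Implicit Types (M : model R) (s : seq (R * int)).

(* A list [(b_i, k_i)] encodes the piecewise linear function whose slope
   changes by [k_i] at [b_i]. *)
Definition hinge s (t : R) : R := \sum_(p <- s) p.2%:~R * Num.max 0 (t - p.1).

Lemma hinge0 s t : (forall p, p \in s -> t <= p.1) -> hinge s t = 0.
Proof.
move=> h; rewrite /hinge big_seq big1 // => p /h hp.
by rewrite max_l ?mulr0 // subr_le0.
Qed.

Lemma hinge_right s t : eventually0 (fun h =>
  hinge s (t + h) = hinge s t + (\sum_(p <- s | p.1 <= t) p.2)%:~R * h).
Proof.
elim: s => [|[b k] s IH]; first by exists 1 => // h _; rewrite /hinge !big_nil mul0r addr0.
have h1 : eventually0 (fun h => Num.max 0 (t + h - b) = Num.max 0 (t - b) + ((b <= t)%R)%:R * h).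
  have [bt|tb] := lerP b t.
    by exists 1 => // h hh; rewrite !max_r; [rewrite /=; ring | lra | lra].
  by exists (b - t) => [|h hh]; [lra | rewrite !max_l; [rewrite /=; ring | lra | lra]].
apply: eventually0_imp (eventually0_and h1 IH) => h _ [e1].
rewrite /hinge !big_cons /= e1 => ->; case: (b <= t) => /=; rewrite ?rmorphD /=; ring.
Qed.

Lemma hinge_left s t : eventually0 (fun h =>
  hinge s (t - h) = hinge s t + (- \sum_(p <- s | p.1 < t) p.2)%:~R * h).
Proof.
elim: s => [|[b k] s IH]; first by exists 1 => // h _; rewrite /hinge !big_nil oppr0 mul0r addr0.
have h1 : eventually0 (fun h => Num.max 0 (t - h - b) = Num.max 0 (t - b) - ((b < t)%R)%:R * h).
  have [tb|bt] := lerP t b.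
    by exists 1 => // h hh; rewrite !max_l; [rewrite /=; ring | lra | lra].
  by exists (t - b) => [|h hh]; [lra | rewrite !max_r; [rewrite /=; ring | lra | lra]].
apply: eventually0_imp (eventually0_and h1 IH) => h _ [e1].
rewrite /hinge !big_cons /= e1 => ->; case: (b < t) => /=; rewrite ?opprD ?rmorphD ?rmorphN /=; ring.
Qed.

Section HingeFunction.
Variables (M : model R) (g : vert M -> R) (kk : edge M -> seq (R * int)).
Hypothesis range : forall e p, p \in kk e -> 0 <= p.1 <= len e.
Hypothesis total : forall e, \sum_(p <- kk e) p.2 = 0.
Hypothesis ends : forall e, g (tgt e) = g (src e) + hinge (kk e) (len e).

Definition hinge_fun (x : mg_point M) : R :=
  match x with
  | Vtx v => g v
  | Inn e t _ => g (src e) + hinge (kk e) t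
  end.

Lemma hinge_fun_edge e t : 0 <= t <= len e ->
  hinge_fun (edge_point e t) = g (src e) + hinge (kk e) t.
Proof.
move: t; apply: edge_ind.
- by rewrite edge_point0 /= hinge0 ?addr0 // => p /range/andP[].
- by rewrite edge_point_len /= ends.
- by move=> t ht; rewrite (edge_pointE ht).
Qed.

Lemma hinge_fun_right e t : 0 <= t < len e -> eventually0 (fun h =>
  hinge_fun (germ_point (e, t, 1) h) = hinge_fun (edge_point e t)
    + (\sum_(p <- kk e | p.1 <= t) p.2)%:~R * h).
Proof.
move=> /andP[t0 t1]; have hl : eventually0 (fun h => h < len e - t).
  by apply: eventually0_lt; rewrite subr_gt0.
apply: eventually0_imp (eventually0_and hl (hinge_right (kk e) t)) => h h0 [h1 e1].
rewrite /germ_point /= mul1r !hinge_fun_edge ?e1 ?addrA //; lra.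
Qed.

Lemma hinge_fun_left e t : 0 < t <= len e -> eventually0 (fun h =>
  hinge_fun (germ_point (e, t, -1) h) = hinge_fun (edge_point e t)
    + (- \sum_(p <- kk e | p.1 < t) p.2)%:~R * h).
Proof.
move=> /andP[t0 t1]; have hl : eventually0 (fun h => h < t) by exact: eventually0_lt.
apply: eventually0_imp (eventually0_and hl (hinge_left (kk e) t)) => h h0 [h1 e1].
rewrite /germ_point /= mulN1r !hinge_fun_edge ?e1 ?addrA //; lra.
Qed.

Lemma hinge_locally_linear : locally_linear hinge_fun.
Proof.
move=> x [[e t] sg] /germsP[[/= /andP[t0 t1] [->|->] h1 h2] <-].
  by eexists; apply: hinge_fun_right; rewrite t0 h1.
by eexists; apply: hinge_fun_left; rewrite t1 h2.
Qed.

(** A slope change at parameter 0 is the outgoing slope at the source. By [total], the changes at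
    [len e] add up to minus the slope just before it, which is the outgoing slope at the target.
    Breakpoints at vertices thus count like inner ones. *)
Lemma hinge_div x : div_of hinge_fun x =
  \sum_(e : edge M) \sum_(p <- kk e | edge_point e p.1 == x) p.2.
Proof.
case: x => [v|e t h]; last first.
  have /andP[t0 t1] := h.
  have g1 : (e, t, 1) \in germs (Inn h) by rewrite inE eqxx.
  have g2 : (e, t, -1) \in germs (Inn h) by rewrite !inE eqxx orbT.
  have r : 0 <= t < len e by rewrite t1 ltW.
  have l : 0 < t <= len e by rewrite t0 ltW.
  have := hinge_fun_right r; have := hinge_fun_left l; rewrite (edge_pointE h) => hl hr.
  rewrite /= (out_slopeE g1 hr) (out_slopeE g2 hl) (bigD1 e) //= [X in _ = _ + X]big1; last first.
    move=> e' ne; rewrite big_seq_cond big1 // => p /andP[/range hp /eqP ep].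
    have := edge_point_interior h hp; rewrite ep (edge_pointE h) => /(_ erefl)[ee _].
    by rewrite ee eqxx in ne.
  rewrite addr0 big_mkcond [X in _ - X]big_mkcond [RHS]big_mkcond -sumrB big_seq [RHS]big_seq.
  apply: eq_bigr => p hp.
  have -> : (edge_point e p.1 == Inn h) = (p.1 == t).
    apply/eqP/eqP => [ep|->]; last exact: edge_pointE.
    by have := edge_point_interior h (range hp); rewrite ep (edge_pointE h) => /(_ erefl)[].
  by rewrite le_eqVlt; case: (eqVneq p.1 t) => [->|_] /=; rewrite ?ltxx ?subr0 // subrr.
rewrite /= [X in X + _]big_mkcond [X in _ + X]big_mkcond -big_split; apply: eq_bigr => e _ /=.
have l0 := len_gt0 e.
have -> : (if src e == v then out_slope hinge_fun e 0 1 else 0)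
    = \sum_(p <- kk e | (p.1 == 0) && (src e == v)) p.2.
  case: eqP => [ev|_]; last by rewrite big_pred0 // => p; rewrite andbF.
  have hg : (e, 0, 1) \in germs (Vtx v).
    by rewrite mem_cat; apply/orP; left; apply/mapP; exists e; rewrite // mem_enum inE ev.
  have r : (0 : R) <= 0 < len e by rewrite lexx l0.
  have := hinge_fun_right r; rewrite edge_point0 ev => hr; rewrite (out_slopeE hg hr).
  rewrite big_seq_cond [RHS]big_seq_cond; apply: eq_bigl => p; rewrite andbT.
  case: (boolP (p \in kk e)) => // /range/andP[p0 _] /=.
  by rewrite eq_le p0 andbT.
have -> : (if tgt e == v then out_slope hinge_fun e (len e) (-1) else 0)
    = \sum_(p <- kk e | (p.1 == len e) && (tgt e == v)) p.2.
  case: eqP => [ev|_]; last by rewrite big_pred0 // => p; rewrite andbF.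
  have hg : (e, len e, -1) \in germs (Vtx v).
    by rewrite mem_cat; apply/orP; right; apply/mapP; exists e; rewrite // mem_enum inE ev.
  have l : 0 < len e <= len e by rewrite lexx l0.
  have := hinge_fun_left l; rewrite edge_point_len ev => hl; rewrite (out_slopeE hg hl).
  have := total e; rewrite (bigID (fun p : R * int => p.1 < len e)) /= => /eqP.
  rewrite addrC addr_eq0 => /eqP <-.
  rewrite big_seq_cond [RHS]big_seq_cond; apply: eq_bigl => p; rewrite andbT.
  case: (boolP (p \in kk e)) => // /range/andP[_ p1] /=.
  by rewrite -leNgt eq_le p1.
rewrite [X in X + _]big_mkcond [X in _ + X]big_mkcond [RHS]big_mkcond -big_split.
rewrite big_seq [RHS]big_seq; apply: eq_bigr => p hp /=.
have hr := range hp.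
have [p0|p0] := eqVneq p.1 0.
  rewrite p0 edge_point0 [0 == len e]lt_eqF //= addr0.
  have -> // : (Vtx (src e) == Vtx v :> mg_point M) = (src e == v).
  by apply/eqP/eqP => [[]|->].
have [p1|p1] := eqVneq p.1 (len e).
  rewrite p1 edge_point_len /= add0r.
  have -> // : (Vtx (tgt e) == Vtx v :> mg_point M) = (tgt e == v).
  by apply/eqP/eqP => [[]|->].
rewrite /= addr0; case: eqP => // /(edge_point_Vtx hr)[[e1 _]|[e1 _]].
  by rewrite e1 eqxx in p0.
by rewrite e1 eqxx in p1.
Qed.

End HingeFunction.

(** The function is a trapezoid of height [d]: it climbs with slope 1 from [a] to [a + d], is
    constant up to [b], descends to 0 at [b + d], and vanishes elsewhere. *)
Lemma slide_equiv M (e : edge M) (a b d : R) : 0 <= a -> 0 <= d -> a + d <= b ->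
  b + d <= len e ->
  lin_equiv (fun x => pt (edge_point e a) x + pt (edge_point e (b + d)) x)
            (fun x => pt (edge_point e (a + d)) x + pt (edge_point e b) x).
Proof.
move=> a0 d0 ab bl.
pose kk (e' : edge M) : seq (R * int) :=
  if e' == e then [:: (a, 1); (a + d, -1); (b, -1); (b + d, 1)] else [::].
have kke : kk e = [:: (a, 1); (a + d, -1); (b, -1); (b + d, 1)] by rewrite /kk eqxx.
have kkn e' : e' != e -> kk e' = [::] by rewrite /kk => /negbTE->.
have r e' p : p \in kk e' -> 0 <= p.1 <= len e'.
  have [->|/kkn->//] := eqVneq e' e.
  rewrite kke !inE => /or4P[] /eqP-> /=; lra.
have t e' : \sum_(p <- kk e') p.2 = 0.
  have [->|/kkn->] := eqVneq e' e; last by rewrite big_nil.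
  by rewrite kke !big_cons big_nil.
have en (e' : edge M) : 0 = 0 + hinge (kk e') (len e').
  rewrite add0r /hinge; have [->|/kkn->] := eqVneq e' e; last by rewrite big_nil.
  by rewrite kke !big_cons big_nil /= !max_r; lra.
exists (hinge_fun (fun=> 0) kk).
  exact/rational_locally_linear/hinge_locally_linear.
move=> x; rewrite hinge_div // (bigD1 e) //= [X in _ = _ + X]big1 => [|e' /kkn ->]; last by rewrite big_nil.
rewrite kke !big_cons big_nil /pt /= !(eq_sym x).
by do !case: eqP => _.
Qed.

End Hinges.

(** * Pullbacks from trees *)

Section Trees.

(* A 2-colouring of the vertices is determined by its value at one vertex and
   its coboundary, so 2^|V| <= 2 * 2^|E|. *)
Lemma card_vert_connected (V E : finType) (s t : E -> V) (S : {set E}) :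
  (forall x y, connect (adj s t S) x y) -> (#|V| <= #|[pred e | e \notin S]|.+1)%N.
Proof.
move=> conn; have [V0|/card_gt0P[r _]] := posnP #|V|; first by rewrite V0.
pose cob (c : {ffun V -> bool}) :=
  (c r, [ffun e : {e | e \notin S} => c (s (val e)) (+) c (t (val e))]).
have cob_inj : injective cob.
  move=> c d [cr /ffunP ce]; apply/ffunP => x.
  have /connectP[p pth ->] := conn r x.
  suff key z : c z = d z -> path (adj s t S) z p -> c (last z p) = d (last z p).
    exact: key.
  elim: p z {pth} => [|y p IH] z cz //= /andP[/existsP[e /andP[eS h]]].
  apply: IH; have := ce (Sub e eS); rewrite !ffunE !SubK.
  by case/orP: h => /andP[/eqP-> /eqP->]; rewrite cz;
    move: (c y) (d y) (d z) => [] [] [].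
have := leq_card cob cob_inj; rewrite card_prod !card_ffun !card_bool card_sig.
by rewrite -expnS leq_exp2l.
Qed.

(** If the graph stayed connected without [e], [card_vert_connected] would give |V| <= |E|, whereas
    genus 0 means |E| + 1 <= |V|. *)
Lemma tree_bridge (G : graph) (e : edge G) : is_tree G ->
  ~~ connect (adj (@src G) (@tgt G) (finset.set1 e)) (src e) (tgt e).
Proof.
rewrite /is_tree /genus => gen; apply/negP => conn.
have conn1 x y : connect (adj (@src G) (@tgt G) (finset.set1 e)) x y.
  have /connectP[p pth ->] := graph_conn x y.
  elim: p x pth => [|z p IH] x //= /andP[/existsP[e' /andP[_ h]] /IH].
  apply: connect_trans; have [ee|ne] := eqVneq e' e.
    by case/orP: h => /andP[/eqP<- /eqP<-]; rewrite ee // connect_adj_sym.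
  have h' : connect (adj (@src G) (@tgt G) (finset.set1 e)) (src e') (tgt e').
    by apply: adj_edge; rewrite finset.inE.
  by case/orP: h => /andP[/eqP<- /eqP<-] //; rewrite connect_adj_sym.
have := card_vert_connected conn1.
have : (#|[pred e' | e' \notin finset.set1 e]|.+1 = #|edge G|)%N.
  rewrite [RHS](cardD1 e) inE add1n; congr S; apply: eq_card => e'.
  by rewrite !inE andbT.
lia.
Qed.

Definition bridge_side (G : graph) (e : edge G) : {pred vert G} :=
  connect (adj (@src G) (@tgt G) (finset.set1 e)) (src e).

Lemma bridge_side_edge (G : graph) (e e' : edge G) : e' != e ->
  (src e' \in bridge_side e) = (tgt e' \in bridge_side e).
Proof.
move=> ne; have h : connect (adj (@src G) (@tgt G) (finset.set1 e)) (src e') (tgt e').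
  by apply: adj_edge; rewrite finset.inE.
apply/idP/idP => h'; apply: connect_trans h' _ => //.
by rewrite connect_adj_sym.
Qed.

End Trees.

(** * Divisors of degree 3 from morphisms and from few vertices *)

Section Pullback.
Context {R : realType}.
Implicit Types (M : model R).

Lemma equiv_effective_pt M (D E : mg_point M -> int) p : effective E -> 1 <= E p ->
  lin_equiv D E -> equiv_effective (fun x => D x - pt p x).
Proof.
move=> effE Ep eqE; exists (fun x => E x - pt p x); last exact: (lin_equiv_shift (fun x => - pt p x)).
split; first exact: (is_divisorD effE.1 (is_divisorN (pt_divisor p))).
move=> x; have := effE.2 x; rewrite /pt; case: eqP => [->|_]; first by lia.
by rewrite subr0.
Qed.

(** Chips at the two ends of [e] move inwards by the distance [d] from the point to the nearer end,
    so that one of them lands on it. As the ends are distinct, both chips can be taken off [D]. *)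
Lemma slide_point M (D : mg_point M -> int) (e : edge M) t (h : 0 < t < len e) :
  effective D -> src e != tgt e -> 1 <= D (Vtx (src e)) -> 1 <= D (Vtx (tgt e)) ->
  exists E, [/\ effective E, 1 <= E (Inn h) & lin_equiv D E].
Proof.
move=> effD ne Ds Dt; have /andP[t0 t1] := h.
pose d := Num.min t (len e - t).
have [d0 dl dt] : [/\ 0 <= d, d + d <= len e & d = t \/ len e - d = t].
  by rewrite /d; case: (leP t (len e - t)) => h'; (split; [lra | lra |]); [left | right; lra].
pose F x := D x - pt (Vtx (src e)) x - pt (Vtx (tgt e)) x.
have effF : effective F.
  split.
    exact: (is_divisorD (is_divisorD effD.1 (is_divisorN (pt_divisor (Vtx (src e)))))
      (is_divisorN (pt_divisor (Vtx (tgt e))))).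
  move=> x; rewrite /F /pt; case: eqP => [->|_]; last first.
    by rewrite subr0; case: eqP => [->|_]; [lia | rewrite subr0; exact: effD.2].
  case: eqP => [[]|_]; first by move=> e1; rewrite e1 eqxx in ne.
  by lia.
exists (fun x => pt (edge_point e d) x + pt (edge_point e (len e - d)) x + F x).
split.
- exact: (effectiveD (effectiveD (pt_effective _) (pt_effective _)) effF).
- have := effF.2 (Inn h); have := (pt_effective (edge_point e d)).2 (Inn h).
  have := (pt_effective (edge_point e (len e - d))).2 (Inn h).
  by rewrite -(edge_pointE h); case: dt => ->; rewrite /pt eqxx; lia.
have := @slide_equiv _ _ e 0 (len e - d) d (lexx _) d0 ltac:(lra) ltac:(lra).
rewrite subrK edge_point0 edge_point_len add0r => /(lin_equiv_shift F).
suff -> : (fun x => pt (Vtx (src e)) x + pt (Vtx (tgt e)) x + F x) = D by [].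
by apply/funext => x; rewrite /F; ring.
Qed.

Section Morphism.
Variables (H H' : model R) (phi : indexed_morphism H H').
Hypotheses (mm : metric_morphism phi) (harm : is_harmonic phi)
  (nondeg : is_nondegenerate phi) (deg : degree phi = 3%N)
  (tree : is_tree H') (noloop : forall e : edge H, ~~ is_loop e).

Let mu (e : edge H) : R := (edge_index phi e)%:R.

Let muE e e' : mapE phi e = inr e' -> 0 < mu e /\ len e' = mu e * len e.
Proof.
move=> h; have := mm h; rewrite /mu => ->; split.
  by rewrite divr_gt0 ?len_gt0.
by rewrite divfK // gt_eqF // len_gt0.
Qed.

Let edge_ends e e' : mapE phi e = inr e' ->
  (mapV phi (src e) = src e' /\ mapV phi (tgt e) = tgt e') \/
  (mapV phi (src e) = tgt e' /\ mapV phi (tgt e) = src e').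
Proof. by move=> /mapE_edge[[-> ->]|[-> ->]]; [left|right]. Qed.

Let bridge (e' : edge H') : tgt e' \notin bridge_side e'.
Proof. exact: tree_bridge. Qed.

Let side (e' : edge H') : src e' \in bridge_side e'.
Proof. exact: connect0. Qed.

Let ends_neq (e' : edge H') : (tgt e' == src e') = false.
Proof. by apply/negbTE; apply: contraNneq (bridge e') => ->. Qed.

(** The parameter on [e] of the point over the parameter [tau] of [e']: [mu e] is the stretching
    factor, and [e] may run against the orientation of [e']. *)
Let kink (e' : edge H') (tau : R) (e : edge H) : R :=
  if mapV phi (src e) == src e' then tau / mu e else len e - tau / mu e.

Let fibre (e' : edge H') (tau : R) (x : mg_point H) : int :=
  \sum_(e | mapE phi e == inr e') (edge_index phi e)%:Z * pt (edge_point e (kink e' tau e)) x.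

Let kink_range e' tau e : 0 <= tau <= len e' -> mapE phi e = inr e' ->
  0 <= tau / mu e <= len e.
Proof.
move=> /andP[t0 t1] he; have [m0 ml] := muE he.
by rewrite divr_ge0 ?(ltW m0) //= ler_pdivrMr // mulrC -ml.
Qed.

Let fibre_effective e' tau : effective (fibre e' tau).
Proof.
split; last by move=> x; apply: sumr_ge0 => e _; rewrite mulr_ge0.
apply/is_divisorP; exists (undup [seq edge_point e (kink e' tau e) | e <- enum (edge H)]).
  exact: undup_uniq.
move=> x; rewrite mem_undup => hx; rewrite /fibre big1 // => e _; rewrite /pt.
case: eqP hx => [->|_ _]; last by rewrite mulr0.
by move=> /negP[]; apply/mapP; exists e; rewrite ?mem_enum.
Qed.

(** The function is pulled back from the tree: 0 on the source side of [e'], of slope 1 along [e']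
    up to [tau], and [tau] beyond. It is well defined because [e'] is a bridge. *)
Let fibre_equiv e' tau : 0 <= tau <= len e' -> lin_equiv (fibre e' 0) (fibre e' tau).
Proof.
move=> ht; pose k e := (edge_index phi e)%:Z.
pose kk (e : edge H) : seq (R * int) := if mapE phi e == inr e' then
  (if mapV phi (src e) == src e' then [:: (0, k e); (tau / mu e, - k e)]
   else [:: (len e - tau / mu e, - k e); (len e, k e)]) else [::].
pose g (v : vert H) : R := if mapV phi v \in bridge_side e' then 0 else tau.
have kR e : (k e)%:~R = mu e by rewrite /k /mu -pmulrn.
have r e p : p \in kk e -> 0 <= p.1 <= len e.
  rewrite /kk; case: eqP => // he; have := kink_range ht he; have := len_ge0 e.
  by case: eqP => _ l0 hr; rewrite !inE => /orP[] /eqP-> /=; lra.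
have t e : \sum_(p <- kk e) p.2 = 0.
  rewrite /kk; case: eqP => _; last by rewrite big_nil.
  by case: eqP => _; rewrite !big_cons big_nil addr0 ?subrr ?addNr.
have en e : g (tgt e) = g (src e) + hinge (kk e) (len e).
  rewrite /kk; case: eqP => [he|ne].
    have [m0 ml] := muE he; have := kink_range ht he => kr; have l0 := len_gt0 e.
    have km : mu e * (tau / mu e) = tau by rewrite mulrC divfK // gt_eqF.
    rewrite /hinge /g; case: (edge_ends he) => -[-> ->].
      rewrite eqxx side (negbTE (bridge e')) !big_cons big_nil /= !max_r ?rmorphN /= ?kR; lra.
    rewrite ends_neq side (negbTE (bridge e')) !big_cons big_nil /= !max_r ?rmorphN /= ?kR; lra.
  rewrite /hinge big_nil addr0 /g; case he : (mapE phi e) => [w|e''].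
    by have [-> ->] := mapE_vert he.
  have ne' : e'' != e' by apply: contra_not_neq ne => <-.
  by case: (edge_ends he) => -[-> ->]; rewrite (bridge_side_edge ne').
exists (hinge_fun g kk); first exact/rational_locally_linear/hinge_locally_linear.
move=> x; rewrite hinge_div // /fibre -sumrB big_mkcond; apply: eq_bigr => e _.
rewrite /kk /kink; case: eqP => [he|_]; last by rewrite big_nil.
rewrite mul0r subr0 -/(k e) /pt.
case: (mapV phi (src e) == src e'); rewrite !big_cons big_nil /= !(eq_sym x);
by do 2 case: eqP => _ /=; ring.
Qed.

Definition pullback (u : vert H') (x : mg_point H) : int :=
  if x is Vtx v then (if mapV phi v == u then (local_degree phi v)%:Z else 0) else 0.

Let local_degreeE v e' : incident e' (mapV phi v) -> local_degree phi v = local_sum phi v e'.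
Proof.
move=> h; rewrite /local_degree; case: pickP => [e2 h2|/(_ e')]; last by rewrite h.
exact: harm.
Qed.

(** Over an end [u] of [e'] the fibre consists of vertices, and each collects the indices of its
    edges over [e']. By harmonicity this is its local degree whichever edge at [u] is used, so the
    fibres of adjacent edges fit together. *)
Let pull_fibre e' tau u : incident e' u ->
  (forall e, mapE phi e = inr e' -> exists w, [/\ edge_point e (kink e' tau e) = Vtx w,
     mapV phi w = u & forall v, mapV phi v = u -> incident e v = (v == w)]) ->
  pullback u = fibre e' tau.
Proof.
move=> eu hw; apply/funext => -[v|e t h]; last first.
  rewrite /fibre big1 // => e2 /eqP/hw[w [-> _ _]].
  by rewrite /pt; case: eqP => // _; exact: mulr0.
rewrite /pullback /fibre; case: eqP => [vu|nvu]; last first.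
  rewrite big1 // => e2 /eqP/hw[w [-> wu _]]; rewrite /pt.
  by case: eqP => [[vw]|_]; [case: nvu; rewrite vw | exact: mulr0].
rewrite (@local_degreeE v e') ?vu // /local_sum (big_morph Posz PoszD (erefl _)).
rewrite big_mkcondl; apply: eq_bigr => e2 /eqP/hw[w [-> _ hv]]; rewrite hv // /pt.
have -> : (Vtx v == Vtx w :> mg_point H) = (v == w).
  by apply/eqP/eqP => [[]|->].
by case: eqP => _; apply/esym; [exact: mulr1 | exact: mulr0].
Qed.

Let pull_src e' : pullback (src e') = fibre e' 0.
Proof.
apply: pull_fibre => [|e he]; first by rewrite /incident eqxx.
rewrite /kink mul0r subr0; case: (edge_ends he) => -[e1 e2].
  exists (src e); rewrite e1 eqxx edge_point0; split=> // v hv.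
  rewrite /incident orbC; case: eqP => [tv|_]; last by rewrite eq_sym.
  by move: e2; rewrite tv hv => /esym/eqP; rewrite ends_neq.
exists (tgt e); rewrite e1 ends_neq edge_point_len; split=> // v hv.
rewrite /incident; case: eqP => [tv|_]; last by rewrite eq_sym.
by move: e1; rewrite tv hv => /esym/eqP; rewrite ends_neq.
Qed.

Let pull_tgt e' : pullback (tgt e') = fibre e' (len e').
Proof.
apply: pull_fibre => [|e he]; first by rewrite /incident eqxx orbT.
have [m0 ml] := muE he.
have q : len e' / mu e = len e by rewrite ml mulrC mulKf // gt_eqF.
rewrite /kink q subrr; case: (edge_ends he) => -[e1 e2].
  exists (tgt e); rewrite e1 eqxx edge_point_len; split=> // v hv.
  rewrite /incident; case: eqP => [tv|_]; last by rewrite eq_sym.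
  by move: e1; rewrite tv hv => /eqP; rewrite ends_neq.
exists (src e); rewrite e1 ends_neq edge_point0; split=> // v hv.
rewrite /incident orbC; case: eqP => [tv|_]; last by rewrite eq_sym.
by move: e2; rewrite tv hv => /eqP; rewrite ends_neq.
Qed.

Lemma pullback_equiv u w : lin_equiv (pullback u) (pullback w).
Proof.
have step (e' : edge H') : lin_equiv (pullback (src e')) (pullback (tgt e')).
  rewrite pull_src pull_tgt; apply: fibre_equiv.
  by rewrite len_ge0 lexx.
have /connectP[p pth ->] := graph_conn u w.
elim: p u pth => [|z p IH] u /=; first by move=> _; exact: lin_equiv_refl.
move=> /andP[/existsP[e /andP[_ h]] /IH]; apply: lin_equiv_trans.
by case/orP: h => /andP[/eqP<- /eqP<-]; [exact: step | apply: lin_equiv_sym; exact: step].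
Qed.

Lemma pullback_effective u : effective (pullback u).
Proof.
split; last by case=> //= v; case: eqP.
by have [] := @vtx_support _ _ (pullback u).
Qed.

Lemma pullback_degree : exists u, div_degree (pullback u) = 3.
Proof.
(* [degree] is 0 by default on a graph without edges, so degree 3 provides an edge [e']. *)
move: deg; rewrite /degree; case: pickP => // e' _ h; exists (src e').
rewrite (vtx_support _).2 // pull_src -[3]/(3%N%:Z) -h (big_morph Posz PoszD (erefl _)).
rewrite exchange_big; apply: eq_bigr => e /eqP he /=.
have [w ew] : exists w, edge_point e (kink e' 0 e) = Vtx w.
  rewrite /kink mul0r subr0; case: ifP => _; first by exists (src e); rewrite edge_point0.
  by exists (tgt e); rewrite edge_point_len.
rewrite (bigD1 w) //= ew /pt eqxx (mulr1 (Posz _)) big1 ?addr0 // => v vw.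
case: eqP => [[e1]|_]; last exact: mulr0.
by rewrite e1 eqxx in vw.
Qed.

Lemma pullback_trigonal : divisorially_trigonal H.
Proof.
have [u0 du0] := pullback_degree.
apply: (trigonal_of_points (D := pullback u0)) => //; first by case: (pullback_effective u0).
move=> p; suff [u [E [effE Ep eqE]]] : exists u E, [/\ effective E, 1 <= E p & lin_equiv (pullback u) E].
  by apply: (equiv_effective_pt effE Ep); apply: lin_equiv_trans eqE; exact: pullback_equiv.
have pull_ge v u : mapV phi v = u -> 1 <= pullback u (Vtx v).
  by move=> hu; rewrite /pullback hu eqxx lez_nat; exact: nondeg.2.
case: p => [v|e t h].
  exists (mapV phi v), (pullback (mapV phi v)); split.
  - exact: pullback_effective.
  - exact: pull_ge.
  - exact: lin_equiv_refl.
case he : (mapE phi e) => [w|e'].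
  exists w; have [e1 e2] := mapE_vert he; apply: slide_point.
  - exact: pullback_effective.
  - exact: noloop.
  - exact: pull_ge.
  - exact: pull_ge.
have [m0 ml] := muE he; have /andP[t0 t1] := h.
have key tau : 0 <= tau <= len e' -> kink e' tau e = t -> exists u E,
    [/\ effective E, 1 <= E (Inn h) & lin_equiv (pullback u) E].
  move=> ht ek; exists (src e'), (fibre e' tau); split; first exact: fibre_effective.
    rewrite /fibre (bigD1 e) /=; last by rewrite he.
    rewrite ek (edge_pointE h) /pt eqxx (mulr1 (Posz _)).
    have i1 : (0 < edge_index phi e)%N by rewrite -(ltr0n R).
    rewrite -[1]addr0; apply: lerD; first by rewrite lez_nat.
    by apply: sumr_ge0 => i _; rewrite mulr_ge0.
  by rewrite pull_src; exact: fibre_equiv.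
have r1 : 0 <= mu e * t <= len e'.
  by rewrite ml mulr_ge0 ?(ltW m0) ?(ltW t0) //= ler_pM2l // ltW.
have r2 : 0 <= mu e * (len e - t) <= len e'.
  by rewrite ml mulr_ge0 ?(ltW m0) //= ?ler_pM2l //; lra.
have q x : mu e * x / mu e = x by rewrite mulrC mulKf // gt_eqF.
case: (edge_ends he) => -[e1 e2].
  by apply: (key _ r1); rewrite /kink e1 eqxx q.
by apply: (key _ r2); rewrite /kink e1 ends_neq q subKr.
Qed.

End Morphism.

Lemma strictly_trigonal_divisorially M : loopless M -> strictly_trigonal M ->
  divisorially_trigonal M.
Proof.
move=> ll [T [treeT [H [H' [phi [[isoH isoH' mm] [harm nondeg deg]]]]]]].
have [psi ipsi] : exists psi : mg_point H -> mg_point M, isometry psi.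
  by case: isoH => psi hpsi; exists psi.
have [psi' [ipsi' _ _]] := isometry_inv ipsi.
apply: (trigonal_isometry ipsi').
by apply: (pullback_trigonal mm harm nondeg deg (treeT _ isoH')); exact: ll isoH.
Qed.

Lemma few_vertices_trigonal M : loopless M -> (#|vert M| = 2 \/ #|vert M| = 3)%N ->
  divisorially_trigonal M.
Proof.
move=> ll hV; have [v0 _] := card_gt0P (vert_gt0 M).
pose D (x : mg_point M) : int := if x is Vtx v then 1 + (if v == v0 then 3 - #|vert M|%:Z else 0) else 0.
have D1 v : 1 <= D (Vtx v) by rewrite /D; case: ifP => _; lia.
have effD : effective D.
  split; last by case=> // v; exact: le_trans (D1 v).
  by have [] := @vtx_support _ _ D.
apply: (trigonal_of_points (D := D)); first by case: effD.
  rewrite (vtx_support _).2 // /D big_split /= -big_mkcond big_pred1_eq sumr_const.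
  by case: hV => ->.
move=> p; suff [E [effE Ep eqE]] : exists E, [/\ effective E, 1 <= E p & lin_equiv D E].
  exact: (equiv_effective_pt effE Ep).
case: p => [v|e t h]; first by exists D; split=> //; exact: lin_equiv_refl.
apply: slide_point => //; apply: ll.
by exists id; exact: isometry_id.
Qed.

End Pullback.

(** * Potentials on a three-edge-connected graph *)

Section Discrete.
Context {R : realType}.
(** [D x] stands for a divisor of the given class whose support contains [x], and [p x] for a
    function with divisor [D x - D0] and integer slope [sl x e] on [e]. The common reference [D0]
    drops out of the differences [pot], which are additive by [potD]. *)
Variables (H : model R) (D : vert H -> vert H -> int) (D0 : vert H -> int)
  (p : vert H -> vert H -> R) (sl : vert H -> edge H -> int).

Definition boundary (X : {pred vert H}) : pred (edge H) :=
  fun e => (src e \in X) != (tgt e \in X).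

Definition mass x (X : {pred vert H}) : int := \sum_(v in X) D x v.

Hypothesis p_slope : forall x e,
  p x (tgt e) - p x (src e) = (sl x e)%:~R * len e.
Hypothesis p_div : forall x v, D x v - D0 v =
  \sum_(e : edge H | src e == v) sl x e - \sum_(e : edge H | tgt e == v) sl x e.
Hypothesis D_ge0 : forall x v, 0 <= D x v.
Hypothesis D_sum : forall x, \sum_v D x v = 3.
Hypothesis D_self : forall x, 1 <= D x x.
(* The last two cases are those of a set [X], or of its complement, that lies
   inside the open edges of the original graph. *)
Hypothesis D_cut : forall (X : {pred vert H}) a b, a \in X -> b \notin X ->
  [\/ (3 <= #|boundary X|)%N, forall x, mass x X < #|boundary X|%:Z |
      forall x, mass x (predC X) < #|boundary X|%:Z].

Definition pot x y v := p x v - p y v.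
Definition slope x y e := sl x e - sl y e.

Lemma slopeE x y e : pot x y (tgt e) - pot x y (src e) = (slope x y e)%:~R * len e.
Proof. by rewrite /pot /slope rmorphB /= mulrBl -!p_slope; ring. Qed.

Lemma slope_gt0 x y e : (0 < slope x y e) = (pot x y (src e) < pot x y (tgt e)).
Proof. by rewrite -[RHS]subr_gt0 slopeE pmulr_lgt0 ?len_gt0 // ltr0z. Qed.

Lemma slope_lt0 x y e : (slope x y e < 0) = (pot x y (tgt e) < pot x y (src e)).
Proof. by rewrite -[RHS]subr_lt0 slopeE pmulr_llt0 ?len_gt0 // ltrz0. Qed.

Lemma slope_eq0 x y e : pot x y (src e) = pot x y (tgt e) -> slope x y e = 0.
Proof.
move=> h; have := slope_gt0 x y e; have := slope_lt0 x y e.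
by rewrite h ltxx; lia.
Qed.

Lemma pot_div x y v : D x v - D y v =
  \sum_(e : edge H | src e == v) slope x y e - \sum_(e : edge H | tgt e == v) slope x y e.
Proof.
rewrite /slope !sumrB; have := p_div x v; have := p_div y v => hy hx.
have -> : D x v - D y v = (D x v - D0 v) - (D y v - D0 v) by ring.
by rewrite hx hy; ring.
Qed.

Lemma potC x y v : pot x y v = - pot y x v.
Proof. by rewrite /pot opprB. Qed.

Lemma potD x y z v : pot x y v = pot x z v + pot z y v.
Proof. by rewrite /pot addrA subrK. Qed.

Definition out_of (k : edge H -> int) (X : {pred vert H}) e :=
  if src e \in X then k e else - k e.

Lemma boundary_flow x y (X : {pred vert H}) :
  mass x X - mass y X = \sum_(e | boundary X e) out_of (slope x y) X e.
Proof.
rewrite /mass -sumrB; under eq_bigr do rewrite pot_div.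
rewrite sum_flow [RHS](bigID (fun e => src e \in X)) /= -sumrN; congr (_ + _).
  apply: eq_big => e; first by rewrite /boundary; case: (src e \in X); case: (tgt e \in X).
  by rewrite /out_of => /andP[->].
apply: eq_big => e; first by rewrite /boundary; case: (src e \in X); case: (tgt e \in X).
by rewrite /out_of => /andP[_ /negbTE->].
Qed.

Lemma boundary_neq0 (X : {pred vert H}) a b : a \in X -> b \notin X ->
  exists e, boundary X e.
Proof.
move=> aX bX; have /connectP[q pth eb] := graph_conn a b.
elim: q a aX pth eb => [|c q IH] a aX /=; first by move=> _ e; rewrite e aX in bX.
move=> /andP[/existsP[e /andP[_ h]] pth eb].
have [cX|cX] := boolP (c \in X); first exact: IH pth eb.
exists e; rewrite /boundary; case/orP: h => /andP[/eqP-> /eqP->];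
by rewrite aX (negbTE cX).
Qed.

Definition rising x y (X : {pred vert H}) :=
  forall e, boundary X e -> 1 <= out_of (slope x y) X e.

Lemma rising_flow x y X : rising x y X ->
  #|boundary X|%:Z <= mass x X - mass y X.
Proof.
move=> hr; rewrite boundary_flow -sum1_card (big_morph Posz PoszD (erefl _)).
by apply: ler_sum => e; apply: hr.
Qed.

(* At most three chips leave [X], each boundary edge carries at least one, and
   the boundary has at least three edges. *)
Lemma rising_cut x y X a b : a \in X -> b \notin X -> rising x y X ->
  [/\ #|boundary X| = 3, forall e, boundary X e -> out_of (slope x y) X e = 1,
      forall v, v \notin X -> D x v = 0 & forall v, v \in X -> D y v = 0].
Proof.
move=> aX bX hr; have flow := rising_flow hr.
have tot z : mass z X + mass z (predC X) = 3.
  by rewrite -(D_sum z) [RHS](bigID (mem X)).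
have ge0 z (Y : {pred vert H}) : 0 <= mass z Y by apply: sumr_ge0.
have c3 : (3 <= #|boundary X|)%N.
  (* The flow is at most the mass of [D x] on [X] and at most that of [D y] on the complement, so in
     either exceptional case it would be less than the number of boundary edges. *)
  have [//|/(_ x) h|/(_ y) h] := D_cut aX bX; exfalso.
    by have := ge0 y X; lia.
  by have := ge0 x (predC X); have := tot x; have := tot y; lia.
have x3 : mass x X = 3.
  by have := ge0 y X; have := tot x; have := ge0 x (predC X); lia.
have y0 : mass y X = 0 by have := ge0 y X; lia.
have x0 : mass x (predC X) = 0 by have := tot x; lia.
have b3 : #|boundary X| = 3 by lia.
split=> //.
- have : \sum_(e | boundary X e) (out_of (slope x y) X e - 1) = 0.
    rewrite sumrB -boundary_flow x3 y0.
    have := @big_morph _ _ Posz 0 _ 0%N addn PoszD (erefl _) _ (index_enum (edge H)) (boundary X) (fun=> 1%N).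
    by rewrite sum1_card b3 => <-.
  move=> /eqP; rewrite psumr_eq0 => [/allP h e he|e he]; last by rewrite subr_ge0 hr.
  by have := h e (mem_index_enum e); rewrite he /= subr_eq0 => /eqP.
- move=> v vX; move: x0 => /eqP; rewrite psumr_eq0 // => /allP/(_ v (mem_index_enum v)).
  by rewrite inE /= vX => /eqP.
move=> v vX; move: y0 => /eqP; rewrite psumr_eq0 // => /allP/(_ v (mem_index_enum v)).
by rewrite /= vX => /eqP.
Qed.

Definition sublevel x y c : {pred vert H} := fun v => pot x y v <= c.

Lemma in_sublevel x y c v : (v \in sublevel x y c) = (pot x y v <= c).
Proof. by []. Qed.

Lemma sublevel_rising x y c : rising x y (sublevel x y c).
Proof.
move=> e; rewrite /boundary /out_of !in_sublevel.
case: (leP (pot x y (src e)) c) => h1; case: (leP (pot x y (tgt e)) c) => h2 // _.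
  by have := slope_gt0 x y e; rewrite (le_lt_trans h1 h2); lia.
by have := slope_lt0 x y e; rewrite (le_lt_trans h2 h1); lia.
Qed.

Lemma level_cut x y a b : pot x y a < pot x y b ->
  let X := sublevel x y (pot x y a) in
  [/\ #|boundary X| = 3, forall e, boundary X e -> out_of (slope x y) X e = 1,
      forall v, v \notin X -> D x v = 0 & forall v, v \in X -> D y v = 0].
Proof.
move=> ab X; apply: (@rising_cut x y X a b); last exact: sublevel_rising.
  by rewrite in_sublevel.
by rewrite in_sublevel -ltNge.
Qed.

(** If [w] were lower, the sublevel cut at [w] would leave [v] outside, where [D x] vanishes. *)
Lemma pot_min x y v w : 1 <= D x v -> pot x y v <= pot x y w.
Proof.
move=> hv; case: leP => // h; have [_ _ /(_ v) hx _] := level_cut h.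
by rewrite hx // in_sublevel -ltNge in hv.
Qed.

Lemma pot_max x y v w : 1 <= D y v -> pot x y w <= pot x y v.
Proof. by move=> hv; rewrite potC [X in _ <= X]potC lerN2; apply: pot_min. Qed.

Lemma slope_abs x y e : -1 <= slope x y e <= 1.
Proof.
have [h|h|h] := ltgtP (pot x y (src e)) (pot x y (tgt e)).
- have [_ /(_ e) hb _ _] := level_cut h; move: hb.
  rewrite /boundary /out_of !in_sublevel lexx leNgt h /= => /(_ isT) ->.
  by [].
- have [_ /(_ e) hb _ _] := level_cut h; move: hb.
  rewrite /boundary /out_of !in_sublevel lexx leNgt h /= => /(_ isT) hs.
  by rewrite -[slope x y e]opprK hs.
by rewrite slope_eq0.
Qed.

Lemma pot_const x y : (forall v w, pot x y v = pot x y w) -> D x = D y.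
Proof.
move=> h; apply/funext => v; apply/eqP; rewrite -subr_eq0 pot_div.
rewrite !big1 ?subrr // => e _; exact: slope_eq0.
Qed.

(** A common point of the supports is both a minimum and a maximum of [pot x y]. *)
Lemma D_class x y v : 1 <= D x v -> 1 <= D y v -> D x = D y.
Proof.
move=> hx hy; apply: pot_const => a b; apply/eqP.
have h w : pot x y w = pot x y v.
  by apply/eqP; rewrite eq_le pot_max //= pot_min.
by rewrite !h.
Qed.

Lemma pot_class x y v w : 1 <= D x v -> 1 <= D x w -> pot x y v = pot x y w.
Proof. by move=> h1 h2; apply/eqP; rewrite eq_le !pot_min. Qed.

Lemma pot_class' x y v w : 1 <= D y v -> 1 <= D y w -> pot x y v = pot x y w.
Proof. by move=> h1 h2; apply/eqP; rewrite eq_le !pot_max. Qed.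

Lemma pot_lt x y v w : D x <> D y -> 1 <= D x v -> 1 <= D y w -> pot x y v < pot x y w.
Proof.
move=> ne hv hw; have := pot_min y w hv; rewrite le_eqVlt => /predU1P[e|//]; case: ne.
apply: pot_const => a b.
have h u : pot x y u = pot x y v.
  by apply/eqP; rewrite eq_le (pot_min y u hv) e (pot_max x u hw).
by rewrite !h.
Qed.

Definition joins (a b : vert H) (e : edge H) :=
  ((src e == a) && (tgt e == b)) || ((src e == b) && (tgt e == a)).

Lemma joinsC a b e : joins a b e = joins b a e. Proof. by rewrite /joins orbC. Qed.

Lemma joins_slope x y a b e : joins a b e ->
  exists2 s : int, -1 <= s <= 1 & pot x y b - pot x y a = s%:~R * len e.
Proof.
case/orP => /andP[/eqP<- /eqP<-].
  by exists (slope x y e); [exact: slope_abs | exact: slopeE].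
exists (- slope x y e); first by have := slope_abs x y e; lia.
by rewrite -opprB slopeE rmorphN mulNr.
Qed.

(** A converse of [pot_max]: at a global maximum all outgoing slopes are at most 0, and the one
    towards [a] is negative, so [D x b - D y b] is at most -1. *)
Lemma below_max x y a b e : joins a b e -> pot x y a < pot x y b ->
  (forall v, pot x y v <= pot x y b) -> 1 <= D y b.
Proof.
move=> je ab hb.
have s_src e' : src e' = b -> slope x y e' <= 0.
  by move=> eb; have := slope_gt0 x y e'; have := hb (tgt e'); rewrite eb leNgt => /negbTE ->; lia.
have s_tgt e' : tgt e' = b -> 0 <= slope x y e'.
  by move=> eb; have := slope_lt0 x y e'; have := hb (src e'); rewrite eb leNgt => /negbTE ->; lia.
have := pot_div x y b; set A := \sum_(e' | src e' == b) _; set B := \sum_(e' | tgt e' == b) _.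
have le1 : A <= 0 by apply: sumr_le0 => e' /eqP/s_src.
have ge1 : 0 <= B by apply: sumr_ge0 => e' /eqP/s_tgt.
have Dx := D_ge0 x b; suff : A <= -1 \/ 1 <= B by lia.
case/orP: je => /andP[/eqP ea /eqP eb].
  right; rewrite /B (bigD1 e) /= ?eb // -[1]addr0; apply: lerD.
    by have := slope_gt0 x y e; rewrite ea eb ab; lia.
  by apply: sumr_ge0 => e' /andP[/eqP/s_tgt].
left; rewrite /A (bigD1 e) /= ?ea // -[-1]addr0; apply: lerD.
  by have := slope_lt0 x y e; rewrite ea eb ab; lia.
by apply: sumr_le0 => e' /andP[/eqP/s_src].
Qed.

Lemma above_min x y a b e : joins a b e -> pot x y a < pot x y b ->
  (forall v, pot x y a <= pot x y v) -> 1 <= D x a.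
Proof.
move=> je ab ha; apply: (@below_max y x b a e); first by rewrite joinsC.
  by rewrite potC [X in _ < X]potC ltrN2.
by move=> v; rewrite potC [X in _ <= X]potC lerN2.
Qed.

(* On the set where [pot z y] and [pot x y] are both below their values at [b],
   [pot x y] is harmonic and increases across every boundary edge; hence the set
   is empty. *)
Lemma flat_branch x y z a b : D x <> D y -> D z <> D y -> D z <> D x ->
  1 <= D x a -> 1 <= D y b -> pot z y a = pot z y b -> pot x y z = pot x y b.
Proof.
move=> xy zy zx ha hb kab; apply/eqP; rewrite eq_le pot_max //= leNgt; apply/negP => fz.
pose Y : {pred vert H} := fun v => (pot z y v < pot z y b) && (pot x y v < pot x y b).
have inY v : (v \in Y) = (pot z y v < pot z y b) && (pot x y v < pot x y b) by [].
have zY : z \in Y by rewrite inY fz pot_lt.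
have bY : b \notin Y by rewrite inY ltxx.
have Dy v : v \in Y -> D y v = 0.
  rewrite inY => /andP[h _]; apply/eqP; apply: contraTT h => ne.
  by rewrite -leNgt pot_max //; have := D_ge0 y v; lia.
(* On the support of [D x] both [pot x y] and [pot x z] are constant, hence so is [pot z y], with
   the value [pot z y b]. *)
have Dx v : v \in Y -> D x v = 0.
  rewrite inY => /andP[h _]; apply/eqP; apply: contraTT h => ne.
  have hv : 1 <= D x v by have := D_ge0 x v; lia.
  have := potD x y z v; have := potD x y z a.
  rewrite (pot_class y ha hv) (pot_class z ha hv) -leNgt; lra.
(* If [Y] is left because [pot z y] reaches its maximum, then [w] is in the support of [D y], where
   [pot x y] is maximal too. *)
have step u w e : joins u w e -> u \in Y -> w \notin Y -> pot x y u < pot x y w.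
  move=> je; rewrite !inY => /andP[h1 h2] /nandP[]; rewrite -leNgt => h3; last exact: lt_le_trans h3.
  apply: lt_le_trans h2 _; suff hw : 1 <= D y w by exact: pot_max.
  apply: (below_max (x := z) je); first exact: lt_le_trans h3.
  by move=> v; apply: le_trans h3; exact: pot_max.
have hr : rising x y Y.
  move=> e; rewrite /boundary /out_of.
  case: (boolP (src e \in Y)) => h1; case: (boolP (tgt e \in Y)) => h2 // _.
    by have := slope_gt0 x y e; rewrite (step _ _ e) // /joins ?eqxx //; lia.
  by have := slope_lt0 x y e; rewrite (step _ _ e) // /joins ?eqxx ?orbT //; lia.
have := rising_flow hr; rewrite /mass !big1 // subrr.
have [e he] := boundary_neq0 zY bY.
have : (0 < #|boundary Y|)%N by apply/card_gt0P; exists e.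
lia.
Qed.

(** Along [e] the slope 1 of [pot x y] is the sum of the slopes of [pot x z] and [pot z y], which
    lie in {-1, 0, 1}. Hence one of them is 0, and [flat_branch] applies on that side. *)
Lemma two_valued x y a b e z : D x <> D y -> 1 <= D x a -> 1 <= D y b ->
  joins a b e -> pot x y z = pot x y a \/ pot x y z = pot x y b.
Proof.
move=> xy ha hb je.
have [zx|/eqP zx] := eqVneq (D z) (D x).
  by left; apply: pot_class => //; rewrite -zx.
have [zy|/eqP zy] := eqVneq (D z) (D y).
  by right; apply: pot_class' => //; rewrite -zy.
have [s hs es] := joins_slope x z je; have [t ht et] := joins_slope z y je.
have l0 := len_gt0 e; have lt := pot_lt xy ha hb.
have [u hu eu] := joins_slope x y je.
have su : s + t = u.
  apply: (@intr_inj R); apply: (mulIf (lt0r_neq0 l0)).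
  rewrite rmorphD /= mulrDl -es -et -eu (potD x y z a) (potD x y z b); ring.
have u0 : 0 < u by rewrite -(ltr0z R) -(pmulr_lgt0 _ l0) -eu subr_gt0.
have [t0|t0] := eqVneq t 0.
  right; apply: (flat_branch (a := a) xy zy zx) => //.
  by move: et; rewrite t0 mul0r => /eqP; rewrite subr_eq0 => /eqP.
have s0 : s = 0 by lia.
left; rewrite potC [RHS]potC; congr (- _).
apply: (@flat_branch y x z b a) => //; first exact: nesym.
by rewrite potC [RHS]potC; congr (- _); move: es; rewrite s0 mul0r => /eqP; rewrite subr_eq0 => /eqP.
Qed.

Definition cjoins x y (e : edge H) :=
  ((1 <= D x (src e)) && (1 <= D y (tgt e))) ||
  ((1 <= D x (tgt e)) && (1 <= D y (src e))).

Lemma cjoinsC x y e : cjoins x y e = cjoins y x e.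
Proof. by rewrite /cjoins orbC andbC [X in _ || X]andbC. Qed.

Lemma joins_ends e : joins (src e) (tgt e) e. Proof. by rewrite /joins !eqxx. Qed.

Lemma joins_ends' e : joins (tgt e) (src e) e. Proof. by rewrite joinsC joins_ends. Qed.

Lemma cjoins_two_valued x y e z : D x <> D y -> cjoins x y e ->
  pot x y z = pot x y x \/ pot x y z = pot x y y.
Proof.
move=> ne /orP[] /andP[hx hy].
  have := two_valued z ne hx hy (joins_ends e).
  by rewrite (pot_class y hx (D_self x)) (pot_class' x hy (D_self y)).
have := two_valued z ne hx hy (joins_ends' e).
by rewrite (pot_class y hx (D_self x)) (pot_class' x hy (D_self y)).
Qed.

(** * The edges between two supports *)

Section Crossing.
Variables (x y : vert H) (e0 : edge H).
Hypotheses (xy : D x <> D y) (e0xy : cjoins x y e0).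

Let lt : pot x y x < pot x y y. Proof. exact: pot_lt. Qed.

(** There are only two values, so an edge on which [pot x y] changes joins a minimum to a maximum,
    and both must carry chips. *)
Lemma crossing a b e : joins a b e -> pot x y a <> pot x y y -> pot x y b = pot x y y ->
  1 <= D x a /\ 1 <= D y b.
Proof.
move=> je ha hb; have {}ha : pot x y a = pot x y x.
  by have [] := cjoins_two_valued a xy e0xy.
split; first by apply: (above_min (y := y) je) => [|v]; rewrite ha ?hb // pot_min.
by apply: (below_max (x := x) je) => [|v]; rewrite ?ha hb // pot_max.
Qed.

Let X := sublevel x y (pot x y x).

Let inX v : (v \in X) = (pot x y v == pot x y x).
Proof. by rewrite in_sublevel eq_le (pot_min y v (D_self x)) andbT. Qed.

Let notinX v : (v \notin X) = (pot x y v == pot x y y).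
Proof.
rewrite inX; have [->|->] := cjoins_two_valued v xy e0xy.
  by rewrite eqxx lt_eqF.
by rewrite eqxx gt_eqF.
Qed.

Lemma boundary_cjoins e : boundary X e = cjoins x y e.
Proof.
apply/idP/idP => [|/orP[] /andP[hx hy]].
- rewrite /boundary; case: (boolP (src e \in X)) => h1; case: (boolP (tgt e \in X)) => h2 // _.
    have [] := @crossing (src e) (tgt e) e (joins_ends e); rewrite /cjoins; last by move=> -> ->.
      by move: h1; rewrite inX => /eqP->; apply/eqP; rewrite lt_eqF.
    by move: h2; rewrite notinX => /eqP.
  have [] := @crossing (tgt e) (src e) e (joins_ends' e); rewrite /cjoins; last by move=> -> ->; rewrite orbT.
    by move: h2; rewrite inX => /eqP->; apply/eqP; rewrite lt_eqF.
  by move: h1; rewrite notinX => /eqP.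
- have h1 : src e \in X by rewrite inX (pot_class y hx (D_self x)).
  have h2 : tgt e \notin X by rewrite notinX (pot_class' x hy (D_self y)).
  by rewrite /boundary h1 (negbTE h2).
have h1 : tgt e \in X by rewrite inX (pot_class y hx (D_self x)).
have h2 : src e \notin X by rewrite notinX (pot_class' x hy (D_self y)).
by rewrite /boundary h1 (negbTE h2).
Qed.

Lemma cjoins_card : #|cjoins x y| = 3.
Proof.
by have [<- _ _ _] := level_cut lt; apply: eq_card => e; exact: (esym (boundary_cjoins e)).
Qed.

Lemma cjoins_slope e : cjoins x y e -> slope x y e = if src e \in X then 1 else -1.
Proof.
rewrite -boundary_cjoins => he; have [_ /(_ e he) + _ _] := level_cut lt.
by rewrite /out_of -/X; case: ifP => _ // h; rewrite -[slope x y e]opprK h.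
Qed.

Lemma cjoins_len e : cjoins x y e -> len e = pot x y y - pot x y x.
Proof.
move=> he; have := slopeE x y e; rewrite cjoins_slope //.
move: he; rewrite -boundary_cjoins /boundary.
case: (boolP (src e \in X)) => h1; case: (boolP (tgt e \in X)) => h2 // _.
  by move: h1; rewrite inX => /eqP->; move: h2; rewrite notinX => /eqP->; rewrite mul1r => ->.
move: h1; rewrite notinX => /eqP->; move: h2; rewrite inX => /eqP->.
by rewrite mulN1r => h; rewrite -[len e]opprK -h opprB.
Qed.

Lemma ncjoins_slope e : ~~ cjoins x y e -> slope x y e = 0.
Proof.
rewrite -boundary_cjoins /boundary negbK => /eqP h; apply: slope_eq0.
have [hs|hs] := boolP (src e \in X).
  by move: (hs) (hs); rewrite {2}h !inX => /eqP-> /eqP->.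
by move: (hs) (hs); rewrite {2}h !notinX => /eqP-> /eqP->.
Qed.

(** [pot x y] leaves [a] with slope 1 on the edges that join the two supports and is flat on the
    others, while [D y a = 0]. The count does not depend on [y]: this is the source of
    harmonicity. *)
Lemma cjoins_local a : (forall e : edge H, src e != tgt e) -> 1 <= D x a ->
  D x a = #|[pred e | incident e a && cjoins x y e]|%:Z.
Proof.
move=> noloop ha; have ya : D y a = 0.
  apply/eqP; apply: contraTT isT => ne; exfalso; apply: xy; apply: (D_class (v := a)) => //.
  by have := D_ge0 y a; lia.
have aX : a \in X by rewrite inX (pot_class y ha (D_self x)).
have := pot_div x y a; rewrite ya subr0 => ->.
rewrite -sum1_card (big_morph Posz PoszD (erefl _)) -sumrN.
rewrite [RHS](eq_bigl (fun e => incident e a && cjoins x y e)) // big_mkcondr /=.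
rewrite [RHS](bigID (fun e => src e == a)) /=; congr (_ + _).
  apply: eq_big => e; first by rewrite /incident; case: (src e == a); rewrite ?andbF.
  move=> /eqP ea; case: ifP => [h|/negbT/ncjoins_slope//].
  by rewrite cjoins_slope // ea aX.
apply: eq_big => e.
  rewrite /incident; case: (eqVneq (src e) a) => [ea|] /=; last by rewrite andbT.
  by rewrite eq_sym -ea (negbTE (noloop e)).
move=> /eqP ea; case: ifP => [h|/negbT/ncjoins_slope->]; last by rewrite oppr0.
rewrite cjoins_slope //; move: (h); rewrite -boundary_cjoins /boundary ea aX.
by case: (src e \in X).
Qed.

End Crossing.

(* The vertices of the target tree are the distinct divisors [D x], each
   represented by the vertex [nu x]; arcs point towards the class of [root]. *)
Definition nu x := odflt x [pick z | 1 <= D x z].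

Lemma D_nu x : D (nu x) = D x.
Proof.
rewrite /nu; case: pickP => [z hz|/(_ x)] /=; last by rewrite D_self.
by apply: (D_class (v := z)).
Qed.

Lemma nu_eq x y : D x = D y -> nu x = nu y.
Proof.
move=> h; rewrite /nu h; case: pickP => [//|/(_ y)] /=; by rewrite D_self.
Qed.

Lemma nu_idem x : nu (nu x) == nu x.
Proof. by apply/eqP/nu_eq/D_nu. Qed.

Lemma nu_inj x y : nu x = nu y -> D x = D y.
Proof. by move=> h; rewrite -D_nu h D_nu. Qed.

Lemma nu_class x v : 1 <= D x v -> nu v = nu x.
Proof. by move=> h; apply: nu_eq; apply: (D_class (v := v)). Qed.

Lemma self_nu x : 1 <= D (nu x) x. Proof. by rewrite D_nu. Qed.

(** * The target tree and the morphism onto it *)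

Variable root : vert H.

Definition tree_vert := {v : vert H | nu v == v}.

Definition nuV (x : vert H) : tree_vert := exist _ (nu x) (nu_idem x).

(** The last clause puts the root on the side of [q.2]. The potential having two values, exactly one
    orientation of each adjacent pair qualifies. *)
Definition tree_rel (q : vert H * vert H) :=
  [&& nu q.1 == q.1, nu q.2 == q.2, q.1 != q.2, [exists e, cjoins q.1 q.2 e] &
      pot q.1 q.2 (nu root) != pot q.1 q.2 q.1].

Definition tree_edge := {q : vert H * vert H | tree_rel q}.

Definition tree_arc a b (h : tree_rel (a, b)) : tree_edge :=
  exist (fun q => tree_rel q) (a, b) h.

Definition tree_src (q : tree_edge) := nuV (val q).1.
Definition tree_tgt (q : tree_edge) := nuV (val q).2.

Lemma tree_relP a b : tree_rel (a, b) -> exists e,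
  [/\ nu a = a, nu b = b, D a <> D b, cjoins a b e & pot a b (nu root) = pot a b b].
Proof.
move=> /and5P[/= /eqP na /eqP nb ab /existsP[e he] /eqP hr].
have ne : D a <> D b by move=> h; rewrite -na -nb (nu_eq h) eqxx in ab.
by exists e; split=> //; have [] := cjoins_two_valued (nu root) ne he.
Qed.

Lemma tree_rel_asym a b : tree_rel (a, b) -> ~~ tree_rel (b, a).
Proof.
move=> /tree_relP[e [_ _ _ _ h]]; apply/negP => /and5P[_ _ _ _ /=].
by rewrite potC h -potC eqxx.
Qed.

Lemma tree_rel_orient e : nu (src e) != nu (tgt e) ->
  tree_rel (nu (src e), nu (tgt e)) \/ tree_rel (nu (tgt e), nu (src e)).
Proof.
move=> ne; have je : cjoins (nu (src e)) (nu (tgt e)) e by rewrite /cjoins !self_nu.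
have nD : D (nu (src e)) <> D (nu (tgt e)).
  by move=> h; move: ne; rewrite (nu_eq (etrans (esym (D_nu _)) (etrans h (D_nu _)))) eqxx.
have ex : [exists e', cjoins (nu (src e)) (nu (tgt e)) e'] by apply/existsP; exists e.
have ex' : [exists e', cjoins (nu (tgt e)) (nu (src e)) e'].
  by apply/existsP; exists e; rewrite cjoinsC.
have l := pot_lt nD (D_self _) (D_self _).
have [h|h] := cjoins_two_valued (nu root) nD je.
  right; rewrite /tree_rel /= !nu_idem eq_sym ne ex' /= potC [X in _ != X]potC eqr_opp h.
  by rewrite lt_eqF.
by left; rewrite /tree_rel /= !nu_idem ne ex /= h gt_eqF.
Qed.

Lemma tree_conn x y : connect (adj tree_src tree_tgt finset.set0) x y.
Proof.
have step (e : edge H) : connect (adj tree_src tree_tgt finset.set0) (nuV (src e)) (nuV (tgt e)).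
  have [h|ne] := eqVneq (nu (src e)) (nu (tgt e)).
    by have -> : nuV (src e) = nuV (tgt e) by exact: val_inj.
  have nn a : nuV (nu a) = nuV a by apply: val_inj; apply/eqP; exact: nu_idem.
  have [h|h] := tree_rel_orient ne.
    have := @adj_edge _ _ tree_src tree_tgt finset.set0 (tree_arc h).
    by rewrite /tree_src /tree_tgt /= !nn; apply; rewrite finset.inE.
  rewrite connect_adj_sym.
  have := @adj_edge _ _ tree_src tree_tgt finset.set0 (tree_arc h).
  by rewrite /tree_src /tree_tgt /= !nn; apply; rewrite finset.inE.
have key v w : connect (adj tree_src tree_tgt finset.set0) (nuV v) (nuV w).
  have /connectP[q pth ->] := graph_conn v w.
  elim: q v pth => [|u q IH] v //= /andP[/existsP[e /andP[_ h]] /IH].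
  apply: connect_trans; case/orP: h => /andP[/eqP<- /eqP<-] //.
  by rewrite connect_adj_sym.
have vK (u : tree_vert) : u = nuV (val u) by apply: val_inj => /=; rewrite (eqP (valP u)).
by rewrite (vK x) (vK y).
Qed.

Lemma tree_vert_gt0 : (0 < #|{: tree_vert}|)%N.
Proof. by apply/card_gt0P; exists (nuV root). Qed.

Definition tree_graph : graph := Graph tree_vert_gt0 tree_conn.

(* The common far side of two arcs leaving [a] contains the root but has no
   boundary edge. *)
Lemma tree_parent_inj a b b' : tree_rel (a, b) -> tree_rel (a, b') -> b = b'.
Proof.
move=> h h'; apply/eqP; apply: contraT => bb'.
have [e0 [na nb ab je hr]] := tree_relP h; have [e0' [_ nb' ab' je' hr']] := tree_relP h'.
pose X : {pred vert H} := fun v => (pot a b v == pot a b b) && (pot a b' v == pot a b' b').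
have inX v : (v \in X) = (pot a b v == pot a b b) && (pot a b' v == pot a b' b') by [].
have rX : nu root \in X by rewrite inX hr hr' !eqxx.
have aX : a \notin X by rewrite inX lt_eqF // pot_lt.
have [e he] := boundary_neq0 rX aX.
have {he} [u [w [juw uX wX]]] : exists u w, [/\ joins w u e, u \in X & w \notin X].
  move: he; rewrite /boundary; case: (boolP (src e \in X)) => h1; case: (boolP (tgt e \in X)) => h2 // _.
    by exists (src e), (tgt e); rewrite joins_ends'.
  by exists (tgt e), (src e); rewrite joins_ends.
move: uX; rewrite inX => /andP[/eqP u1 /eqP u2].
suff : D b = D b' by move=> hD; move: bb'; rewrite -nb -nb' (nu_eq hD) eqxx.
(* The edge from [w] to [u] crosses one of the two levels, so [w] is in the support of [D a]. It
   therefore crosses the other level as well, and [u] lies in the supports of both [D b] and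
   [D b']. *)
move: wX; rewrite inX => /nandP[] /eqP w1.
  have [wa ub] := crossing ab je juw w1 u1.
  have w2 : pot a b' w <> pot a b' b'.
    by apply/eqP; rewrite (pot_class b' wa (D_self a)) lt_eqF // pot_lt.
  have [_ ub'] := crossing ab' je' juw w2 u2.
  exact: D_class ub ub'.
have [wa ub'] := crossing ab' je' juw w1 u2.
have w2 : pot a b w <> pot a b b.
  by apply/eqP; rewrite (pot_class b wa (D_self a)) lt_eqF // pot_lt.
have [_ ub] := crossing ab je juw w2 u1.
exact: D_class ub ub'.
Qed.

(** An arc is determined by its source, and the class of the root is the source of none; so there
    are fewer arcs than classes. *)
Lemma tree_graph_tree : is_tree tree_graph.
Proof.
have inj : injective tree_src.
  move=> [[a b] h] [[a' b'] h'] /(congr1 val) /= e; apply: val_inj => /=.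
  have [? [na _ _ _ _]] := tree_relP h; have [? [na' _ _ _ _]] := tree_relP h'.
  move: e h'; rewrite na na' => <- h'; congr (_, _); exact: tree_parent_inj h h'.
have sub : codom tree_src \subset predC1 (nuV root).
  apply/fintype.subsetP => _ /codomP[[[a b] h] ->]; rewrite !inE; apply/eqP => /(congr1 val) /=.
  have [? [na _ _ _ _]] := tree_relP h; rewrite na => ar.
  by move: h => /and5P[_ _ _ _ /=]; rewrite -ar eqxx.
have := subset_leq_card sub; rewrite card_codom // cardC1 => h.
apply/eqP; rewrite /genus subn_eq0; apply: leq_ltn_trans h _.
by rewrite ltn_predL; exact: tree_vert_gt0.
Qed.

Definition tree_len (q : edge tree_graph) : R :=
  pot (val q).1 (val q).2 (val q).2 - pot (val q).1 (val q).2 (val q).1.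

Lemma tree_len_gt0 q : 0 < tree_len q.
Proof.
case: q => [[a b] h]; have [_ [_ _ ab _ _]] := tree_relP h.
by rewrite subr_gt0 pot_lt.
Qed.

Definition tree_model : model R := Model tree_len_gt0.

(** By [tree_rel_asym] at most one of the two tests succeeds, and by [tree_rel_orient] both fail
    only if the ends of [e] are in the same class. *)
Definition tree_mapE (e : edge H) : vert tree_model + edge tree_model :=
  if insub (nu (src e), nu (tgt e)) is Some q then inr q
  else if insub (nu (tgt e), nu (src e)) is Some q then inr q
  else inl (nuV (src e)).

Lemma tree_mapE_inr e q : tree_mapE e = inr q <-> cjoins (val q).1 (val q).2 e.
Proof.
rewrite /tree_mapE; split.
  case: insubP => [q1 _ v1|_]; first by case=> <-; rewrite v1 /cjoins !self_nu.
  case: insubP => [q1 _ v1|_] //; case=> <-; by rewrite v1 /cjoins !self_nu orbT.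
case: q => [[a b] h]; have [_ [na nb _ _ _]] := tree_relP h.
move=> /orP[] /andP[/= /nu_class h1 /nu_class h2]; rewrite h1 h2 na nb.
  by rewrite (insubT tree_rel h).
by rewrite (insubN _ (tree_rel_asym h)) (insubT tree_rel h).
Qed.

Lemma tree_mapE_inl e w : tree_mapE e = inl w -> nuV (src e) = w /\ nuV (tgt e) = w.
Proof.
have [h|ne] := eqVneq (nu (src e)) (nu (tgt e)).
  have hV : nuV (src e) = nuV (tgt e) by exact: val_inj.
  rewrite /tree_mapE; case: insubP => // _; case: insubP => // _ [<-].
  by rewrite -hV.
have [h|h] := tree_rel_orient ne; rewrite /tree_mapE; first by rewrite (insubT tree_rel h).
by case: insubP => // _; rewrite (insubT tree_rel h).
Qed.

Lemma tree_mapE_edge e q : tree_mapE e = inr q ->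
  same_ends (Defs.ends q) (nuV (src e), nuV (tgt e)).
Proof.
move=> /tree_mapE_inr; case: q => [[a b] h]; have [_ [na nb _ _ _]] := tree_relP h.
rewrite /Defs.ends /= /tree_src /tree_tgt /=.
by move=> /orP[] /andP[/= /nu_class h1 /nu_class h2]; [left|right]; congr (_, _);
  apply: val_inj; rewrite /= ?h1 ?h2.
Qed.

(** All edges over an arc have the length of that arc by [cjoins_len], so the stretching factor is
    1. *)
Definition tree_index e : nat := if tree_mapE e is inr _ then 1 else 0.

Lemma tree_index_eq0 e : tree_index e = 0%N <-> exists w, tree_mapE e = inl w.
Proof.
rewrite /tree_index; case: (tree_mapE e) => [w|q]; split=> //; first by exists w.
by case.
Qed.

Definition tree_map : indexed_morphism H tree_model :=
  @IndexedMorphism H tree_model nuV tree_mapE tree_index tree_mapE_inl tree_mapE_edge tree_index_eq0.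

Lemma tree_metric : metric_morphism tree_map.
Proof.
move=> e q /= he; rewrite /tree_index he; move: he => /tree_mapE_inr.
case: q => [[a b] h]; have [e0 [_ _ ab je _]] := tree_relP h => /= hj.
by rewrite /tree_len /= (cjoins_len ab je hj) divff // gt_eqF // subr_gt0 pot_lt.
Qed.

Hypothesis noloop : forall e : edge H, src e != tgt e.

Lemma tree_local x (q : edge tree_model) : incident q (nuV x : vert tree_model) -> (local_sum tree_map x q)%:Z = D x x.
Proof.
move=> hx; have -> : local_sum tree_map x q =
    #|[pred e | incident e x && cjoins (val q).1 (val q).2 e]|.
  rewrite -sum1_card; apply: eq_big => e.
    by rewrite !inE; congr (_ && _); apply/eqP/idP => /tree_mapE_inr.
  by move=> /andP[_ /eqP h]; rewrite /= /tree_index (h : tree_mapE e = inr q).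
move: hx; case: q => [[a b] h]; have [e0 [na nb ab je _]] := tree_relP h => /=.
rewrite /incident /= /tree_src /tree_tgt /= => /orP[] /eqP/(congr1 val)/= /nu_inj hD; rewrite -hD.
  by rewrite -(cjoins_local ab je) // hD D_self.
rewrite (eq_card (B := [pred e | incident e x && cjoins b a e])); last first.
  by move=> e; rewrite !inE cjoinsC.
rewrite -(@cjoins_local b a e0) ?hD ?D_self //; last by rewrite cjoinsC.
by rewrite -hD; exact: nesym.
Qed.

Lemma tree_harmonic : is_harmonic tree_map.
Proof.
move=> x q q' h h'; have := tree_local h; rewrite -(tree_local h').
by case.
Qed.

Hypothesis nontrivial : exists x y, D x <> D y.

(** Without an arc at [nuV x] the local degree would take its default value 0. As [H] is connected
    and there is a second class, some edge leaves the class of [x]. *)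
Lemma tree_incident x : exists q : edge tree_model,
  incident q (nuV x : vert tree_model).
Proof.
have [z hz] : exists z, D z <> D x.
  have [y [y' h]] := nontrivial; have [e|/eqP] := eqVneq (D y) (D x); last by exists y.
  by exists y'; rewrite -e; apply: nesym.
pose X : {pred vert H} := fun v => nu v == nu x.
have xX : x \in X by rewrite unfold_in /X eqxx.
have zX : z \notin X by rewrite unfold_in /X; apply/eqP => /nu_inj.
have [e he] := boundary_neq0 xX zX.
move: he; rewrite /boundary !unfold_in /X => he.
have ne : nu (src e) != nu (tgt e) by apply: contraNneq he => ->.
have hx : nu (src e) = nu x \/ nu (tgt e) = nu x.
  case: (eqVneq (nu (src e)) (nu x)) he => [|_ /=]; first by left.
  by case: (eqVneq (nu (tgt e)) (nu x)) => // ->; right.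
have [h|h] := tree_rel_orient ne; exists (tree_arc h);
  rewrite /incident /= /tree_src /tree_tgt /=; apply/orP.
  by case: hx => hx; [left|right]; apply/eqP; apply: val_inj; rewrite /= hx; apply/eqP/nu_idem.
by case: hx => hx; [right|left]; apply/eqP; apply: val_inj; rewrite /= hx; apply/eqP/nu_idem.
Qed.

Lemma tree_nondegenerate : is_nondegenerate tree_map.
Proof.
split=> [e w|x]; first by rewrite /is_loop (negbTE (noloop e)).
rewrite /local_degree; case: pickP => [q hq|h]; last first.
  by have [q hq] := tree_incident x; have := h q; rewrite hq.
by have := tree_local hq; have := D_self x; lia.
Qed.

Lemma tree_degree : degree tree_map = 3%N.
Proof.
rewrite /degree; case: pickP => [q _|h]; last first.
  by have [q hq] := tree_incident root; have := h q.
rewrite -[RHS](_ : #|cjoins (val q).1 (val q).2| = 3)%N.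
  rewrite -sum1_card; apply: eq_big => e.
    by rewrite unfold_in; apply/eqP/idP => /tree_mapE_inr.
  by move=> /eqP h; rewrite /= /tree_index (h : tree_mapE e = inr q).
by case: q => [[a b] h]; have [e0 [_ _ ab je _]] := tree_relP h; exact: cjoins_card ab je.
Qed.

Lemma discrete_tree : exists T : model R, is_tree T /\
  exists phi : indexed_morphism H T, [/\ metric_morphism phi, is_harmonic phi,
    is_nondegenerate phi & degree phi = 3%N].
Proof.
exists tree_model; split; first exact: tree_graph_tree.
exists tree_map; split; [exact: tree_metric|exact: tree_harmonic|exact: tree_nondegenerate|exact: tree_degree].
Qed.

End Discrete.

(** * From divisors to morphisms *)

Section Cuts.
Context {R : realType}.
Implicit Types (M : model R).

Definition carrier M (x : mg_point M) : option (edge M) :=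
  if x is Inn e _ _ then Some e else None.

(** [edge_connected] removes sets of exactly [k - 1] edges, so a smaller cut must be padded before
    it can be excluded. *)
Lemma card_extend (T : finType) (A : {set T}) n : (#|A| <= n <= #|T|)%N ->
  exists2 B : {set T}, A \subset B & #|B| = n.
Proof.
move=> /andP[]; move: {2}(n - #|A|)%N (erefl (n - #|A|)%N) => k.
elim: k A => [|k IH] A hk An nT; first by exists A => //; lia.
have [x xA] : exists x, x \notin A.
  apply/existsP; rewrite -negb_forall; apply/negP => /forallP h.
  have : #|A| = #|T| by apply: eq_card => x; rewrite h.
  lia.
have c1 : #|finset.setU (finset.set1 x) A| = #|A|.+1 by rewrite finset.cardsU1 xA.
have [|||B hB cB] := IH (finset.setU (finset.set1 x) A); rewrite ?c1; try lia.
by exists B => //; apply: fintype.subset_trans hB; exact: finset.subsetUr.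
Qed.

Lemma boundaryC M (X : {pred vert M}) : #|boundary (predC X)| = #|boundary X|.
Proof.
apply: eq_card => e.
rewrite -[LHS]/(~~ (src e \in X) != ~~ (tgt e \in X)) -[RHS]/((src e \in X) != (tgt e \in X)).
by case: (src e \in X); case: (tgt e \in X).
Qed.

Lemma edge_connected_cut M (X : {pred vert M}) x y : edge_connected M 3 ->
  (2 <= #|edge M|)%N -> x \in X -> y \notin X -> (3 <= #|boundary X|)%N.
Proof.
move=> conn E2 xX yX; rewrite ltnNge; apply/negP => b2.
have [|S bS cS] := @card_extend (edge M) (finset.finset (boundary X)) 2.
  by rewrite finset.cardsE b2.
have /connectP[q pth ey] := conn S cS x y.
elim: q x xX pth ey => [|z q IH] x xX /=; first by move=> _ e; rewrite e xX in yX.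
move=> /andP[/existsP[e /andP[eS h]] pth ey].
have eb : ~~ boundary X e.
  apply: contra eS => he; apply: (fintype.subsetP bS); rewrite finset.in_set.
  exact: he.
apply: (IH z) pth ey; move: eb; rewrite /boundary negbK => /eqP eb.
by case/orP: h eb => /andP[/eqP-> /eqP->]; rewrite xX; [move=> <- | move=> ->].
Qed.

Definition touched M (H : model R) (psi : mg_point H -> mg_point M)
    (X : {pred vert H}) : pred (edge M) :=
  fun e => [exists x, (x \in X) && (carrier (psi (Vtx x)) == Some e)].

(* [psi] presents [H] as a subdivision of [M]; [rho] sends an edge of [H] to
   the edge of [M] that contains it. *)
Definition cut_subdivision M (H : model R) (psi : mg_point H -> mg_point M) : Prop :=
  [/\ exists rho : edge H -> edge M,
        (forall a t (h : 0 < t < len a), carrier (psi (Inn h)) = Some (rho a)) /\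
        (forall a x, incident a x -> carrier (psi (Vtx x)) != None ->
           carrier (psi (Vtx x)) = Some (rho a)),
      forall (X : {pred vert H}) x y, x \in X -> y \notin X ->
        carrier (psi (Vtx x)) = None -> carrier (psi (Vtx y)) = None ->
        (3 <= #|boundary X|)%N &
      forall X : {pred vert H}, (forall x, x \in X -> carrier (psi (Vtx x)) != None) ->
        (2 * #|touched psi X| <= #|boundary X|)%N].

Lemma cut_subdivision_id M : edge_connected M 3 -> (2 <= #|edge M|)%N ->
  cut_subdivision (@id (mg_point M)).
Proof.
move=> conn E2; split; first by exists id.
  by move=> X x y xX yX _ _; exact: edge_connected_cut xX yX.
move=> X hX; rewrite (@eq_card0 _ (touched _ X)) // => e.
rewrite unfold_in; apply/negbTE/existsPn => x; rewrite negb_and.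
by apply/orP; left; apply/negP => /hX.
Qed.

Section SubStep.
Variables (H : model R) (e0 : edge H) (t0 : R) (h0 : 0 < t0 < len e0).
Let S := sub_model h0.

Variable X : {pred vert S}.
Let X0 : {pred vert H} := fun v => (Some v : vert S) \in X.

Let bSome e : e != e0 -> boundary X (Some e : edge S) = boundary X0 e.
Proof. by move=> ne; rewrite /boundary /= (negbTE ne). Qed.

Let bSome0 : boundary X (Some e0 : edge S) =
  ((src e0 \in X0) != ((None : vert S) \in X)).
Proof. by rewrite /boundary /= eqxx. Qed.

Let bNone : boundary X (None : edge S) =
  (((None : vert S) \in X) != (tgt e0 \in X0)).
Proof. by []. Qed.

(** Boundary edges other than [e0] survive as they are. If the ends of [e0] are separated, then so
    are those of one of its halves, which takes its place. *)
Lemma sub_boundary_le : (#|boundary X0| <= #|boundary X|)%N.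
Proof.
pose j e : edge S := if boundary X (Some e : edge S) then Some e else None.
have j0 e : boundary X0 e -> j e = None -> e = e0.
  move=> he; rewrite /j; case: ifP => // hb _; apply/eqP; apply: contraFT hb => ne.
  by rewrite bSome.
have inj : {in boundary X0 &, injective j}.
  move=> e e' he he' jj; move: (j0 e he) (j0 e' he') jj; rewrite /j.
  by case: ifP => h1; case: ifP => h2 // k k'; [case | rewrite k // k'].
rewrite -(card_in_image inj); apply: subset_leq_card; apply/fintype.subsetP => a /fintype.imageP[e he ->].
rewrite unfold_in in he; rewrite unfold_in /j; case: ifP => // hb.
have ee : e = e0 by apply: j0 => //; rewrite /j hb.
suff : boundary X (None : edge S) by [].
move: hb he; rewrite ee bSome0 bNone /boundary; case: ((None : vert S) \in X);
by case: (src e0 \in X0); case: (tgt e0 \in X0).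
Qed.

(** Both halves of [e0] enter the boundary, to which [e0] did not belong. *)
Lemma sub_boundary_le2 : (None : vert S) \in X -> src e0 \notin X0 ->
  tgt e0 \notin X0 -> ((#|boundary X0|).+2 <= #|boundary X|)%N.
Proof.
move=> nX s0 t0'.
have b0 : ~~ boundary X0 e0 by rewrite /boundary (negbTE s0) (negbTE t0').
have bs : boundary X (Some e0 : edge S) by rewrite bSome0 nX (negbTE s0).
have bn : boundary X (None : edge S) by rewrite bNone nX (negbTE t0').
rewrite (cardD1 (None : edge S)) [None \in _]bn add1n ltnS.
rewrite (cardD1 (Some e0 : edge S)) inE /= [Some e0 \in _]bs add1n ltnS.
have inj : {in boundary X0 &, injective (Some : edge H -> edge S)} by move=> ? ? _ _ [].
rewrite -(card_in_image inj); apply: subset_leq_card; apply/fintype.subsetP => a /fintype.imageP[e he ->].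
rewrite unfold_in in he.
have ne : e != e0 by apply: contraNneq b0 => <-.
have bx : boundary X (Some e : edge S) by rewrite bSome.
by rewrite !inE /= (inj_eq Some_inj) ne; exact: bx.
Qed.

End SubStep.

(** Boundaries never shrink, so the critical case is a new vertex in [X] on an edge of [M] not yet
    touched: the required bound grows by 2, and both halves of [e0] are new in the boundary. *)
Lemma cut_subdivision_step M (H : model R) (psi : mg_point H -> mg_point M)
  (e0 : edge H) t0 (h0 : 0 < t0 < len e0) : cut_subdivision psi ->
  cut_subdivision (psi \o @sub_map _ _ _ _ h0).
Proof.
move=> [[rho [rhoI rhoV]] cut1 cut2].
have cN : carrier (psi (Inn h0)) = Some (rho e0) by exact: rhoI.
split.
- exists (rho \o @sub_base _ _ _ _ h0); split.
    move=> a t hh; rewrite -(edge_pointE hh) /=.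
    rewrite sub_map_edge; last by case/andP: hh => h1 h2; rewrite !ltW.
    have r : 0 < sub_off a + t < len (sub_base a).
      move: hh; case: a => [e|] /=; last by have := h0; lra.
      by rewrite /sub_base /=; case: eqP => [->|_]; have := h0; lra.
    by rewrite (edge_pointE r).
  move=> a [x|] /=; last first.
    move=> + _; rewrite cN; case: a => [e|] //=; rewrite /incident /=.
    by case: (eqVneq e e0) => [->|ne] /=; rewrite ?orbF.
  move=> hx; apply: rhoV; move: hx; case: a => [e|]; rewrite /incident /sub_base /=.
    case: (eqVneq e e0) => [->|ne] /=; last by rewrite !(inj_eq Some_inj).
    by rewrite orbF (inj_eq Some_inj) => ->.
  by rewrite (inj_eq Some_inj) => ->; rewrite orbT.
- move=> X [x|] [y|] //=; rewrite ?cN // => xX yX hx hy.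
  by apply: leq_trans (sub_boundary_le X); exact: (cut1 _ x y).
move=> X hX; pose X0 : {pred vert H} := fun v => (Some v : vert (sub_model h0)) \in X.
have hX0 x : x \in X0 -> carrier (psi (Vtx x)) != None by move=> /hX.
have IH := cut2 X0 hX0.
have le := sub_boundary_le X.
have tE e : touched (psi \o @sub_map _ _ _ _ h0) X e =
    touched psi X0 e || (((None : vert (sub_model h0)) \in X) && (e == rho e0)).
  apply/existsP/orP => [[[x|] /= /andP[xX hx]]|[/existsP[x hx]|/andP[nX /eqP->]]].
  - by left; apply/existsP; exists x; rewrite hx andbT.
  - by right; rewrite xX /=; move: hx; rewrite cN (inj_eq Some_inj) eq_sym.
  - by exists (Some x).
  by exists None; rewrite /= nX cN eqxx.
have [nX|nX] := boolP ((None : vert (sub_model h0)) \in X); last first.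
  rewrite (eq_card (B := touched psi X0)); first exact: leq_trans IH le.
  by move=> e; rewrite [LHS]tE (negbTE nX) orbF.
have [et|nt] := boolP (touched psi X0 (rho e0)).
  rewrite (eq_card (B := touched psi X0)); first exact: leq_trans IH le.
  move=> e; rewrite [LHS]tE nX /=; case: eqP => [->|_]; last by rewrite orbF.
  by rewrite orbT; apply/esym.
(* An end of [e0] in [X0] would itself lie inside the edge [rho e0] and touch it. *)
have out x : incident e0 x -> x \notin X0.
  move=> ix; apply: contra nt => xX; apply/existsP; exists x; rewrite xX /=.
  by apply/eqP; apply: rhoV ix (hX0 _ xX).
have le2 := sub_boundary_le2 nX (out (src e0) _) (out (tgt e0) _).
have c : #|touched (psi \o @sub_map _ _ _ _ h0) X| = #|touched psi X0|.+1.
  rewrite (cardD1 (rho e0)) [rho e0 \in _]tE nX eqxx orbT add1n; congr S.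
  apply: eq_card => e; rewrite inE /= [e \in touched _ X]tE nX -[RHS]/(touched psi X0 e).
  case: (eqVneq e (rho e0)) => [->|_] /=; last by rewrite orbF.
  by rewrite (negbTE nt).
rewrite c mulnS; apply: leq_trans (le2 _ _); rewrite ?/incident ?eqxx ?orbT //.
Qed.

End Cuts.

(** * Strict trigonality from a divisor of degree 3 *)

Section Necessity.
Context {R : realType}.
Implicit Types (M : model R).

Definition triple M (v : vert M) (a b : mg_point M) (x : mg_point M) : int :=
  pt (Vtx v) x + pt a x + pt b x.

Lemma triple_effective M (v : vert M) a b : effective (triple v a b).
Proof. exact: (effectiveD (effectiveD (pt_effective _) (pt_effective _)) (pt_effective _)). Qed.

Lemma triple_degree M (v : vert M) a b : div_degree (triple v a b) = 3.
Proof.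
rewrite (div_degreeD (is_divisorD (pt_divisor _) (pt_divisor _)) (pt_divisor _)).
by rewrite (div_degreeD (pt_divisor _) (pt_divisor _)) !pt_degree.
Qed.

Lemma effective_sub_pt M (D : mg_point M -> int) p : effective D -> 1 <= D p ->
  effective (fun x => D x - pt p x) /\
  div_degree (fun x => D x - pt p x) = div_degree D - 1.
Proof.
move=> effD Dp; split.
  split; first exact: (is_divisorD effD.1 (is_divisorN (pt_divisor p))).
  move=> x; have := effD.2 x; rewrite /pt; case: eqP => [->|_]; first by lia.
  by rewrite subr0.
by rewrite (div_degreeD effD.1 (is_divisorN (pt_divisor p))) (div_degreeN (pt_divisor p)) pt_degree.
Qed.

Lemma effective_point M (D : mg_point M -> int) : effective D -> 0 < div_degree D ->
  exists p, 1 <= D p.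
Proof. by move=> effD dD; have [p _ hp] := fsumr_gt0 [::] dD; exists p. Qed.

Lemma effective_triple M (D : mg_point M -> int) v : effective D ->
  div_degree D = 3 -> 1 <= D (Vtx v) -> exists a b, D = triple v a b.
Proof.
move=> effD dD Dv; have [eff1 d1] := effective_sub_pt effD Dv.
have [a ha] := effective_point eff1 ltac:(rewrite d1 dD; lia).
have [eff2 d2] := effective_sub_pt eff1 ha.
have [b hb] := effective_pt eff2 ltac:(rewrite d2 d1 dD; lia).
exists a, b; apply/funext => x; have /= := congr1 (fun F => F x) hb.
by rewrite /triple => <-; ring.
Qed.

(* Two chips in the interior of the same edge are pushed apart until one of them
   reaches a vertex. *)
Lemma normal_triple_slide M (D : mg_point M -> int) v (e : edge M) t t'
  (h : 0 < t < len e) (h' : 0 < t' < len e) : t <= t' ->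
  lin_equiv D (triple v (Inn h) (Inn h')) ->
  exists a b, lin_equiv D (triple v a b) /\ (carrier a = None \/ carrier b = None).
Proof.
move=> tt' eqD; pose d := Num.min t (len e - t').
have [d0 dt dt' dd] : [/\ 0 <= d, 0 <= t - d, t' + d <= len e & d = t \/ d = len e - t'].
  by rewrite /d; case: (leP t (len e - t')) => ?; (split; [lra | lra | lra |]); [left | right].
exists (edge_point e (t - d)), (edge_point e (t' + d)); split; last first.
  case: dd => ->; [left | right]; first by rewrite subrr edge_point0.
  by rewrite addrC subrK edge_point_len.
apply: lin_equiv_trans eqD _; apply: lin_equiv_sym.
have := @slide_equiv _ _ e (t - d) t' d dt d0 ltac:(lra) dt'.
rewrite subrK (edge_pointE h) (edge_pointE h') => /(lin_equiv_shift (pt (Vtx v))).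
have E (a b : mg_point M) : triple v a b = (fun x => pt a x + pt b x + pt (Vtx v) x).
  by apply/funext => x; rewrite /triple; ring.
by rewrite !E.
Qed.

Lemma normal_triple M (D : mg_point M -> int) v a b : lin_equiv D (triple v a b) ->
  exists a b, lin_equiv D (triple v a b) /\ (carrier a = carrier b -> carrier a = None).
Proof.
have tC (x y : mg_point M) : triple v x y = triple v y x.
  by apply/funext => z; rewrite /triple addrAC.
case: a b => [w|e t h] [w'|e' t' h'] eqD.
- by exists (Vtx w), (Vtx w').
- by exists (Vtx w), (Inn h').
- by exists (Inn h), (Vtx w').
have [ee|ne] := eqVneq e e'; last by exists (Inn h), (Inn h'); split=> //= -[e1]; rewrite e1 eqxx in ne.
subst e'; suff [x [y [h1 h2]]] : exists a b, lin_equiv D (triple v a b) /\ (carrier a = None \/ carrier b = None).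
  by exists x, y; split=> // hxy; case: h2 => // <-.
have [tt'|/ltW tt'] := leP t t'; first exact: normal_triple_slide eqD.
by rewrite tC in eqD; exact: normal_triple_slide eqD.
Qed.

Lemma sum_pt M (H : model R) (psi : mg_point H -> mg_point M) (X : {pred vert H}) q :
  bijective psi -> \sum_(w in X) pt q (psi (Vtx w)) =
    ([exists w, (w \in X) && (psi (Vtx w) == q)] : nat)%:Z.
Proof.
move=> bpsi; case: existsP => [[w /andP[wX /eqP hw]]|h]; last first.
  rewrite big1 // => w wX; rewrite /pt; case: eqP => // hw.
  by case: h; exists w; rewrite wX hw eqxx.
rewrite (bigD1 w) //= big1 ?addr0; first by rewrite /pt hw eqxx.
move=> w' /andP[_ ne]; rewrite /pt -hw; case: eqP => // /(bij_inj bpsi)[e1].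
by rewrite e1 eqxx in ne.
Qed.

(** The chip at [v] is outside [X]. If at most one of [a] and [b] is in [X], one chip faces a bound
    of at least 2; if both are, they lie in different edges and the bound is at least 4. *)
Lemma triple_mass M (H : model R) (psi : mg_point H -> mg_point M) (X : {pred vert H})
  v a b w0 : bijective psi -> (forall w, w \in X -> carrier (psi (Vtx w)) != None) ->
  (carrier a = carrier b -> carrier a = None) -> w0 \in X ->
  \sum_(w in X) triple v a b (psi (Vtx w)) < (2 * #|touched psi X|)%N%:Z.
Proof.
move=> bpsi hX hab w0X; rewrite big_split big_split /= !sum_pt //.
have nv : [exists w, (w \in X) && (psi (Vtx w) == Vtx v)] = false.
  apply/negbTE/existsPn => w; apply/negP => /andP[/hX + /eqP e1].
  by rewrite e1.
rewrite nv add0r.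
have tp q : [exists w, (w \in X) && (psi (Vtx w) == q)] -> exists2 e, touched psi X e & carrier q = Some e.
  move=> /existsP[w /andP[wX /eqP <-]]; have := hX _ wX; case ce : (carrier _) => [e|] // _.
  by exists e => //; apply/existsP; exists w; rewrite wX ce eqxx.
have t1 : (0 < #|touched psi X|)%N.
  have := hX _ w0X; case ce : (carrier _) => [e|] // _; apply/card_gt0P; exists e.
  by apply/existsP; exists w0; rewrite w0X ce eqxx.
case: (boolP [exists w, (w \in X) && (psi (Vtx w) == a)]) => [/tp[e1 te1 ce1]|_]; last first.
  by case: [exists w, _] => /=; lia.
case: (boolP [exists w, (w \in X) && (psi (Vtx w) == b)]) => [/tp[e2 te2 ce2]|_] /=; last by lia.
have ne : e1 != e2.
  by apply/eqP => ee; have := hab; rewrite ce1 ce2 ee => /(_ erefl).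
have : (2 <= #|touched psi X|)%N.
  by rewrite (cardD1 e1) [e1 \in _]te1 (cardD1 e2) !inE eq_sym ne [e2 \in _]te2.
lia.
Qed.

Lemma trigonal_strictly M : loopless M -> edge_connected M 3 ->
  (4 <= #|vert M|)%N -> divisorially_trigonal M -> strictly_trigonal M.
Proof.
move=> ll conn V4 /trigonal_points[D0 [hD0 dD0 hp]].
have E3 : (3 <= #|edge M|)%N.
  have := leq_trans V4 (card_vert_connected (@graph_conn M)).
  by rewrite ltnS => h; exact: leq_trans h (max_card _).
have hN v : exists ab : mg_point M * mg_point M, lin_equiv D0 (triple v ab.1 ab.2) /\
    (carrier ab.1 = carrier ab.2 -> carrier ab.1 = None).
  have [E [effE Ev dE eqE]] := hp (Vtx v).
  have [a [b hE]] := effective_triple effE dE Ev; rewrite hE in eqE.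
  by have [a' [b' hab]] := normal_triple eqE; exists (a', b').
have [N {}hN] := boolp.choice hN.
pose Dv v := triple v (N v).1 (N v).2.
have [v0 _] := card_gt0P (vert_gt0 M).
have hf v : exists f, rational_function f /\ forall x, Dv v x - Dv v0 x = div_of f x.
  have [f rf hf] : lin_equiv (Dv v) (Dv v0).
    by apply: lin_equiv_trans (lin_equiv_sym (hN v).1) (hN v0).1.
  by exists f.
have [f {}hf] := boolp.choice hf.
have [H [psi [ipsi [_ cut1 cut2] hV hs hw]]] := @subdivision_ind _ M (@cut_subdivision _ M)
  (cut_subdivision_id conn (ltnW E3)) (fun H psi e t h _ => @cut_subdivision_step _ M H psi e t h)
  (flatten [seq [:: (N v).1; (N v).2] | v <- enum (vert M)]).
(* Every vertex of [H] is a vertex of [M] or one of the points [N v], hence in the support of some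
   [Dv v]. *)
have hi w : exists v, 1 <= Dv v (psi (Vtx w)).
  have pge (x y : mg_point M) : 0 <= pt x y by [].
  have pself (x : mg_point M) : pt x x = 1 by rewrite /pt eqxx.
  have tge v x : [\/ x = Vtx v, x = (N v).1 | x = (N v).2] -> 1 <= Dv v x.
    have := pge (Vtx v) x; have := pge (N v).1 x; have := pge (N v).2 x.
    by rewrite /Dv /triple => h1 h2 h3 [] xq; rewrite -xq pself; lia.
  have [[v hv]|/flattenP[_ /mapP[v _ ->]]] := hw w; first by exists v; apply: tge; apply: Or31.
  by rewrite !inE => /orP[] /eqP hv; exists v; apply: tge; [apply: Or32 | apply: Or33].
have [i {}hi] := boolp.choice hi.
have D_inn v (e : edge H) t (h : 0 < t < len e) : Dv v (psi (Inn h)) = 0.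
  rewrite /Dv /triple /pt.
  have [w0 e0] := hV v.
  have inN q : q \in [:: (N v).1; (N v).2] -> exists w, psi (Vtx w) = q.
    by move=> hq; apply: hs; apply/flattenP; exists [:: (N v).1; (N v).2] => //; apply: map_f; rewrite mem_enum.
  have [w1 e1] := inN (N v).1 (mem_head _ _).
  have [w2 e2] := inN (N v).2 ltac:(by rewrite !inE eqxx orbT).
  have ne w : (psi (Inn h) == psi (Vtx w)) = false by apply/eqP => /(bij_inj ipsi.1).
  by rewrite -e0 -e1 -e2 !ne.
have lf v := (rational_locally_linear (f v)).1 (hf v).1.
have hk v : exists k : edge H -> int, forall e t, 0 <= t <= len e ->
    (f v \o psi) (edge_point e t) = (f v \o psi) (edge_point e 0) + (k e)%:~R * t.
  have hke e : exists k : int, forall t, 0 <= t <= len e ->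
      (f v \o psi) (edge_point e t) = (f v \o psi) (edge_point e 0) + k%:~R * t.
    apply: (@edge_affine _ _ (f v \o psi) e) => [|t h].
      exact/rational_locally_linear/locally_linear_isometry.
    by rewrite div_of_isometry // -(hf v).2 !D_inn subrr.
  by have [k hk] := boolp.choice hke; exists k.
have [k {}hk] := boolp.choice hk.
pose D (x w : vert H) : int := Dv (i x) (psi (Vtx w)).
pose p (x w : vert H) : R := f (i x) (psi (Vtx w)).
have noloop (e : edge H) : src e != tgt e.
  by apply: ll; exists psi.
have DD x : D x x >= 1 by exact: hi.
have [T [treeT [phi [mm harm nondeg deg]]]] :
  exists T : model R, is_tree T /\ exists phi : indexed_morphism H T,
    [/\ metric_morphism phi, is_harmonic phi, is_nondegenerate phi & degree phi = 3%N].
  have [r0 _] := card_gt0P (vert_gt0 H).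
  apply: (@discrete_tree R H D (fun w => Dv v0 (psi (Vtx w))) p (fun x => k (i x)) _ _ _ _ DD _ r0 noloop).
  - move=> x e; have := hk (i x) e (len e) ltac:(by rewrite len_ge0 lexx).
    by rewrite edge_point0 edge_point_len /p /= => ->; rewrite addrC addKr.
  - move=> x w; rewrite -(affine_div w (hk (i x))) div_of_isometry // -(hf (i x)).2.
    by [].
  - by move=> x w; exact: (triple_effective _ _ _).2.
  - move=> x; have := div_degree_isometry (Dv (i x)) ipsi; rewrite triple_degree => <-.
    by rewrite (vtx_support _).2 // => e t h; exact: D_inn.
  - move=> X a b aX bX.
    (* Counting chips settles the case in which [X] or its complement contains no vertex of [M];
       otherwise the 3-edge-connectivity of [M] applies. *)
    have avoid (Y : {pred vert H}) w : w \in Y -> (forall w, w \in Y -> carrier (psi (Vtx w)) != None) ->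
        forall x, mass D x Y < #|boundary Y|%:Z.
      move=> wY hY x; apply: lt_le_trans (triple_mass (i x) ipsi.1 hY (hN (i x)).2 wY) _.
      by rewrite lez_nat; exact: cut2.
    have [/existsP[x /andP[xX /eqP hx]]|/existsPn hX] := boolP [exists x, (x \in X) && (carrier (psi (Vtx x)) == None)]; last first.
      apply: Or32; apply: (avoid X a aX) => w wX; apply/negP => hwn.
      by have := hX w; rewrite wX hwn.
    have [/existsP[y /andP[yX /eqP hy]]|/existsPn hY] := boolP [exists y, (y \notin X) && (carrier (psi (Vtx y)) == None)].
      by apply: Or31; exact: cut1 xX yX hx hy.
    apply: Or33; rewrite -(boundaryC X); apply: (avoid (predC X) b); first by rewrite inE.
    by move=> w; rewrite inE /= => wX; apply/negP => hwn; have := hY w; rewrite wX hwn.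
  have [x hx] := hV v0.
  (* The support of a triple has at most three points, so one of the four or more vertices of [M] is
     missed. The divisor of that vertex is then a different one. *)
  have [w hw0] : exists w : vert M, Dv (i x) (Vtx w) = 0.
    apply: contrapT => hall.
    pose ok q : pred (vert M) := fun w => Vtx w == q.
    have c1 q : (#|ok q| <= 1)%N.
      by apply/card_le1_eqP => w w'; rewrite !unfold_in /ok => /eqP h1 /eqP; rewrite -h1 => -[].
    pose A := ok (Vtx (i x)); pose B := ok (N (i x)).1; pose C := ok (N (i x)).2.
    have cov : (#|vert M| <= #|[predU A & [predU B & C]]|)%N.
      apply: subset_leq_card; apply/fintype.subsetP => w _; rewrite !inE.
      apply/negPn/negP => h; apply: hall; exists w; move: h; rewrite /Dv /triple /pt.
      rewrite -[w \in A]/(Vtx w == Vtx (i x)) -[w \in B]/(Vtx w == (N (i x)).1).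
      rewrite -[w \in C]/(Vtx w == (N (i x)).2).
      by case: (Vtx w == Vtx (i x)); case: (Vtx w == (N (i x)).1); case: (Vtx w == (N (i x)).2).
    have u1 : (#|[predU B & C]| <= #|B| + #|C|)%N by rewrite -cardUI leq_addr.
    have u0 : (#|[predU A & [predU B & C]]| <= #|A| + #|[predU B & C]|)%N.
      by rewrite -cardUI leq_addr.
    by have := leq_trans V4 (leq_trans cov (leq_trans u0
      (leq_add (c1 _) (leq_trans u1 (leq_add (c1 _) (c1 _)))))).
  have [y hy] := hV w; exists x, y => exy.
  by have := DD y; rewrite -exy /D hy hw0.
(* [metric_tree] concerns every model of [T], whence the use of the invariance of the genus. *)
have mT : metric_tree T.
  by move=> H1 [q hq]; rewrite /is_tree (genus_isometry (hq : isometry q)).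
exists T; split=> //; exists H, T, phi; split; split=> //; first by exists psi.
by exists id; exact: isometry_id.
Qed.

End Necessity.

Lemma is_model_isometry (R : realType) (M M' H : model R)
    (psi : mg_point M' -> mg_point M) :
  isometry psi -> is_model M' H -> is_model M H.
Proof. by move=> ipsi [q hq]; exists (psi \o q); exact: isometry_comp hq ipsi. Qed.

Theorem theorem3p3 (R : realType) (Gam M0 : model R)
    (hloopless : loopless Gam)
    (hgenus : (2 <= genus Gam)%N)
    (hcanonical : canonical_model Gam M0)
    (hconn : edge_connected M0 3) :
  ((#|vert M0| = 2%N \/ #|vert M0| = 3%N) \/ strictly_trigonal Gam) <->
  divisorially_trigonal Gam.
Proof.
have [[psi ipsi] _ _] := hcanonical; rewrite -/(isometry psi) in ipsi.
have [phi [iphi _ _]] := isometry_inv ipsi.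
have ll : loopless M0 by move=> H /(is_model_isometry ipsi)/hloopless.
split=> [[hV|st]|tri].
- exact: trigonal_isometry iphi (few_vertices_trigonal ll hV).
- exact: strictly_trigonal_divisorially.
have [V4|V4] := leqP 4 #|vert M0|.
  right; have [T [mT [H [H' [f [[isoH isoH' mm] hf]]]]]] :=
    trigonal_strictly ll hconn V4 (trigonal_isometry ipsi tri).
  exists T; split=> //; exists H, H', f; split=> //; split=> //.
  exact: is_model_isometry ipsi isoH.
left; have V0 := vert_gt0 M0.
(* A loopless graph with a single vertex has no edges and genus 0. *)
have [V1|] := eqVneq #|vert M0| 1%N; last by lia.
exfalso; move: hgenus; rewrite -(genus_isometry ipsi) /genus V1 subn1 /=.
case: (pickP (edge M0)) => [e _ _|E0]; last by rewrite eq_card0.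
have /negP[] := ll M0 (ex_intro _ id (isometry_id M0)) e.
by apply/eqP; have /card_le1_eqP := eq_leq V1; apply.
Qed.
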